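(* Let $\nu>0$ be a fixed parameter and let $f_0\in A^1(\mathbb{T})$ satisfy $$\|f_0\|_{\dot A^1}<\frac12 .$$ Then the Cauchy problem $$\partial_t f=-\nu\Lambda^3 f-\Lambda f+\partial_x\Big([\mathcal{H},f]\big(\nu\Lambda^3 f+\Lambda f\big)\Big),\qquad f|_{t=0}=f_0,$$ is globally well-posed, in the sense that it admits a unique global solution $$f\in L^\infty(\mathbb{R}_+;A^1(\mathbb{T}))\cap\mathcal{M}(\mathbb{R}_+;A^4(\mathbb{T})),$$ and this solution satisfies, for $t\ge0$, $$\|f(t)\|_{A^1}\le\|f_0\|_{A^1}\qquad\text{and}\qquad\|f(t)\|_{A^0}\le\|f_0\|_{A^0}\,e^{-(1-2\|f_0\|_{A^1})(1+\nu)t}.$$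
   Context: $\mathbb{T}=\mathbb{R}/2\pi\mathbb{Z}$. For a function $u$ on $\mathbb{T}$ the Fourier coefficients are $\hat u(n)=\frac{1}{\sqrt{2\pi}}\int_{\mathbb{T}}u(x)e^{-inx}\,dx$, so that $u(x)=\frac{1}{\sqrt{2\pi}}\sum_{n\in\mathbb{Z}}\hat u(n)e^{inx}$. The Hilbert transform $\mathcal{H}$ and the operator $\Lambda$ are the Fourier multipliers $\widehat{\mathcal{H}u}(n)=-i\,\mathrm{sgn}(n)\hat u(n)$ and $\widehat{\Lambda u}(n)=|n|\hat u(n)$. The commutator is $[\mathcal{H},f]g=\mathcal{H}(fg)-f\,\mathcal{H}g$. Expanded, the equation reads $$\partial_t f+\nu\Lambda^3 f+\Lambda f=\nu\big[\Lambda(f\Lambda^3 f)-\partial_x(f\partial_x^3 f)\big]+\big[\Lambda(f\Lambda f)+\partial_x(f\partial_x f)\big].$$ All functions are real-valued and have zero average (the equation conserves the average). For $\alpha\ge0$ the Wiener space $A^\alpha(\mathbb{T})=\dot A^\alpha(\mathbb{T})$ consists of the zero-average functions $u$ with $\|u\|_{A^\alpha}=\|u\|_{\dot A^\alpha}=\sum_{k\in\mathbb{Z}}|k|^\alpha|\hat u(k)|<\infty$. $\mathcal{M}(\mathbb{R}_+;X)$ denotes the space of measures on $\mathbb{R}_+=[0,\infty)$ with values in the Banach space $X$. A solution is understood in the sense of distributions with the initial datum attained at $t=0$. *)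

(* Defs.v *)
From mathcomp Require Import all_boot all_order all_algebra complex.
From mathcomp Require Import all_classical all_reals all_analysis.

Set Implicit Arguments.
Unset Strict Implicit.
Unset Printing Implicit Defensive.

Import Order.TTheory GRing.Theory Num.Theory.
Import numFieldNormedType.Exports.

Local Open Scope classical_set_scope.
Local Open Scope ring_scope.

Notation leb R := (@lebesgue_measure R).

(* Functions on T = R/2piZ are 2pi-periodic functions R -> R, integrated over
   [0, 2pi] and understood up to Lebesgue-negligible sets. *)
Definition circle (R : realType) : set R := `[0, 2 * pi]%classic.
Arguments circle : clear implicits.

Definition half_line (R : realType) : set R := `[0, +oo[%classic.
Arguments half_line : clear implicits.

Definition cintegral (R : realType) (D : set R) (F : R -> R[i]) : R[i] :=
  Complex (\int[leb R]_(x in D) complex.Re (F x))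
          (\int[leb R]_(x in D) complex.Im (F x)).

Definition cis (R : realType) (a : R) : R[i] := Complex (cos a) (sin a).

Definition fourier (R : realType) (u : R -> R) (n : int) : R[i] :=
  real_complex _ (Num.sqrt (2 * pi))^-1 *
  cintegral (circle R) (fun x => real_complex _ (u x) * cis (- (n%:~R * x))).

(* Real-valued synthesis (2pi)^(-1/2) \sum_n m(n) u^(n) e^{inx}, as the limit of
   the symmetric partial sums over |n| <= N. For real u and a symbol with
   m(-n) = conj (m n) these partial sums are real, so Re discards nothing. *)
Definition multiplier (R : realType) (m : int -> R[i]) (u : R -> R) : R -> R :=
  fun x => limn (fun N : nat =>
    (Num.sqrt (2 * pi))^-1 *
    complex.Re (\sum_(j < N.*2.+1)
          let n : int := (j : nat)%:Z - N%:Z in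
          m n * fourier u n * cis (n%:~R * x))).

Definition hilbert (R : realType) : (R -> R) -> R -> R :=
  multiplier (fun n => - (Complex 0 1) * (sgz n)%:~R).

(* The power Lambda^s, for a natural number s. *)
Definition Lambda (R : realType) (s : nat) : (R -> R) -> R -> R :=
  multiplier (fun n => (absz n)%:R ^+ s).

Definition hilbert_comm (R : realType) (f g : R -> R) : R -> R :=
  fun x => hilbert (fun y => f y * g y) x - f x * hilbert g x.

(* Homogeneous Wiener norm; it may be +oo. Here 0 `^ 0 = 1. *)
Definition wiener_norm (R : realType) (alpha : R) (u : R -> R) : \bar R :=
  \esum_(k in [set: int])
    (((absz k)%:R `^ alpha) * Normc.normc (fourier u k))%:E.

Definition wiener (R : realType) (alpha : R) (u : R -> R) : Prop :=
  [/\ periodic u (2 * pi),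
      (leb R).-integrable (circle R) (EFin \o u),
      \int[leb R]_(x in circle R) u x = 0
    & (wiener_norm alpha u < +oo)%E].

(* Bochner measurability of f : R_+ -> A^alpha. Every class of
   almost-everywhere equal strongly measurable functions has a representative
   for which the approximation by simple functions holds at every t >= 0. *)
Definition wiener_simple (R : realType) (alpha : R) (s : R -> R -> R) : Prop :=
  exists (n : nat) (E : 'I_n -> set R) (v : 'I_n -> R -> R),
    [/\ forall i, measurable (E i),
        forall i, wiener alpha (v i)
      & forall t x, s t x = \sum_(i < n) \1_(E i) t * v i x].

Definition wiener_measurable (R : realType) (alpha : R) (f : R -> R -> R) :
    Prop :=
  exists s : nat -> R -> R -> R,
    (forall j, wiener_simple alpha (s j)) /\
    forall t, 0 <= t ->
      wiener_norm alpha (fun x => f t x - s j t x) @[j --> \oo] --> 0%E.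

Definition Linfty_wiener (R : realType) (alpha : R) (f : R -> R -> R) : Prop :=
  [/\ forall t, 0 <= t -> wiener alpha (f t),
      wiener_measurable alpha f
    & exists M : R,
        {ae leb R, forall t, 0 <= t -> (wiener_norm alpha (f t) <= M%:E)%E}].

(* Elements of M(R_+; A^alpha): countably additive A^alpha-valued set functions
   on the Borel subsets of R_+, of bounded variation. *)
Definition wiener_vmeasure (R : realType) (alpha : R) (m : set R -> R -> R) :
    Prop :=
  [/\ forall E, measurable E -> E `<=` half_line R -> wiener alpha (m E),
      forall F : nat -> set R,
        (forall i, measurable (F i)) -> (forall i, F i `<=` half_line R) ->
        trivIset setT F ->
        wiener_norm alpha
          (fun x => m (\bigcup_i F i) x - \sum_(i < n) m (F i) x)
          @[n --> \oo] --> 0%E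
    & exists C : R, forall (n : nat) (F : 'I_n -> set R),
        (forall i, measurable (F i)) -> (forall i, F i `<=` half_line R) ->
        trivIset setT F ->
        (\sum_(i < n) wiener_norm alpha (m (F i)) <= C%:E)%E].

(* f, as the vector measure E |-> \int_E f(t) dt, belongs to M(R_+; A^alpha);
   the integral over a bounded E is identified by its Fourier coefficients. *)
Definition in_wiener_vmeasure (R : realType) (alpha : R) (f : R -> R -> R) :
    Prop :=
  exists m : set R -> R -> R, wiener_vmeasure alpha m /\
    forall (T : R) (E : set R), measurable E -> E `<=` `[0, T]%classic ->
      forall n : int,
        fourier (m E) n = cintegral E (fun t => fourier (f t) n).

(* C^oo: all iterated directional derivatives exist and are continuous. *)
Definition smooth (R : realType) (V : normedModType R) (phi : V -> R^o) :
    Prop :=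
  forall vs : seq V,
    let g := foldr (fun v (h : V -> R^o) => 'D_v h) phi vs in
    continuous g /\ forall z v, derivable g z v.

Definition circle_test (R : realType) (psi : R -> R) : Prop :=
  smooth (psi : R^o -> R^o) /\ periodic psi (2 * pi).

(* Test functions on [0, +oo) x T, the argument being (t, x); they need not
   vanish at t = 0, and their values at t < 0 are irrelevant. *)
Definition spacetime_test (R : realType) (phi : R^o * R^o -> R^o) : Prop :=
  [/\ smooth phi,
      forall t, periodic (fun x : R => phi (t, x)) (2 * pi)
    & exists T : R, forall t x, T <= t -> phi (t, x) = 0].

(* Distributional form of
     f_t = - g + ([H, f] g)_x,  g = nu Lambda^3 f + Lambda f,  f(0) = f0. *)
Definition weak_equation (R : realType) (nu : R) (f0 : R -> R)
    (f : R -> R -> R) : Prop :=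
  forall phi : R^o * R^o -> R^o, spacetime_test phi ->
    let g := fun (t x : R) => nu * Lambda 3 (f t) x + Lambda 1 (f t) x in
    \int[leb R]_(t in half_line R) \int[leb R]_(x in circle R)
        (f t x * 'D_((1, 0) : R^o * R^o) phi (t, x))
    + \int[leb R]_(x in circle R) (f0 x * phi (0, x))
    = \int[leb R]_(t in half_line R) \int[leb R]_(x in circle R)
        (g t x * phi (t, x)
         + hilbert_comm (f t) (g t) x * 'D_((0, 1) : R^o * R^o) phi (t, x)).

Definition global_solution (R : realType) (nu : R) (f0 : R -> R)
    (f : R -> R -> R) : Prop :=
  [/\ Linfty_wiener 1 f, in_wiener_vmeasure 4 f & weak_equation nu f0 f].

(* The value f(t) is meaningful at every t >= 0 for the representative of f
   that is continuous in time with values in distributions on T. *)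
Definition weakly_continuous (R : realType) (f : R -> R -> R) : Prop :=
  forall psi : R -> R, circle_test psi ->
    {within half_line R,
      continuous (fun t : R => \int[leb R]_(x in circle R) (f t x * psi x))}.

(* Main.v *)
(* In Fourier variables the equation is a system of scalar equations
   a_n' = - lam_n a_n + N_n(a, a), lam_n = nu N^3 + N with N = n + 1, where, owing to a
   cancellation in the commutator, N_n only involves products a_{n+k+1} conj(a_k). Hence
     sum_n N |N_n(a, b)| <= 2c (sum_n N lam_n |a_n|) (sum_n N |b_n|), c = (2 pi)^{-1/2},
   and 2c < 1: for data of size < 1/4 (A^1 norm < 1/2, each frequency counted twice) the
   dissipation absorbs the nonlinearity. Picard iteration in the space with norm
   sup_t sum N |a_n(t)| + int sum N lam_n |a_n| converges to a mild solution, and the same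
   estimate applied to a and to e^{gt} a gives the two decay bounds.

   Conversely, let h be a solution. The bounded variation of the vector measure h dt shows,
   on cells where the real and imaginary parts of finitely many modes have constant signs,
   that int sum N lam_n |h_n| is finite. Testing the weak equation against
   theta(t) Re (v e^{iNx}) with theta' - lam_n theta close to - e^{lam_n t} 1_[0,tau[ shows
   that the modes of h satisfy Duhamel's formula, and a Gronwall argument, using the smallness
   of the constructed solution only, identifies them with those of f. *)
From HB Require Import structures.
Require Import Defs.
From mathcomp Require Import all_boot all_order all_algebra complex.
From mathcomp Require Import all_classical all_reals all_analysis.
From mathcomp Require finmap.
From mathcomp Require Import measurable_realfun ring lra.
Set Implicit Arguments.
Unset Strict Implicit.
Unset Printing Implicit Defensive.

Import Order.TTheory GRing.Theory Num.Theory.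
Import numFieldNormedType.Exports.

Local Open Scope classical_set_scope.
Local Open Scope ring_scope.

(** * Complex-valued integrals *)

(** The margin [2 c < 1] amounts to [pi > 2]. The cancellation in the commutator matters because the
    surviving products always put the higher frequency on the same factor: the dissipation of that
    factor and the A^1 norm of the other one then suffice.

    Uniqueness compares the small solution [a] with a solution [b] of which only finiteness is
    known. With [w = a - b] the forcing splits as [N(w, a) + N(b, w)]: the dissipation of [w]
    absorbs the first term since [a] is small, and the second is the A^1 size of [w] times an
    integrable function of time.

    Two obstacles shape the analysis. The dissipation is finite at almost every time only, and
    elsewhere the multipliers in the weak equation have no controlled value; integrals are therefore
    compared up to null sets, also for integrands of unknown measurability. Moreover a real test
    function only sees the real part of a mode times a constant [v], so complex identities come from
    [v = 1] and [v = i]. Series are integrals for the counting measure, so that sums, time and space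
    integrals share one set of norm and Fubini lemmas. *)

Notation cRe := complex.Re.
Notation cIm := complex.Im.
Notation cnorm := Normc.normc.

Section ComplexNumbers.
Context {R : realType}.
Implicit Types z w : R[i].

Lemma cReD z w : cRe (z + w) = cRe z + cRe w. Proof. by case: z w => ? ? []. Qed.
Lemma cImD z w : cIm (z + w) = cIm z + cIm w. Proof. by case: z w => ? ? []. Qed.
Lemma cReN z : cRe (- z) = - cRe z. Proof. by case: z. Qed.
Lemma cImN z : cIm (- z) = - cIm z. Proof. by case: z. Qed.
Lemma cReM z w : cRe (z * w) = cRe z * cRe w - cIm z * cIm w.
Proof. by case: z w => ? ? []. Qed.
Lemma cImM z w : cIm (z * w) = cRe z * cIm w + cIm z * cRe w.
Proof. by case: z w => ? ? []. Qed.
Lemma cReJ z : cRe (conjc z) = cRe z. Proof. by case: z. Qed.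
Lemma cImJ z : cIm (conjc z) = - cIm z. Proof. by case: z. Qed.

Lemma complex_ext z w : cRe z = cRe w -> cIm z = cIm w -> z = w.
Proof. by case: z w => ? ? [? ?] /= -> ->. Qed.

Lemma cnorm_sqr z : cnorm z ^+ 2 = cRe z ^+ 2 + cIm z ^+ 2.
Proof. by case: z => a b; rewrite sqr_sqrtr// addr_ge0// sqr_ge0. Qed.

Lemma cnorm_ge0 z : 0 <= cnorm z.
Proof. by case: z => a b; rewrite sqrtr_ge0. Qed.

Lemma cnormD z w : cnorm (z + w) <= cnorm z + cnorm w.
Proof. exact: le_normcD. Qed.

Lemma cnormN z : cnorm (- z) = cnorm z.
Proof. by case: z => a b /=; rewrite !sqrrN. Qed.

Lemma cnormB z w : cnorm (z - w) <= cnorm z + cnorm w.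
Proof. by rewrite (le_trans (cnormD _ _))// cnormN. Qed.

Lemma cnormJ z : cnorm (conjc z) = cnorm z.
Proof. by case: z => a b /=; rewrite !sqrrN. Qed.

Lemma cnormR (x : R) : cnorm (real_complex R x) = `|x|.
Proof. by rewrite /= expr0n/= addr0 sqrtr_sqr. Qed.

Lemma cnorm_cis (x : R) : cnorm (cis x) = 1.
Proof. by rewrite /= cos2Dsin2 sqrtr1. Qed.

Lemma Re_le_cnorm z : `|cRe z| <= cnorm z.
Proof.
case: z => a b /=; rewrite -[X in X <= _]sqrtr_sqr ler_sqrt ?addr_ge0 ?sqr_ge0//.
by rewrite lerDl sqr_ge0.
Qed.

Lemma Im_le_cnorm z : `|cIm z| <= cnorm z.
Proof.
case: z => a b /=; rewrite -[X in X <= _]sqrtr_sqr ler_sqrt ?addr_ge0 ?sqr_ge0//.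
by rewrite lerDr sqr_ge0.
Qed.

Lemma cnorm_le z : cnorm z <= `|cRe z| + `|cIm z|.
Proof.
rewrite -(ler_pXn2r (n := 2))// ?nnegrE ?cnorm_ge0 ?addr_ge0//.
rewrite cnorm_sqr sqrrD !real_normK ?num_real// addrAC lerDl mulrn_wge0// mulr_ge0//.
Qed.

End ComplexNumbers.

Section ComplexIntegral.
Context {d} {T : measurableType d} {R : realType}.
Variable mu : {measure set T -> \bar R}.
Implicit Types (D : set T) (F G : T -> R[i]) (f : T -> R).

(** The measure is arbitrary, so that one theory covers integrals in space, integrals in time and,
    with the counting measure, absolutely convergent series. *)
Definition cint D F : R[i] :=
  Complex (\int[mu]_(x in D) cRe (F x)) (\int[mu]_(x in D) cIm (F x)).

Definition cmeas D F :=
  measurable_fun D (fun x => cRe (F x)) /\ measurable_fun D (fun x => cIm (F x)).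

Definition cintegrable D F :=
  mu.-integrable D (fun x => (cRe (F x))%:E) /\
  mu.-integrable D (fun x => (cIm (F x))%:E).

Lemma cmeasD D F G : cmeas D F -> cmeas D G -> cmeas D (fun x => F x + G x).
Proof.
move=> [F1 F2] [G1 G2]; split; under eq_fun do rewrite ?(cReD, cImD);
exact: measurable_funD.
Qed.

Lemma cmeasN D F : cmeas D F -> cmeas D (fun x => - F x).
Proof.
move=> [F1 F2]; split; under eq_fun do rewrite ?(cReN, cImN);
exact: measurableT_comp.
Qed.

Lemma cmeasJ D F : cmeas D F -> cmeas D (fun x => conjc (F x)).
Proof.
move=> [F1 F2]; split; first by under eq_fun do rewrite cReJ.
by under eq_fun do rewrite cImJ; exact: measurableT_comp.
Qed.

Lemma cmeasM D F G : cmeas D F -> cmeas D G -> cmeas D (fun x => F x * G x).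
Proof.
move=> [F1 F2] [G1 G2]; split; under eq_fun do rewrite ?(cReM, cImM).
  by apply: measurable_funB; exact: measurable_funM.
by apply: measurable_funD; exact: measurable_funM.
Qed.

Lemma cmeas_cst D z : cmeas D (fun=> z).
Proof. by split; exact: measurable_cst. Qed.

Lemma cmeasR D f : measurable_fun D f -> cmeas D (fun x => real_complex R (f x)).
Proof. by move=> mf; split => //=; exact: measurable_cst. Qed.

Lemma cmeasS D D' F : measurable D' -> D `<=` D' -> cmeas D' F -> cmeas D F.
Proof. by move=> mD DD' [? ?]; split; exact: measurable_funS DD' _. Qed.

Lemma cmeas_norm D F : cmeas D F -> measurable_fun D (fun x => cnorm (F x)).
Proof.
move=> [F1 F2].
rewrite (_ : (fun _ => _) = Num.sqrt \o (fun x => cRe (F x) ^+ 2 + cIm (F x) ^+ 2)).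
  apply: measurableT_comp; last first.
    by apply: measurable_funD; exact: measurable_funX.
  by apply: continuous_measurable_fun; exact: sqrt_continuous.
by apply/funext => x /=; case: (F x).
Qed.

(** Since [|Re z|, |Im z| <= |z| <= |Re z| + |Im z|], integrability of the two components is a
    single condition on the norm, the only quantity estimated later. *)
Lemma cintegrableP D F : measurable D ->
  cintegrable D F <-> cmeas D F /\ (\int[mu]_(x in D) (cnorm (F x))%:E < +oo)%E.
Proof.
move=> mD; split.
  move=> [i1 i2]; have mF : cmeas D F.
    by split; apply/measurable_EFinP; exact: (measurable_int mu).
  split => //; have i12 := integrableD mD (integrable_abse i1) (integrable_abse i2).
  have /integrableP[_] := i12; apply: le_lt_trans.
  apply: ge0_le_integral => //.
  - by move=> x _; rewrite lee_fin cnorm_ge0.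
  - by apply/measurable_EFinP; exact: cmeas_norm.
  - apply: measurableT_comp => //; exact: measurable_int i12.
  - by move=> x _ /=; rewrite lee_fin ger0_norm ?addr_ge0// cnorm_le.
move=> [[m1 m2] fin]; split; apply/integrableP; split.
- exact/measurable_EFinP.
- apply: le_lt_trans fin; apply: ge0_le_integral => //.
  + by apply/measurable_EFinP; exact: measurableT_comp.
  + by apply/measurable_EFinP; exact: cmeas_norm.
  + by move=> x _; rewrite lee_fin Re_le_cnorm.
- exact/measurable_EFinP.
- apply: le_lt_trans fin; apply: ge0_le_integral => //.
  + by apply/measurable_EFinP; exact: measurableT_comp.
  + by apply/measurable_EFinP; exact: cmeas_norm.
  + by move=> x _; rewrite lee_fin Im_le_cnorm.
Qed.

Lemma cintegrable_le D F f : measurable D -> cmeas D F ->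
  mu.-integrable D (EFin \o f) -> (forall x, D x -> cnorm (F x) <= f x) ->
  cintegrable D F.
Proof.
move=> mD mF If Ff; apply/cintegrableP => //; split => //.
have /integrableP[mf] := If; apply: le_lt_trans; apply: ge0_le_integral => //.
- by move=> x _; rewrite lee_fin cnorm_ge0.
- by apply/measurable_EFinP; exact: cmeas_norm.
- by apply: measurableT_comp.
- by move=> x Dx; rewrite lee_fin (le_trans (Ff _ Dx))// ler_norm.
Qed.

Lemma cintegrable_norm D F : measurable D -> cintegrable D F ->
  mu.-integrable D (fun x => (cnorm (F x))%:E).
Proof.
move=> mD /cintegrableP[//|mF fin]; apply/integrableP; split.
  by apply/measurable_EFinP; exact: cmeas_norm.
by under eq_integral do rewrite gee0_abs ?lee_fin ?cnorm_ge0//.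
Qed.

Lemma cintegrableS D D' F : measurable D -> measurable D' -> D `<=` D' ->
  cintegrable D' F -> cintegrable D F.
Proof. by move=> mD mD' DD' [? ?]; split; exact: integrableS DD' _. Qed.

Lemma cintegrableD D F G : measurable D ->
  cintegrable D F -> cintegrable D G -> cintegrable D (fun x => F x + G x).
Proof.
move=> mD [F1 F2] [G1 G2]; split; under eq_fun do rewrite ?(cReD, cImD) EFinD;
exact: integrableD.
Qed.

Lemma cintegrableZ D F z : measurable D ->
  cintegrable D F -> cintegrable D (fun x => z * F x).
Proof.
move=> mD [F1 F2]; split; under eq_fun do
  rewrite ?(cReM, cImM) ?EFinB ?EFinD !EFinM.
  by apply: integrableB => //; exact: integrableZl.
by apply: integrableD => //; exact: integrableZl.
Qed.

Lemma cintegrableN D F : measurable D ->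
  cintegrable D F -> cintegrable D (fun x => - F x).
Proof.
move=> mD iF; have := cintegrableZ (-1) mD iF.
by under eq_fun do rewrite mulN1r.
Qed.

Lemma cintegrableB D F G : measurable D ->
  cintegrable D F -> cintegrable D G -> cintegrable D (fun x => F x - G x).
Proof. by move=> mD iF iG; apply: cintegrableD => //; exact: cintegrableN. Qed.

Lemma cintegrableR D f : measurable D -> mu.-integrable D (EFin \o f) ->
  cintegrable D (fun x => real_complex R (f x)).
Proof. by move=> mD i; split => //=; exact: integrable0. Qed.

Lemma eq_cint D F G : (forall x, D x -> F x = G x) -> cint D F = cint D G.
Proof.
by move=> FG; rewrite /cint; congr Complex; apply: eq_Rintegral => x;
   rewrite inE => Dx; rewrite FG.
Qed.

Lemma cintD D F G : measurable D -> cintegrable D F -> cintegrable D G ->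
  cint D (fun x => F x + G x) = cint D F + cint D G.
Proof.
move=> mD [F1 F2] [G1 G2]; apply: complex_ext; rewrite ?(cReD, cImD)/=.
  by rewrite -RintegralD//; apply: eq_Rintegral => x _; rewrite cReD.
by rewrite -RintegralD//; apply: eq_Rintegral => x _; rewrite cImD.
Qed.

Lemma cintZ D F z : measurable D -> cintegrable D F ->
  cint D (fun x => z * F x) = z * cint D F.
Proof.
move=> mD [F1 F2]; apply: complex_ext; rewrite ?(cReM, cImM)/= -!RintegralZl//.
  rewrite -RintegralB//; first by apply: eq_Rintegral => x _; rewrite cReM.
  - by rewrite /comp; under eq_fun do rewrite EFinM; exact: integrableZl.
  - by rewrite /comp; under eq_fun do rewrite EFinM; exact: integrableZl.
rewrite -RintegralD//; first by apply: eq_Rintegral => x _; rewrite cImM.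
- by rewrite /comp; under eq_fun do rewrite EFinM; exact: integrableZl.
- by rewrite /comp; under eq_fun do rewrite EFinM; exact: integrableZl.
Qed.

Lemma cintN D F : measurable D -> cintegrable D F ->
  cint D (fun x => - F x) = - cint D F.
Proof.
by move=> mD iF; rewrite -mulN1r -cintZ//; apply: eq_cint => x _; rewrite mulN1r.
Qed.

Lemma cintB D F G : measurable D -> cintegrable D F -> cintegrable D G ->
  cint D (fun x => F x - G x) = cint D F - cint D G.
Proof. by move=> mD iF iG; rewrite cintD ?cintN//; exact: cintegrableN. Qed.

Lemma cint0 D : cint D (fun=> 0) = 0.
Proof.
apply: complex_ext => /=; rewrite /Rintegral integral0_eq//.
Qed.

Lemma cintJ D F : measurable D -> cintegrable D F ->
  cint D (fun x => conjc (F x)) = conjc (cint D F).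
Proof.
move=> mD [F1 F2]; apply: complex_ext => /=.
  by apply: eq_Rintegral => x _; rewrite cReJ.
rewrite -mulN1r -RintegralZl//; apply: eq_Rintegral => x _.
by rewrite cImJ mulN1r.
Qed.

(* |I|^2 = Re (conj I * I) = int Re (conj I * F) <= |I| int |F|, I = cint F *)
Lemma cint_norm D F : measurable D -> cintegrable D F ->
  cnorm (cint D F) <= \int[mu]_(x in D) cnorm (F x).
Proof.
move=> mD iF; set I := cint D F.
have [I0|I0] := eqVneq (cnorm I) 0.
  by rewrite I0 Rintegral_ge0// => x _; exact: cnorm_ge0.
have Ip : 0 < cnorm I by rewrite lt_neqAle eq_sym I0 cnorm_ge0.
rewrite -(ler_pM2l Ip).
have -> : cnorm I * cnorm I = cRe (conjc I * I).
  by rewrite -expr2 cnorm_sqr; case: (I) => a b /=; ring.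
have iN := cintegrable_norm mD iF.
have iZ := cintegrableZ (conjc I) mD iF.
rewrite -cintZ// -RintegralZl// -[leLHS]/(\int[mu]_(x in D) cRe (conjc I * F x)).
apply: le_Rintegral => //.
- by case: iZ.
- by rewrite /comp; under eq_fun do rewrite EFinM; exact: integrableZl.
move=> x Dx; apply: le_trans (ler_norm _) _.
by rewrite (le_trans (Re_le_cnorm _))// Normc.normcM cnormJ.
Qed.

Lemma cint_norme D F : measurable D -> cintegrable D F ->
  ((cnorm (cint D F))%:E <= \int[mu]_(x in D) (cnorm (F x))%:E)%E.
Proof.
move=> mD iF; rewrite -[leRHS]fineK.
  by rewrite lee_fin; exact: cint_norm.
exact: (integrable_fin_num mD (cintegrable_norm mD iF)).
Qed.

End ComplexIntegral.

(** * Integrals of arbitrary functions: monotonicity and null sets *)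

Section NonmeasurableIntegrands.
Import HBSimple HBNNSimple.
Context {d} {T : measurableType d} {R : realType}.
Variable mu : {measure set T -> \bar R}.
Implicit Types (D : set T) (f g : T -> \bar R).
Local Open Scope ereal_scope.

(** The integral of a nonnegative function is a supremum over the simple functions below it, and
    this family grows with the function. Comparisons made this way go through for the many sums
    whose only role is to be a bound. *)
Lemma ge0_le_integralW D f g : (forall x, D x -> 0 <= f x) ->
  (forall x, D x -> f x <= g x) ->
  \int[mu]_(x in D) f x <= \int[mu]_(x in D) g x.
Proof.
move=> f0 fg; rewrite !ge0_integralE//; last first.
  by move=> x Dx; rewrite (le_trans (f0 _ Dx))// fg.
apply: le_ereal_sup => _ [h hf <-]; exists h => // x.
apply: le_trans (hf x) _; rewrite !patchE; case: ifPn => //.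
by rewrite inE; exact: fg.
Qed.

Let ge0_ae_le D f g : measurable D ->
  (forall x, D x -> 0 <= f x) -> (forall x, D x -> 0 <= g x) ->
  {ae mu, forall x, D x -> f x = g x} ->
  \int[mu]_(x in D) f x <= \int[mu]_(x in D) g x.
Proof.
move=> mD f0 g0 [N [mN N0 subN]].
rewrite [leLHS]ge0_integralE//; apply: ub_ereal_sup => _ [h hf <-].
rewrite -integralT_nnsfun.
have mh : measurable_fun setT (EFin \o h) by exact/measurable_EFinP.
(* The simple function is set to 0 on the null set: its integral is unchanged, and elsewhere it lies
   below [f = g]. *)
have mhN : measurable_fun setT ((EFin \o h) \_ (~` N)).
  by apply/(measurable_restrictT _ _).1; [exact: measurableC|exact: measurable_funTS].
have -> : \int[mu]_x (h x)%:E = \int[mu]_x ((EFin \o h) \_ (~` N)) x.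
  apply: ge0_ae_eq_integral => //.
  - by move=> x _; rewrite lee_fin.
  - by move=> x _; rewrite patchE; case: ifPn => // _; rewrite lee_fin.
  - exists N; split => // x /=; apply: contra_notP => Nx _.
    by rewrite patchE mem_set.
rewrite [leRHS]integral_mkcond; apply: ge0_le_integralW.
  by move=> x _; rewrite patchE; case: ifPn => // _; rewrite lee_fin.
move=> x _; rewrite patchE; case: ifPn => [|_]; last first.
  by rewrite patchE; case: ifPn => //; rewrite inE => /g0.
rewrite inE => /= Nx; apply: le_trans (hf x) _; rewrite !patchE.
case: ifPn => //; rewrite inE => Dx; rewrite le_eqVlt; apply/orP; left; apply/eqP.
by apply: contrapT => fgx; apply: Nx; apply: subN => /= /(_ Dx).
Qed.

(* The integral of an arbitrary function is a supremum of integrals of simple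
   functions, hence insensitive to changes on a null set. *)
Lemma ae_eq_integralW D f g : measurable D ->
  {ae mu, forall x, D x -> f x = g x} ->
  \int[mu]_(x in D) f x = \int[mu]_(x in D) g x.
Proof.
move=> mD fg; rewrite integralE [RHS]integralE.
have ae1 : {ae mu, forall x, D x -> (f^\+) x = (g^\+) x}.
  by apply: filterS fg => x h Dx; rewrite !funeposE h.
have ae2 : {ae mu, forall x, D x -> (f^\-) x = (g^\-) x}.
  by apply: filterS fg => x h Dx; rewrite !funenegE h.
have sym (u v : T -> \bar R) : {ae mu, forall x, D x -> u x = v x} ->
    {ae mu, forall x, D x -> v x = u x}.
  by apply: filterS => x h Dx; rewrite h.
by congr (_ - _); apply/eqP; rewrite eq_le !ge0_ae_le//; exact: sym.
Qed.

Lemma ae_eq_Rintegral D (f g : T -> R) : measurable D ->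
  {ae mu, forall x, D x -> f x = g x} ->
  (\int[mu]_(x in D) f x = \int[mu]_(x in D) g x)%R.
Proof.
move=> mD fg; rewrite /Rintegral; congr fine; apply: ae_eq_integralW => //.
by apply: filterS fg => x h Dx; rewrite h.
Qed.

End NonmeasurableIntegrands.

Lemma integrable_fine {d} {T : measurableType d} {R : realType}
    (mu : {measure set T -> \bar R}) (D : set T) (f : T -> \bar R) :
  measurable D -> mu.-integrable D f ->
  mu.-integrable D (fun x => (fine (f x))%:E) /\
  (\int[mu]_(x in D) (fine (f x))%:E = \int[mu]_(x in D) f x)%E.
Proof.
move=> mD fi.
have mf : measurable_fun D (fun x => (fine (f x))%:E).
  by apply/measurable_EFinP/measurableT_comp => //; exact: measurable_int fi.
split; last first.
  apply: ae_eq_integral => //; first exact: measurable_int fi.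
  have := integrable_ae mD fi; apply: filterS => x fx Dx.
  by rewrite fineK// fx.
apply: le_integrable fi => // x Dx.
by case: (f x) => [r||] //=; rewrite normr0 leey.
Qed.

(** * Fubini and Tonelli on products of domains *)

Section Fubini.
Context {R : realType}.

(** Extension by zero off the product of the domains turns an iterated integral over domains into
    one over the whole spaces, where the product-measure theorems apply. *)
Lemma integral2_dom {d1 d2} {T1 : measurableType d1} {T2 : measurableType d2}
    (m1 : {measure set T1 -> \bar R}) (m2 : {measure set T2 -> \bar R})
    (D1 : set T1) (D2 : set T2) (g f : T1 -> T2 -> \bar R) :
  (forall x y, g x y = if (x \in D1) && (y \in D2) then f x y else 0%E) ->
  (\int[m1]_x \int[m2]_y g x y = \int[m1]_(x in D1) \int[m2]_(y in D2) f x y)%E.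
Proof.
move=> gf; rewrite [RHS]integral_mkcond; apply: eq_integral => x _.
rewrite patchE; case: ifPn => xD; last first.
  by apply: integral0_eq => y _; rewrite gf (negbTE xD).
rewrite [RHS]integral_mkcond; apply: eq_integral => y _.
by rewrite gf xD patchE.
Qed.

Context {d1 d2} {T1 : measurableType d1} {T2 : measurableType d2}.
Variable m1 : {sigma_finite_measure set T1 -> \bar R}.
Variable m2 : {sigma_finite_measure set T2 -> \bar R}.
Variables (D1 : set T1) (D2 : set T2).
Hypotheses (mD1 : measurable D1) (mD2 : measurable D2).

Let in_setX (x : T1) (y : T2) :
  ((x, y) \in D1 `*` D2) = (x \in D1) && (y \in D2).
Proof.
apply/idP/andP => [|[]]; first by rewrite inE => -[/= ? ?]; rewrite !inE.
by rewrite !inE => ? ?; split.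
Qed.

Lemma fubini_tonelli_dom (f : T1 -> T2 -> \bar R) :
  measurable_fun (D1 `*` D2) (fun z => f z.1 z.2) ->
  (forall x y, D1 x -> D2 y -> 0 <= f x y)%E ->
  (\int[m1]_(x in D1) \int[m2]_(y in D2) f x y =
   \int[m2]_(y in D2) \int[m1]_(x in D1) f x y)%E.
Proof.
move=> mf f0; pose F := (fun z => f z.1 z.2) \_ (D1 `*` D2).
have mF : measurable_fun setT F.
  by apply/(measurable_restrictT _ _).1 => //; exact: measurableX.
have F0 z : (0 <= F z)%E.
  by rewrite /F patchE; case: ifPn => //; rewrite inE => -[? ?]; exact: f0.
have := fubini_tonelli (m1 := m1) (m2 := m2) F mF F0.
rewrite (integral2_dom m1 m2 (D1 := D1) (D2 := D2) (f := f)); last first.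
  by move=> x y; rewrite /F patchE in_setX.
rewrite (integral2_dom m2 m1 (D1 := D2) (D2 := D1) (f := fun y x => f x y)) //.
by move=> y x; rewrite /F patchE in_setX andbC.
Qed.

End Fubini.

Section Fubini.
Context {R : realType}.

Let in_setX {T1 T2 : Type} (D1 : set T1) (D2 : set T2) (x : T1) (y : T2) :
  ((x, y) \in D1 `*` D2) = (x \in D1) && (y \in D2).
Proof.
apply/idP/andP => [|[]]; first by rewrite inE => -[/= ? ?]; rewrite !inE.
by rewrite !inE => ? ?; split.
Qed.

Lemma fubini_dom_integrable {d1 d2} {T1 : measurableType d1}
    {T2 : measurableType d2}
    (m1 : {sigma_finite_measure set T1 -> \bar R})
    (m2 : {sigma_finite_measure set T2 -> \bar R})
    (D1 : set T1) (D2 : set T2) (f : T1 -> T2 -> R) :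
  measurable D1 -> measurable D2 ->
  measurable_fun (D1 `*` D2) (fun z => f z.1 z.2) ->
  (\int[m1]_(x in D1) \int[m2]_(y in D2) `|f x y|%:E < +oo)%E ->
  let F := (fun z => (f z.1 z.2)%:E) \_ (D1 `*` D2) in
  (m1 \x m2)%E.-integrable setT F /\
  m1.-integrable D1 (fun x => \int[m2]_(y in D2) (f x y)%:E)%E.
Proof.
move=> mD1 mD2 mf foo F.
have mF : measurable_fun setT F.
  apply/(measurable_restrictT _ _).1; first exact: measurableX.
  exact/measurable_EFinP.
have iF : (m1 \x m2)%E.-integrable setT F.
  have [_ H] := @integrable12ltyP _ _ _ _ _ m1 m2 F mF; apply: H.
  rewrite (integral2_dom m1 m2 (D1 := D1) (D2 := D2) (f := fun x y => `|f x y|%:E)) //.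
  by move=> x y; rewrite /F patchE in_setX; case: ifP => //=; rewrite normr0.
split => //.
have := integrableS measurableT mD1 (@subsetT _ _) (integrable_fubini_F iF).
apply: eq_integrable => // x xD; rewrite [RHS]integral_mkcond.
by apply: eq_integral => y _; rewrite /F patchE in_setX xD patchE.
Qed.

Lemma measurable_fun_dom_swap {d1 d2 d3} {T1 : measurableType d1}
    {T2 : measurableType d2} {T3 : measurableType d3} (D1 : set T1) (D2 : set T2)
    (f : T1 -> T2 -> T3) :
  measurable D1 -> measurable D2 ->
  measurable_fun (D1 `*` D2) (fun z => f z.1 z.2) ->
  measurable_fun (D2 `*` D1) (fun z => f z.2 z.1).
Proof.
move=> mD1 mD2 mf; apply: (@measurable_comp _ _ _ _ _ _ (D1 `*` D2) (fun z => f z.1 z.2) _ (fun z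
  => (z.2, z.1))) => //.
- exact: measurableX.
- by move=> _ [[y x] [/= ? ?] <-].
- by apply: measurable_funTS; apply: measurable_fun_pair => //.
Qed.

Context {d1 d2} {T1 : measurableType d1} {T2 : measurableType d2}.
Variable m1 : {sigma_finite_measure set T1 -> \bar R}.
Variable m2 : {sigma_finite_measure set T2 -> \bar R}.
Variables (D1 : set T1) (D2 : set T2).
Hypotheses (mD1 : measurable D1) (mD2 : measurable D2).

Lemma fubini_dom (f : T1 -> T2 -> R) :
  measurable_fun (D1 `*` D2) (fun z => f z.1 z.2) ->
  (\int[m1]_(x in D1) \int[m2]_(y in D2) `|f x y|%:E < +oo)%E ->
  m1.-integrable D1 (fun x => (\int[m2]_(y in D2) f x y)%:E) /\
  (\int[m1]_(x in D1) \int[m2]_(y in D2) f x y =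
   \int[m2]_(y in D2) \int[m1]_(x in D1) f x y).
Proof.
move=> mf foo.
have [iF i1] := fubini_dom_integrable mD1 mD2 mf foo.
have foo' : (\int[m2]_(y in D2) \int[m1]_(x in D1) `|f x y|%:E < +oo)%E.
  rewrite -fubini_tonelli_dom//.
    by apply/measurable_EFinP; exact: measurableT_comp.
have [_ i2] := fubini_dom_integrable (f := fun y x => f x y) mD2 mD1 (measurable_fun_dom_swap mD1
  mD2 mf) foo'.
have [i1' e1] := integrable_fine mD1 i1.
have [i2' e2] := integrable_fine mD2 i2.
split => //; rewrite /Rintegral e1 e2; congr fine.
have := Fubini iF.
rewrite (integral2_dom m1 m2 (D1 := D1) (D2 := D2) (f := fun x y => (f x y)%:E)); last first.
  by move=> x y; rewrite patchE in_setX.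
rewrite (integral2_dom m2 m1 (D1 := D2) (D2 := D1) (f := fun y x => (f x y)%:E)) //.
by move=> y x; rewrite patchE in_setX andbC.
Qed.

Lemma cfubini (F : T1 -> T2 -> R[i]) :
  cmeas (D1 `*` D2) (fun z => F z.1 z.2) ->
  (\int[m1]_(x in D1) \int[m2]_(y in D2) (cnorm (F x y))%:E < +oo)%E ->
  cintegrable m1 D1 (fun x => cint m2 D2 (F x)) /\
  cint m1 D1 (fun x => cint m2 D2 (F x)) =
  cint m2 D2 (fun y => cint m1 D1 (fun x => F x y)).
Proof.
move=> [mR mI] Foo.
have dom (h : T1 -> T2 -> R) : (forall x y, `|h x y| <= cnorm (F x y)) ->
    (\int[m1]_(x in D1) \int[m2]_(y in D2) `|h x y|%:E < +oo)%E.
  move=> hF; apply: le_lt_trans Foo; apply: ge0_le_integralW => x Dx.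
    by apply: integral_ge0.
  by apply: ge0_le_integralW => // y Dy; rewrite lee_fin.
have [? eR] := fubini_dom mR (dom _ (fun x y => Re_le_cnorm _)).
have [? eI] := fubini_dom mI (dom _ (fun x y => Im_le_cnorm _)).
split; first by split.
by apply: complex_ext.
Qed.

End Fubini.

(** Joint measurability when one variable is discrete; with the counting measure it lets Fubini
    exchange a series and an integral. *)
Lemma measurable_fun_nat {d d'} {T : measurableType d} {T' : measurableType d'}
    (D : set T) (f : nat -> T -> T') : measurable D ->
  (forall n, measurable_fun D (f n)) ->
  measurable_fun (setT `*` D) (fun z => f z.1 z.2).
Proof.
move=> mD mf mX Y mY.
rewrite (_ : _ `&` _ = \bigcup_n ([set n] `*` (D `&` f n @^-1` Y))).
  by apply: bigcup_measurable => n _; apply: measurableX => //; exact: mf.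
apply/seteqP; split => [[n x] [[_ /= Dx] fY]|[n x] [m _ [/= -> [Dx fY]]]].
  by exists n.
by split.
Qed.

Lemma cmeas_nat {d} {T : measurableType d} {R : realType} (D : set T)
    (F : nat -> T -> R[i]) : measurable D -> (forall n, cmeas D (F n)) ->
  cmeas (setT `*` D) (fun z => F z.1 z.2).
Proof.
move=> mD mF; split.
  by apply: (measurable_fun_nat (f := fun n x => cRe (F n x))) => // n; case: (mF n).
by apply: (measurable_fun_nat (f := fun n x => cIm (F n x))) => // n; case: (mF n).
Qed.

Notation RC := (real_complex _).

Section ComplexIntegralR.
Context {d} {T : measurableType d} {R : realType}.
Variable mu : {measure set T -> \bar R}.

Lemma cintR (D : set T) (f : T -> R) :
  cint mu D (fun x => RC (f x)) = RC (\int[mu]_(x in D) f x).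
Proof.
by apply: complex_ext => //=; rewrite /Rintegral integral0_eq.
Qed.

Lemma cintegrableM_bounded (D : set T) (F G : T -> R[i]) (C : R) :
  measurable D -> cmeas D F -> (forall x, D x -> cnorm (F x) <= C) ->
  cintegrable mu D G -> cintegrable mu D (fun x => F x * G x).
Proof.
move=> mD mF FC iG.
have mG : cmeas D G by have /cintegrableP[] := iG.
apply: (@cintegrable_le _ _ _ _ _ _ (fun x => C * cnorm (G x))) => //.
- exact: cmeasM.
- rewrite /comp; under eq_fun do rewrite EFinM.
  by apply: integrableZl => //; exact: cintegrable_norm.
- move=> x Dx; rewrite Normc.normcM ler_wpM2r ?cnorm_ge0//; exact: FC.
Qed.

Lemma cmeas_ifT (D : set T) (b : T -> bool) (F G : T -> R[i]) :
  measurable D -> measurable_fun D b -> cmeas D F -> cmeas D G ->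
  cmeas D (fun x => if b x then F x else G x).
Proof.
move=> mD mb [F1 F2] [G1 G2].
have key (f g : T -> R) : measurable_fun D f -> measurable_fun D g ->
    measurable_fun D (fun x => if b x then f x else g x).
  move=> mf mg; apply: measurable_fun_if => //.
    by apply: measurable_funS mf => //; apply: subIset; left.
  by apply: measurable_funS mg => //; apply: subIset; left.
split.
  by rewrite (_ : (fun _ => _) = fun x => if b x then cRe (F x) else cRe (G x));
    [exact: key|apply/funext => x; case: (b x)].
by rewrite (_ : (fun _ => _) = fun x => if b x then cIm (F x) else cIm (G x));
  [exact: key|apply/funext => x; case: (b x)].
Qed.

(** Turns a condition inside the integrand, such as [s <= t] in a Volterra kernel, into a
    restriction of the domain. *)
Lemma cint_if (A B : set T) (H : T -> R[i]) (P : T -> bool) :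
  (forall x, A x /\ P x <-> B x) ->
  cint mu A (fun x => if P x then H x else 0) = cint mu B H.
Proof.
move=> AB; have bd x : (x \in B) = (x \in A) && P x.
  apply/idP/andP => [|[]]; rewrite !inE; first by move=> /AB.
  by move=> ? ?; exact/AB.
apply: complex_ext; rewrite /= Rintegral_mkcond [RHS]Rintegral_mkcond;
  apply: eq_Rintegral => x _; rewrite !patchE bd.
- by case: (x \in A) => //=; case: (P x).
- by case: (x \in A) => //=; case: (P x).
Qed.

End ComplexIntegralR.

(** * Integrals over time intervals *)

Section TimeIntegrals.
Context {R : realType}.
Implicit Types (s t T a b : R) (f g : R -> R) (F G : R -> R[i]).

Definition tint T F := cint (leb R) `[0, T]%classic F.
Definition tintegrable T F := cintegrable (leb R) `[0, T]%classic F.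

(** Fubini on the square for the kernel [F t * G s] cut off at [s <= t]. It replaces integration by
    parts where a factor is only integrable: with an exponential it gives Duhamel's formula, with a
    character the injectivity of the Fourier coefficients, with a test function the weak
    equation. *)
Lemma triangle_fubini a T F G : cintegrable (leb R) `[a, T] F ->
  cintegrable (leb R) `[a, T] G ->
  cint (leb R) `[a, T] (fun t => F t * cint (leb R) `[a, t] G) =
  cint (leb R) `[a, T] (fun s => cint (leb R) `[s, T] F * G s).
Proof.
move=> iF iG; set D := `[a, T]%classic.
have mD : measurable D by exact: measurable_itv.
have /cintegrableP[//|mF fF] := iF.
have /cintegrableP[//|mG fG] := iG.
pose K t s := if s <= t then F t * G s else 0.
have mF1 : cmeas (D `*` D) (fun z => F z.1).
  by case: mF => ? ?; split;
    [apply: (@measurable_comp _ _ _ _ _ _ D (fun t => cRe (F t)) _ fst)|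
     apply: (@measurable_comp _ _ _ _ _ _ D (fun t => cIm (F t)) _ fst)] => //;
    try (by move=> _ [[? ?] [? ?] <-]); exact: measurable_funTS.
have mG2 : cmeas (D `*` D) (fun z => G z.2).
  by case: mG => ? ?; split;
    [apply: (@measurable_comp _ _ _ _ _ _ D (fun t => cRe (G t)) _ snd)|
     apply: (@measurable_comp _ _ _ _ _ _ D (fun t => cIm (G t)) _ snd)] => //;
    try (by move=> _ [[? ?] [? ?] <-]); exact: measurable_funTS.
have mK : cmeas (D `*` D) (fun z => K z.1 z.2).
  apply: cmeas_ifT; first exact: measurableX.
  - by apply: measurable_funTS; apply: measurable_fun_ler; 
      [exact: measurable_snd|exact: measurable_fst].
  - exact: cmeasM.
  - exact: cmeas_cst.
have Koo : (\int[leb R]_(x in D) \int[leb R]_(y in D) (cnorm (K x y))%:E < +oo)%E.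
  apply: (@le_lt_trans _ _ (\int[leb R]_(x in D) ((cnorm (F x))%:E *
      (\int[leb R]_(y in D) (cnorm (G y))%:E)))%E).
    apply: ge0_le_integralW => x Dx.
      by apply: integral_ge0 => y _; rewrite lee_fin cnorm_ge0.
    rewrite -ge0_integralZl//; last 3 first.
    - by apply/measurable_EFinP; exact: cmeas_norm.
    - by move=> y _; rewrite lee_fin cnorm_ge0.
    - by rewrite lee_fin cnorm_ge0.
    apply: ge0_le_integralW => y Dy; first by rewrite lee_fin cnorm_ge0.
    rewrite -EFinM lee_fin /K -Normc.normcM; case: ifP => // _.
    by rewrite Normc.normc0 cnorm_ge0.
  rewrite ge0_integralZr//; last 3 first.
  - by apply/measurable_EFinP; exact: cmeas_norm.
  - by move=> y _; rewrite lee_fin cnorm_ge0.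
  - by apply: integral_ge0 => y _; rewrite lee_fin cnorm_ge0.
  rewrite lte_mul_pinfty// ?ge0_fin_numE//.
  - by apply: integral_ge0 => y _; rewrite lee_fin cnorm_ge0.
  - by apply: integral_ge0 => y _; rewrite lee_fin cnorm_ge0.
have [_] := cfubini (m1 := leb R) (m2 := leb R) mD mD mK Koo.
have subl (t s : R) : t <= T -> (D s /\ s <= t) <-> `[a, t]%classic s.
  move=> tT; rewrite /D/= !in_itv/=; split => [[/andP[-> _] ->]//|/andP[-> st]].
  by rewrite st (le_trans st).
have subr (t s : R) : a <= s -> (D t /\ s <= t) <-> `[s, T]%classic t.
  move=> a0; rewrite /D/= !in_itv/=; split => [[/andP[_ ->] ->]//|/andP[st ->]].
  by rewrite st (le_trans a0).
have hl (t : R) : D t -> cint (leb R) D (K t) = F t * cint (leb R) `[a, t] G.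
  rewrite /D/= in_itv/= => /andP[a0 tT].
  rewrite (@cint_if _ _ _ (leb R) D `[a, t] (fun s => F t * G s) (fun s => s <= t)); last first.
    by move=> s; exact: subl.
  by rewrite cintZ//; apply: cintegrableS iG => // s /(subl t s tT)[].
have hr (s : R) : D s -> cint (leb R) D (fun t => K t s) = cint (leb R) `[s, T] F * G s.
  rewrite /D/= in_itv/= => /andP[a0 sT].
  rewrite /K (@eq_cint _ _ _ (leb R) _ _ (fun t => if s <= t then G s * F t else 0)); last first.
    by move=> t _; rewrite mulrC.
  rewrite (@cint_if _ _ _ (leb R) D `[s, T] (fun t => G s * F t) (fun t => s <= t)); last first.
    by move=> t; exact: subr.
  rewrite cintZ//; last by apply: cintegrableS iF => // t /(subr t s a0)[].
  exact: mulrC.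
move=> E; transitivity (cint (leb R) D (fun t => cint (leb R) D (K t))).
  by apply: eq_cint => t /hl ->.
by rewrite E; apply: eq_cint => s /hr ->.
Qed.

(** The factor [lam] stays on the left so that [lam = 0] is included. *)
Lemma int_exp (lam s t : R) : s <= t ->
  lam * \int[leb R]_(r in `[s, t]) expR (- (lam * r)) =
  expR (- (lam * s)) - expR (- (lam * t)).
Proof.
rewrite le_eqVlt => /predU1P[->|st].
  by rewrite subrr set_itv1 Rintegral_set1 mulr0.
have df (x : R) : is_derive x 1 (fun r => - expR (- (lam * r))) (lam * expR (- (lam * x))).
  by apply: is_derive_eq; rewrite /GRing.scale/= mulr1 mulrN opprK mulrC.
have ce : continuous (fun r : R => expR (- (lam * r))).
  move=> x; apply: (@continuous_comp _ _ _ (fun r => - (lam * r)) expR); last exact: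
    continuous_expR.
  by apply: cvgN; apply: cvgM; [exact: cvg_cst|exact: cvg_id].
have cf : continuous (fun r : R => lam * expR (- (lam * r))).
  by move=> x; apply: cvgM; [exact: cvg_cst|exact: ce].
have i : (leb R).-integrable `[s, t] (EFin \o (fun r => expR (- (lam * r)))).
  apply: continuous_compact_integrable => //; first exact: segment_compact.
  exact: continuous_subspaceT.
rewrite -RintegralZl// /Rintegral (@continuous_FTC2 _ _ (fun r => - expR (- (lam * r))))//=.
- by rewrite opprK addrC.
- exact: continuous_subspaceT.
- split => //.
  + by apply: cvg_at_right_filter; apply: cvgN; exact: ce.
  + by apply: cvg_at_left_filter; apply: cvgN; exact: ce.
- by move=> x _; rewrite derive1E; have /@derive_val := df x.
Qed.

Lemma Rint_continuous f : (forall T, (leb R).-integrable `[0, T] (EFin \o f)) ->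
  continuous (fun t => \int[leb R]_(s in `[0, t]) f s).
Proof.
move=> fi t.
(* Extending [f] by zero to [[-b, b]] makes [t] an interior point, also when [t <= 0], where
   [[0, t]] is empty or a single point. *)
pose b := `|t| + 1; pose g := f \_ `[0, b].
have b0 : 0 <= b by rewrite addr_ge0.
have ig : (leb R).-integrable `[- b, b] (EFin \o g).
  rewrite -restrict_EFin; apply/integrable_restrict => //.
  rewrite (_ : _ `&` _ = `[0, b]%classic) //.
  apply/seteqP; split => [x [] //|x /=]; rewrite !in_itv/= => /andP[x0 xb].
  by rewrite x0 xb andbT; split => //; rewrite (le_trans _ x0)// oppr_le0.
have nbb : - b < b by rewrite -subr_gt0 opprK addr_gt0// ltr_pwDr.
have tb : t \in `]- b, b[%classic.
  by rewrite inE/= in_itv/= -ltr_norml ltrDl.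
have : parameterized_integral (leb R) (- b) x g @[x --> t] --> parameterized_integral (leb R) (-
  b) t g.
  have /(continuous_within_itvP _ nbb)[+ _ _] := parameterized_integral_continuous (ltW nbb) ig.
  by rewrite /= ; apply; rewrite inE in tb.
have E x : x \in `]- b, b[%classic -> parameterized_integral (leb R) (- b) x g =
    \int[leb R]_(s in `[0, x]) f s.
  rewrite inE/= in_itv/= => /andP[bx xb].
  rewrite /parameterized_integral Rintegral_mkcond [RHS]Rintegral_mkcond.
  apply: eq_Rintegral => s _; rewrite /g !patchE !mem_setE !in_itv/=.
  case: (leP 0 s) => s0 /=; last by case: ifP.
  rewrite (le_trans _ s0) ?oppr_le0//=.
  by case: (leP s x) => sx //=; rewrite (le_trans sx (ltW xb)).
rewrite E// => H; apply: cvg_trans H; apply: near_eq_cvg; near=> x.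
rewrite E// inE/= in_itv/=; near: x.
have : \forall x \near t, x \in `]- b, b[ by apply: near_in_itvoo; rewrite inE in tb.
by apply: filterS => x; rewrite in_itv.
Unshelve. all: by end_near. Qed.

End TimeIntegrals.

(** * Duhamel's formula and sequence spaces *)

Section Duhamel.
Context {R : realType}.
Implicit Types (s t T lam : R) (M F : R -> R[i]) (al : R[i]).

Definition ccont F := continuous (fun t => cRe (F t)) /\ continuous (fun t => cIm (F t)).

Lemma ccont_cmeas F (D : set R) : measurable D -> ccont F -> cmeas D F.
Proof.
by move=> mD [c1 c2]; split; apply: measurable_funTS; exact: continuous_measurable_fun.
Qed.

Lemma ccontR (f : R -> R) : continuous f -> ccont (fun t => RC (f t)).
Proof. by move=> cf; split => //= x; exact: cvg_cst. Qed.

Lemma ccont_cst al : ccont (fun=> al).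
Proof. by split => x; exact: cvg_cst. Qed.

Lemma ccontD F M : ccont F -> ccont M -> ccont (fun t => F t + M t).
Proof.
move=> [F1 F2] [M1 M2]; split => x; under eq_fun do rewrite ?(cReD, cImD);
  rewrite ?(cReD, cImD).
  by apply: cvgD; [exact: F1|exact: M1].
by apply: cvgD; [exact: F2|exact: M2].
Qed.

Lemma ccontM F M : ccont F -> ccont M -> ccont (fun t => F t * M t).
Proof.
move=> [F1 F2] [M1 M2]; split => x; under eq_fun do rewrite ?(cReM, cImM);
  rewrite ?(cReM, cImM).
  by apply: cvgB; apply: cvgM; [exact: F1|exact: M1|exact: F2|exact: M2].
by apply: cvgD; apply: cvgM; [exact: F1|exact: M2|exact: F2|exact: M1].
Qed.

Lemma tint_ccont F : (forall T, tintegrable T F) -> ccont (fun t => tint t F).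
Proof.
move=> iF; split.
  by apply: (@Rint_continuous _ (fun t => cRe (F t))) => T; have [] := iF T.
by apply: (@Rint_continuous _ (fun t => cIm (F t))) => T; have [] := iF T.
Qed.

Lemma ccont_expR lam : ccont (fun t => RC (expR (lam * t))).
Proof.
apply: ccontR => x; apply: (@continuous_comp _ _ _ (fun r => lam * r) expR).
  by apply: cvgM; [exact: cvg_cst|exact: cvg_id].
exact: continuous_expR.
Qed.

Lemma ccont_expRN lam : ccont (fun t => RC (expR (- (lam * t)))).
Proof.
have := ccont_expR (- lam); congr ccont.
by apply/funext => t; rewrite mulNr.
Qed.

Lemma expR_bound lam t T : 0 <= t -> t <= T -> expR (lam * t) <= expR (`|lam| * T).
Proof.
move=> t0 tT; rewrite ler_expR (le_trans (ler_norm _))// normrM (ger0_norm t0).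
by rewrite ler_wpM2l.
Qed.

Lemma tintegrable_expM lam T F : tintegrable T F ->
  tintegrable T (fun s => RC (expR (lam * s)) * F s).
Proof.
move=> iF; apply: (@cintegrableM_bounded _ _ _ _ _ _ _ (expR (`|lam| * T))) => //.
- by apply: ccont_cmeas => //; exact: ccont_expR.
- move=> x xT; rewrite cnormR ger0_norm ?expR_ge0//.
  by move: xT; rewrite /= in_itv/= => /andP[x0 xT]; rewrite expR_bound.
Qed.

Lemma ccont_tintegrable T F : ccont F -> tintegrable T F.
Proof.
move=> [c1 c2]; split; apply: continuous_compact_integrable;
  try exact: segment_compact; exact: continuous_subspaceT.
Qed.

Lemma cReMR (x : R) (z : R[i]) : cRe (RC x * z) = x * cRe z.
Proof. by case: z => a b /=; rewrite mul0r subr0. Qed.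

(** Variation of constants for [y' = - lam y + M], [y(0) = al]. For [t < 0] the integral is over an
    empty interval, so the function is defined and, for locally integrable [M], continuous on the
    whole line. *)
Definition duh lam al M t : R[i] :=
  RC (expR (- (lam * t))) * (al + tint t (fun s => RC (expR (lam * s)) * M s)).

Lemma duh_ccont lam al M : (forall T, tintegrable T M) -> ccont (duh lam al M).
Proof.
move=> iM; apply: ccontM; first exact: ccont_expRN.
apply: ccontD; first exact: ccont_cst.
by apply: tint_ccont => T; exact: tintegrable_expM.
Qed.

Lemma cint_exp lam s t : s <= t ->
  RC lam * cint (leb R) `[s, t] (fun r => RC (expR (- (lam * r)))) =
  RC (expR (- (lam * s)) - expR (- (lam * t))).
Proof.
by move=> st; rewrite cintR -int_exp//; apply: complex_ext; rewrite /= ?mul0r ?mulr0 ?subr0 ?addr0.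
Qed.

(** The differential equation in integrated form, since [M] is only integrable. After exchanging the
    two time integrals, [lam] times the integral of the exponential over [[s, t]] is
    [e^{-lam s} - e^{-lam t}]: the first term rebuilds [M], the second cancels against [duh]
    itself. *)
Lemma duh_eq lam al M t : (forall T, tintegrable T M) -> 0 <= t ->
  duh lam al M t + RC lam * tint t (duh lam al M) = al + tint t M.
Proof.
move=> iM t0; pose G s := RC (expR (lam * s)) * M s.
have iG T : tintegrable T G by exact: tintegrable_expM.
pose F s : R[i] := RC (expR (- (lam * s))).
have cF : ccont F by exact: ccont_expRN.
have iF T : tintegrable T F by exact: ccont_tintegrable.
have iFG T : tintegrable T (fun r => F r * tint r G).
  by apply: ccont_tintegrable; apply: ccontM => //; exact: tint_ccont.
have -> : tint t (duh lam al M) = tint t F * al + tint t (fun r => F r * tint r G).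
  transitivity (tint t (fun r => al * F r + F r * tint r G)).
    by apply: eq_cint => r _; rewrite /duh mulrDr [al * _]mulrC.
  rewrite /tint cintD//; [|by apply: cintegrableZ => //; exact: iF|exact: iFG].
  by rewrite cintZ//; [rewrite mulrC|exact: iF].
rewrite mulrDr mulrA cint_exp// mulr0 oppr0 expR0.
have -> : tint t (fun r => F r * tint r G) =
    cint (leb R) `[0, t] (fun s => cint (leb R) `[s, t] F * G s).
  exact: (triangle_fubini (iF t) (iG t)).
have iK : tintegrable t (fun s => M s - F t * G s).
  apply: cintegrableB => //; first exact: iM.
  by apply: cintegrableZ => //; exact: iG.
have eK : tint t (fun s => M s - F t * G s) = tint t M - F t * tint t G.
  rewrite /tint cintB//; [|exact: iM|by apply: cintegrableZ => //; exact: iG].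
  by rewrite cintZ//; exact: iG.
have E : RC lam * cint (leb R) `[0, t] (fun s => cint (leb R) `[s, t] F * G s) =
    tint t M - F t * tint t G.
  have e s : `[0, t]%classic s -> RC lam * (cint (leb R) `[s, t] F * G s) = M s - F t * G s.
    rewrite /= in_itv/= => /andP[s0 st]; rewrite mulrA cint_exp//.
    rewrite rmorphB/= mulrBl; congr (_ - _).
    rewrite /G mulrA -rmorphM/= -expRD addNr expR0.
    by rewrite (_ : RC 1 = 1)// mul1r.
  (* Moving [lam] through the integral needs integrability of the integrand without this factor,
     which is read off after division by [lam]; for [lam = 0] both sides vanish. *)
  have [l0|l0] := eqVneq lam 0.
    rewrite (_ : RC lam = 0) ?l0// mul0r.
    rewrite -eK -(@cint0 _ _ _ (leb R) `[0, t]); apply: eq_cint => s st.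
    by rewrite -e// (_ : RC lam = 0) ?l0// mul0r.
  have l0' : RC lam != 0 by rewrite eq_complex/= negb_and l0.
  have e' s : `[0, t]%classic s -> cint (leb R) `[s, t] F * G s =
      (RC lam)^-1 * (M s - F t * G s).
    by move=> /e <-; rewrite mulKf.
  rewrite (eq_cint (leb R) e') -eK (@cintZ _ _ _ (leb R) `[0, t] (fun s => M s - F t * G s) (RC
    lam)^-1)//.
  by rewrite mulVKf.
rewrite E /duh -/(F t) -/G rmorphB/= (_ : RC 1 = 1)//; ring.
Qed.

(** By comparison: the norm of [duh lam al M] is at most the real Duhamel term [u] with data [|al|]
    and [|M|], and for [u] the integrated equation gives the bound with equality. *)
Lemma duh_norm lam al M t : 0 <= lam -> (forall T, tintegrable T M) -> 0 <= t ->
  cnorm (duh lam al M t) + lam * \int[leb R]_(s in `[0, t]) cnorm (duh lam al M s) <=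
  cnorm al + \int[leb R]_(s in `[0, t]) cnorm (M s).
Proof.
move=> l0 iM t0.
pose N s : R[i] := RC (cnorm (M s)).
have iN T : tintegrable T N.
  by apply: cintegrableR => //; apply: cintegrable_norm => //; exact: iM.
pose u s := cRe (duh lam (RC (cnorm al)) N s).
have uE : u t + lam * \int[leb R]_(s in `[0, t]) u s =
    cnorm al + \int[leb R]_(s in `[0, t]) cnorm (M s).
  have := congr1 (@complex.Re _) (duh_eq lam (RC (cnorm al)) iN t0).
  rewrite 2!cReD [cRe (RC lam * _)]cReM (_ : cIm (RC lam) = 0)// mul0r subr0.
  exact: id.
have du s : 0 <= s -> cnorm (duh lam al M s) <= u s.
  move=> s0; rewrite /u /duh cReMR Normc.normcM cnormR.
  rewrite ger0_norm ?expR_ge0// ler_wpM2l ?expR_ge0//.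
  rewrite (le_trans (cnormD _ _))// cReD/= lerD2l.
  have iG := tintegrable_expM lam (iM s).
  apply: (le_trans (cint_norm _ iG)) => //.
  rewrite /tint le_eqVlt; apply/orP; left; apply/eqP; apply: eq_Rintegral => r _.
  by rewrite Normc.normcM cnormR ger0_norm ?expR_ge0// mul0r subr0.
rewrite -uE lerD ?du// ler_wpM2l//; apply: le_Rintegral => //.
- have := ccont_tintegrable t (duh_ccont lam al iM).
  exact: cintegrable_norm.
- by have [] := ccont_tintegrable t (duh_ccont lam (RC (cnorm al)) iN).
- by move=> s; rewrite /= in_itv/= => /andP[s0 _]; exact: du.
Qed.

Lemma tintegrable_fin t M : tintegrable t M ->
  (\int[leb R]_(s in `[0%R, t]) (cnorm (M s))%:E =
   (\int[leb R]_(s in `[0, t]) cnorm (M s))%:E)%E.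
Proof.
move=> iM; rewrite /Rintegral fineK//.
by apply: integrable_fin_num => //; exact: cintegrable_norm.
Qed.

Lemma duh_norme lam al M t : 0 <= lam -> (forall T, tintegrable T M) -> 0 <= t ->
  ((cnorm (duh lam al M t))%:E +
   lam%:E * \int[leb R]_(s in `[0%R, t]) (cnorm (duh lam al M s))%:E <=
  (cnorm al)%:E + \int[leb R]_(s in `[0%R, t]) (cnorm (M s))%:E)%E.
Proof.
move=> l0 iM t0; rewrite tintegrable_fin; last first.
  exact: ccont_tintegrable (duh_ccont _ _ iM).
by rewrite tintegrable_fin// -EFinM -!EFinD lee_fin; exact: duh_norm.
Qed.

End Duhamel.

(** * Weighted sequence sums and the quadratic nonlinearity *)

Section Sequences.
Context {R : realType}.
Implicit Types (x y z a b : nat -> R[i]) (w W U : nat -> R).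
Local Open Scope ereal_scope.

(** A series is an integral for the counting measure; its value is meaningful under absolute
    convergence, which [csummableP] identifies with integrability. *)
Definition csum z : R[i] := cint (@counting nat R) setT z.
Definition wsum w z : \bar R := \sum_(n <oo) (w n * cnorm (z n))%:E.

Lemma cmeas_natT (D : set nat) z : cmeas D z.
Proof. by split => // mD Y mY. Qed.

Lemma csummableP z :
  cintegrable (@counting nat R) setT z <-> \sum_(n <oo) (cnorm (z n))%:E < +oo.
Proof.
rewrite cintegrableP// ge0_integral_count; last by move=> k; rewrite lee_fin cnorm_ge0.
by split => [[]//|h]; split => //; exact: cmeas_natT.
Qed.

Lemma csum_norme z : (cnorm (csum z))%:E <= \sum_(n <oo) (cnorm (z n))%:E.
Proof.
have [h|/negP] := boolP (\sum_(n <oo) (cnorm (z n))%:E < +oo); last first.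
  by rewrite ltey => /negP; rewrite negbK => /eqP ->; rewrite leey.
have /csummableP iz := h.
apply: le_trans (cint_norme _ iz) _ => //.
by rewrite ge0_integral_count// => k; rewrite lee_fin cnorm_ge0.
Qed.

Lemma wsum_ge0 w z : (forall n, 0 <= w n)%R -> 0 <= wsum w z.
Proof.
by move=> w0; apply: nneseries_ge0 => n _ _; rewrite lee_fin mulr_ge0 ?cnorm_ge0.
Qed.

Lemma wsum_le w W x y : (forall n, 0 <= w n)%R ->
  (forall n, w n * cnorm (x n) <= W n * cnorm (y n))%R ->
  wsum w x <= wsum W y.
Proof.
move=> w0 h; apply: lee_nneseries => n *; last by rewrite lee_fin.
by rewrite lee_fin mulr_ge0 ?cnorm_ge0.
Qed.

Lemma wsumD w x y : (forall n, 0 <= w n)%R ->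
  wsum w (fun n => x n + y n)%R <= wsum w x + wsum w y.
Proof.
move=> w0; rewrite /wsum -nneseriesD; last 2 first.
- by move=> n _ _; rewrite lee_fin mulr_ge0 ?cnorm_ge0.
- by move=> n _ _; rewrite lee_fin mulr_ge0 ?cnorm_ge0.
apply: lee_nneseries => n *; first by rewrite lee_fin mulr_ge0 ?cnorm_ge0.
by rewrite -EFinD lee_fin -mulrDr ler_wpM2l// cnormD.
Qed.

Lemma wsumN w x : wsum w (fun n => - x n)%R = wsum w x.
Proof. by apply: eq_eseriesr => n _; rewrite cnormN. Qed.

Lemma wsumB w x y : (forall n, 0 <= w n)%R ->
  wsum w (fun n => x n - y n)%R <= wsum w x + wsum w y.
Proof. by move=> w0; rewrite (le_trans (wsumD _ _ w0))// wsumN. Qed.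

Lemma wsum_term w z n : (forall n, 0 <= w n)%R -> (w n * cnorm (z n))%:E <= wsum w z.
Proof.
move=> w0; rewrite /wsum (@nneseriesD1 _ _ n)// ?leeDl//; last first.
  by move=> k _; rewrite lee_fin mulr_ge0 ?cnorm_ge0.
by apply: nneseries_ge0 => k _ _; rewrite lee_fin mulr_ge0 ?cnorm_ge0.
Qed.

(** Tonelli after a bound, mode by mode, by a series of increments: this is how estimates pass to
    the limit of the Picard iterates. *)
Lemma wsum_lim w (z : nat -> R[i]) (zz : nat -> nat -> R[i]) :
  (forall n, 0 <= w n)%R ->
  (forall n, (cnorm (z n))%:E <= \sum_(i <oo) (cnorm (zz i n))%:E) ->
  wsum w z <= \sum_(i <oo) wsum w (zz i).
Proof.
move=> w0 h; rewrite /wsum nneseries_interchange; last first.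
  by move=> i n; rewrite lee_fin mulr_ge0 ?cnorm_ge0.
apply: lee_nneseries => n *; first by rewrite lee_fin mulr_ge0 ?cnorm_ge0.
rewrite EFinM; under eq_eseriesr do rewrite EFinM.
rewrite nneseriesZl//; last by move=> i _; rewrite lee_fin cnorm_ge0.
by apply: lee_wpmul2l => //; rewrite lee_fin.
Qed.

Lemma nneseries_shift (f : nat -> \bar R) k : (forall n, 0 <= f n) ->
  \sum_(n <oo) f (n + k).+1 <= \sum_(n <oo) f n.
Proof.
move=> f0; under eq_eseriesr do rewrite -addnS.
rewrite nneseries_addn// [leRHS](nneseries_split _ k.+1)//.
by rewrite leeDr// sume_ge0.
Qed.

Variables (nu c : R).
Hypotheses (nu_gt0 : (0 < nu)%R) (c_gt0 : (0 < c)%R).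

(* Index n stands for the frequency n + 1; w0, w1, w4 weigh the A^0 and A^1 norms
   and the dissipation lam measured in A^1. *)
Definition lam n : R := (nu * n.+1%:R ^+ 3 + n.+1%:R)%R.
Definition w1 n : R := n.+1%:R.
Definition w4 n : R := (n.+1%:R * lam n)%R.
Definition w0 (n : nat) : R := 1%R.

Lemma lam_gt0 n : (0 < lam n)%R.
Proof. by rewrite /lam addr_gt0// mulr_gt0// exprn_gt0. Qed.
Lemma lam_ge0 n : (0 <= lam n)%R. Proof. exact/ltW/lam_gt0. Qed.
Lemma w1_ge0 n : (0 <= w1 n)%R. Proof. exact: ler0n. Qed.
Lemma w4_ge0 n : (0 <= w4 n)%R. Proof. by rewrite mulr_ge0// lam_ge0. Qed.
Lemma w0_ge0 n : (0 <= w0 n)%R. Proof. exact: ler01. Qed.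

Lemma lam_ge n : (1 + nu <= lam n)%R.
Proof.
have h : (1 <= n.+1%:R :> R)%R by rewrite ler1n.
by rewrite /lam addrC lerD// -[leLHS]mulr1 ler_wpM2l ?(ltW nu_gt0)// exprn_ege1.
Qed.

(* With frequencies N = n+1, K = k+1 the interacting mode is N + K >= N, K. *)
Lemma weight41 n k : (n.+1%:R * n.+1%:R * lam k <= w4 (n + k).+1 * w1 k)%R.
Proof.
rewrite /w4 /w1 /lam; have -> : ((n + k).+2%:R = n.+1%:R + k.+1%:R :> R)%R.
  by rewrite -natrD addSn addnS.
have : (0 <= n.+1%:R :> R)%R by []. have : (0 <= k.+1%:R :> R)%R by [].
move: (n.+1%:R) (k.+1%:R) => N K K0 N0.
have -> : ((N + K) * (nu * (N + K) ^+ 3 + (N + K)) * K =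
   N * N * (nu * K ^+ 3 + K) + (nu * K * (N ^+ 4 + 4%:R * N ^+ 3 * K +
   5%:R * N ^+ 2 * K ^+ 2 + 4%:R * N * K ^+ 3 + K ^+ 4) +
   K * (2%:R * N * K + K ^+ 2)))%R by ring.
by rewrite lerDl addr_ge0// ?mulr_ge0 ?addr_ge0 ?mulr_ge0 ?exprn_ge0// ?(ltW nu_gt0).
Qed.

(** The inequality one derivative lower, for the A^0 norm: the first factor then carries [lam]
    alone, while the second still receives one derivative. *)
Lemma weight31 n k : (w0 n * n.+1%:R * lam k <= lam (n + k).+1 * w1 k)%R.
Proof.
rewrite /w0 /w1 /lam; have -> : ((n + k).+2%:R = n.+1%:R + k.+1%:R :> R)%R.
  by rewrite -natrD addSn addnS.
have : (0 <= n.+1%:R :> R)%R by []. have : (0 <= k.+1%:R :> R)%R by [].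
move: (n.+1%:R) (k.+1%:R) => N K K0 N0; rewrite mul1r.
have -> : ((nu * (N + K) ^+ 3 + (N + K)) * K =
   N * (nu * K ^+ 3 + K) + (nu * K * (N ^+ 3 + 3%:R * N ^+ 2 * K + 2%:R * N * K ^+ 2 +
   K ^+ 3) + K * K))%R by ring.
by rewrite lerDl addr_ge0// ?mulr_ge0 ?addr_ge0 ?mulr_ge0 ?exprn_ge0// ?(ltW nu_gt0).
Qed.

(* For a real function with modes a, the commutator couples the frequency n + 1 only to
   pairs (n + k + 2, k + 1): the products of two lower frequencies cancel. *)
Definition bil a b n k : R[i] := (RC (lam k) * a (n + k).+1 * conjc (b k))%R.
Definition Nl a b n : R[i] := (RC (2 * c * n.+1%:R) * csum (bil a b n))%R.

Lemma cnorm_bil a b n k : cnorm (bil a b n k) = (lam k * cnorm (a (n + k).+1) * cnorm (b k))%R.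
Proof. by rewrite /bil !Normc.normcM cnormR cnormJ ger0_norm// lam_ge0. Qed.

(** For fixed k the map n -> n + k + 1 is injective, so the sum over n is at most the full sum of
    [W] against [a], and the sum over k factors out by Tonelli. The hypothesis on the weights
    distributes the output weight, the derivative contained in [Nl] and [lam k] over the two
    factors. *)
Lemma Nl_bound w W U a b : (forall n, 0 <= w n)%R -> (forall n, 0 <= W n)%R ->
  (forall n, 0 <= U n)%R ->
  (forall n k, w n * n.+1%:R * lam k <= W (n + k).+1 * U k)%R ->
  wsum w (Nl a b) <= (2 * c)%:E * (wsum W a * wsum U b).
Proof.
move=> w_0 W_0 U_0 h.
have b0 n k : 0 <= (W (n + k).+1 * cnorm (a (n + k).+1) * (U k * cnorm (b k)))%:E.
  by rewrite lee_fin !mulr_ge0 ?cnorm_ge0.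
apply: (@le_trans _ _ (\sum_(n <oo) (2 * c)%:E * \sum_(k <oo)
    (W (n + k).+1 * cnorm (a (n + k).+1) * (U k * cnorm (b k)))%:E)).
  apply: lee_nneseries => n *; first by rewrite lee_fin mulr_ge0 ?cnorm_ge0.
  rewrite /Nl Normc.normcM cnormR ger0_norm ?mulr_ge0// ?(ltW c_gt0)//.
  rewrite -!mulrA [(w n * _)%R]mulrC -!mulrA mulrA EFinM lee_wpmul2l//.
    by rewrite lee_fin mulr_ge0// ltW.
  rewrite (_ : _ * (_ * w n) = n.+1%:R * w n * cnorm (csum (bil a b n)))%R; last by ring.
  rewrite EFinM; apply: (@le_trans _ _ ((n.+1%:R * w n)%:E *
      \sum_(k <oo) (cnorm (bil a b n k))%:E)).
    by rewrite lee_wpmul2l ?lee_fin ?mulr_ge0// csum_norme.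
  rewrite -nneseriesZl//; last by move=> k _; rewrite lee_fin cnorm_ge0.
  apply: lee_nneseries => k *; first by rewrite -EFinM lee_fin !mulr_ge0 ?cnorm_ge0.
  rewrite -EFinM lee_fin cnorm_bil.
  rewrite [leLHS](_ : _ = w n * n.+1%:R * lam k * (cnorm (a (n + k).+1) * cnorm (b k)))%R; last
    by ring.
  rewrite [leRHS](_ : _ = W (n + k).+1 * U k * (cnorm (a (n + k).+1) * cnorm (b k)))%R; last by
    ring.
  by rewrite ler_wpM2r ?mulr_ge0 ?cnorm_ge0.
rewrite nneseriesZl; last by move=> n _; apply: nneseries_ge0 => k _ _; exact: b0.
rewrite lee_wpmul2l ?lee_fin ?mulr_ge0// ?(ltW c_gt0)//.
rewrite nneseries_interchange//.
have S0 : 0 <= wsum W a by exact: wsum_ge0.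
apply: (@le_trans _ _ (\sum_(k <oo) (U k * cnorm (b k))%:E * wsum W a)).
  apply: lee_nneseries => k *.
    by apply: nneseries_ge0 => n _ _; exact: b0.
  under eq_eseriesr do rewrite mulrC EFinM.
  rewrite nneseriesZl; last by move=> n _; rewrite lee_fin mulr_ge0 ?cnorm_ge0.
  rewrite lee_wpmul2l ?lee_fin ?mulr_ge0 ?cnorm_ge0//.
  apply: (nneseries_shift (f := fun n => (W n * cnorm (a n))%:E)) => n.
  by rewrite lee_fin mulr_ge0 ?cnorm_ge0.
(* If the sum for [a] is infinite, either [b] contributes nothing and both sides are 0 because
   [0 * oo = 0], or the right-hand side is infinite. *)
have [fin|/negP] := boolP (wsum W a \is a fin_num).
  rewrite -(fineK fin); under eq_eseriesr do rewrite muleC.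
  by rewrite nneseriesZl// => n _; rewrite lee_fin mulr_ge0 ?cnorm_ge0.
rewrite ge0_fin_numE// ltey => /negP; rewrite negbK => /eqP ->.
have [U0|U0] := eqVneq (wsum U b) 0.
  rewrite U0 mule0 eseries0// => k _ _.
  have : (U k * cnorm (b k))%:E <= 0 by rewrite -U0; exact: wsum_term.
  rewrite lee_fin => h0; have -> : (U k * cnorm (b k) = 0)%R; last by rewrite mul0e.
  by apply/eqP; rewrite eq_le h0 mulr_ge0 ?cnorm_ge0.
rewrite gt0_mulye ?leey// lt0e U0/=; exact: wsum_ge0.
Qed.

(** The dissipation bounds each [w4 j * |a_j|] uniformly in j, so the sum over k is carried by [b]
    alone. *)
Lemma bil_summable a b n : wsum w4 a < +oo -> wsum w1 b < +oo ->
  cintegrable (@counting nat R) setT (bil a b n).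
Proof.
move=> ha hb; apply/csummableP.
have fa : wsum w4 a \is a fin_num by rewrite ge0_fin_numE ?wsum_ge0//; exact: w4_ge0.
apply: (@le_lt_trans _ _ (\sum_(k <oo) (fine (wsum w4 a))%:E * (w1 k * cnorm (b k))%:E)).
  apply: lee_nneseries => k *; first by rewrite lee_fin cnorm_ge0.
  rewrite cnorm_bil -EFinM lee_fin.
  have h : (w4 (n + k).+1 * cnorm (a (n + k).+1) <= fine (wsum w4 a))%R.
    by rewrite -lee_fin fineK//; apply: wsum_term; exact: w4_ge0.
  apply: (@le_trans _ _ (w4 (n + k).+1 * w1 k * cnorm (a (n + k).+1) * cnorm (b k))%R).
    do 2 (apply: ler_wpM2r; first exact: cnorm_ge0).
    apply: le_trans (weight41 n k); rewrite ler_peMl ?lam_ge0//.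
    by rewrite -natrM ler1n.
  rewrite (_ : _ * _ = (w4 (n + k).+1 * cnorm (a (n + k).+1)) * (w1 k * cnorm (b k)))%R; last by
    ring.
  by rewrite ler_wpM2r// mulr_ge0 ?cnorm_ge0.
rewrite nneseriesZl; last by move=> k _; rewrite lee_fin mulr_ge0 ?cnorm_ge0.
rewrite fineK// lte_mul_pinfty// ?wsum_ge0//; exact: w4_ge0.
Qed.

(** The increment occurs once in each slot: with [a] in the second slot, or with [b] in the first.
    Hence [a] is measured in A^1 only and [b] by its dissipation only; uniqueness depends on this
    asymmetry. *)
Lemma Nl_sub a b : wsum w4 a < +oo -> wsum w1 a < +oo ->
  wsum w4 b < +oo -> wsum w1 b < +oo -> forall n,
  (Nl a a n - Nl b b n = Nl (fun n => a n - b n) a n + Nl b (fun n => a n - b n) n)%R.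
Proof.
move=> a4 a1 b4 b1 n; rewrite /Nl -mulrBr -mulrDr; congr (_ * _)%R.
have d4 : wsum w4 (fun n => a n - b n)%R < +oo.
  by apply: le_lt_trans (wsumB _ _ w4_ge0) _; rewrite lte_add_pinfty.
have d1 : wsum w1 (fun n => a n - b n)%R < +oo.
  by apply: le_lt_trans (wsumB _ _ w1_ge0) _; rewrite lte_add_pinfty.
rewrite -cintB//; [|exact: bil_summable..].
rewrite -cintD//; [|exact: bil_summable..].
apply: eq_cint => k _; rewrite /bil rmorphB/=; ring.
Qed.

End Sequences.

(** * Sequences of modes depending on time *)

Section TimeDependent.
Context {R : realType}.
Local Open Scope ereal_scope.

(** For each real component the integral for the counting measure is the difference of the sums of
    the positive and negative parts, so measurability includes the points where the series
    diverges. *)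
Lemma cmeas_csum {d} {T : measurableType d} (F : nat -> T -> R[i]) :
  (forall k, cmeas setT (F k)) -> cmeas setT (fun t => csum (F^~ t)).
Proof.
move=> mF.
have key (f : nat -> T -> R) : (forall k, measurable_fun setT (f k)) ->
    measurable_fun setT (fun t => (\int[@counting nat R]_k f k t)%R).
  move=> mf; rewrite /Rintegral; apply: (measurableT_comp (f := fine)) => //.
  under eq_fun do rewrite integralE.
  apply: emeasurable_funB.
    under eq_fun do rewrite ge0_integral_count//.
    apply: ge0_emeasurable_sum => // k _.
    rewrite (_ : (fun _ => _) = (EFin \o f k)^\+); last first.
    by apply/funext => t; rewrite !funeposE.
  by apply: measurable_funepos; exact/measurable_EFinP.
  under eq_fun do rewrite ge0_integral_count//.
  apply: ge0_emeasurable_sum => // k _.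
  rewrite (_ : (fun _ => _) = (EFin \o f k)^\-); last first.
    by apply/funext => t; rewrite !funenegE.
  by apply: measurable_funeneg; exact/measurable_EFinP.
by split; apply: key => k; case: (mF k).
Qed.

Lemma measurable_wsum {d} {T : measurableType d} (D : set T) (w : nat -> R)
    (a : nat -> T -> R[i]) : (forall n, 0 <= w n)%R ->
  (forall n, cmeas D (a n)) -> measurable_fun D (fun t => wsum w (a^~ t)).
Proof.
move=> w_0 ma; apply: ge0_emeasurable_sum => n *.
  by rewrite lee_fin mulr_ge0 ?cnorm_ge0.
by apply/measurable_EFinP; apply: measurable_funM => //; exact: cmeas_norm.
Qed.

Implicit Types (a b M : nat -> R -> R[i]) (al : nat -> R[i]) (w L : nat -> R).

Lemma integral_wsum w M (D : set R) : measurable D -> (forall n, 0 <= w n)%R ->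
  (forall n, cmeas D (M n)) ->
  \int[leb R]_(s in D) wsum w (M^~ s) =
  \sum_(n <oo) (w n)%:E * \int[leb R]_(s in D) (cnorm (M n s))%:E.
Proof.
move=> mD w_0 mM; rewrite /wsum integral_nneseries//.
- apply: eq_eseriesr => n _; rewrite -ge0_integralZl_EFin//.
  + by move=> s _; rewrite lee_fin cnorm_ge0.
  + by apply/measurable_EFinP; exact: cmeas_norm (mM n).
- by move=> n; apply/measurable_EFinP; apply: measurable_funM => //; exact: cmeas_norm (mM n).
- by move=> n s _; rewrite lee_fin mulr_ge0 ?cnorm_ge0.
Qed.

(** Energy inequality: [duh_norme] summed with weights, by Tonelli. The rates [L] are left free
    because the decay estimate uses the shifted rates [lam - g]. *)
Lemma duh_wsum w L al M t : (forall n, 0 <= w n)%R -> (forall n, 0 <= L n)%R ->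
  (forall n T, tintegrable T (M n)) -> (0 <= t)%R ->
  wsum w (fun n => duh (L n) (al n) (M n) t) +
  \int[leb R]_(s in `[0%R, t]) wsum (fun n => w n * L n)%R (fun n => duh (L n) (al n) (M n) s) <=
  wsum w al + \int[leb R]_(s in `[0%R, t]) wsum w (M^~ s).
Proof.
move=> w_0 L0 iM t0.
have mM n : cmeas `[0%R, t]%classic (M n) by have /cintegrableP[] := iM n t.
rewrite integral_wsum//; last 2 first.
- by move=> n; rewrite mulr_ge0.
- by move=> n; apply: ccont_cmeas => //; exact: duh_ccont.
rewrite integral_wsum// /wsum -!nneseriesD; last 4 first.
- by move=> n _ _; rewrite lee_fin mulr_ge0 ?cnorm_ge0.
- by move=> n _ _; rewrite mule_ge0 ?lee_fin ?integral_ge0// => s _; rewrite lee_fin cnorm_ge0.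
- by move=> n _ _; rewrite lee_fin mulr_ge0 ?cnorm_ge0.
- move=> n _ _; rewrite mule_ge0 ?lee_fin ?mulr_ge0 ?integral_ge0// => s _.
  by rewrite lee_fin cnorm_ge0.
apply: lee_nneseries => n *.
  rewrite adde_ge0 ?lee_fin ?mulr_ge0 ?cnorm_ge0// mule_ge0 ?lee_fin ?mulr_ge0 ?integral_ge0//.
  by move=> s _; rewrite lee_fin cnorm_ge0.
rewrite !EFinM -muleA -!ge0_muleDr ?lee_fin ?cnorm_ge0//; last 2 first.
- by apply: integral_ge0 => s _; rewrite lee_fin cnorm_ge0.
- by rewrite mule_ge0 ?lee_fin ?integral_ge0// => s _; rewrite lee_fin cnorm_ge0.
by rewrite lee_wpmul2l ?lee_fin// duh_norme.
Qed.

Lemma tintegrable_wsum w M T : (forall n, 1 <= w n)%R -> (forall n, cmeas setT (M n)) ->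
  \int[leb R]_(s in `[0%R, T]) wsum w (M^~ s) < +oo -> forall n, tintegrable T (M n).
Proof.
move=> w_1 mM foo n; apply/cintegrableP => //; split.
  by apply: cmeasS (mM n).
apply: le_lt_trans foo; apply: ge0_le_integralW => s _.
  by rewrite lee_fin cnorm_ge0.
apply: (@le_trans _ _ (w n * cnorm (M n s))%:E).
  by rewrite lee_fin ler_peMl ?cnorm_ge0.
by apply: wsum_term => k; rewrite (le_trans ler01).
Qed.

Lemma duhB l (x y : R[i]) (F G : R -> R[i]) t :
  tintegrable t F -> tintegrable t G ->
  (duh l x F t - duh l y G t = duh l (x - y) (fun s => F s - G s) t)%R.
Proof.
move=> iF iG; rewrite /duh -mulrBr; congr (_ * _)%R.
have -> : tint t (fun s => RC (expR (l * s)) * (F s - G s))%R =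
    (tint t (fun s => RC (expR (l * s)) * F s) - tint t (fun s => RC (expR (l * s)) * G s))%R.
  rewrite /tint -cintB//; [|exact: tintegrable_expM..].
  by apply: eq_cint => s _; rewrite mulrBr.
ring.
Qed.

Variables (nu c : R).
Hypotheses (nu_gt0 : (0 < nu)%R) (c_gt0 : (0 < c)%R).

Definition NN a b n t : R[i] := Nl nu c (a^~ t) (b^~ t) n.
Let W4 := w4_ge0 nu_gt0.
Let W1 n : (0 <= w1 n :> R)%R := w1_ge0 n.

Lemma NN_cmeas a b : (forall n, cmeas setT (a n)) -> (forall n, cmeas setT (b n)) ->
  forall n, cmeas setT (NN a b n).
Proof.
move=> ma mb n; apply: cmeasM; first exact: cmeas_cst.
apply: cmeas_csum => k; apply: cmeasM; last exact: cmeasJ.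
by apply: cmeasM => //; exact: cmeas_cst.
Qed.

(** The bilinear estimate integrated in time: integrable dissipation in the first slot, A^1 norm
    bounded in time in the second. *)
Lemma NN_int a b t (A B : R) : (0 <= B)%R ->
  (forall n, cmeas setT (a n)) ->
  (forall n, cmeas setT (b n)) ->
  (forall s, (0 <= s)%R -> (s <= t)%R -> wsum w1 (b^~ s) <= B%:E) ->
  \int[leb R]_(s in `[0%R, t]) wsum (w4 nu) (a^~ s) <= A%:E ->
  \int[leb R]_(s in `[0%R, t]) wsum w1 (fun n => NN a b n s) <= (2 * c * (A * B))%:E.
Proof.
move=> B0 ma mb bB aA.
have h0 s : 0 <= wsum (w4 nu) (a^~ s) by exact: wsum_ge0.
apply: (@le_trans _ _ (\int[leb R]_(s in `[0%R, t]) ((2 * c * B)%:E * wsum (w4 nu) (a^~ s)))).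
  apply: ge0_le_integralW => s; first by move=> _; exact: wsum_ge0.
  rewrite /= in_itv/= => /andP[s0 st].
  have hN := @Nl_bound R nu c nu_gt0 c_gt0 w1 (w4 nu) w1 (a^~ s) (b^~ s) W1 W4 W1
    (weight41 nu_gt0).
  apply: (le_trans hN).
  rewrite (EFinM (2 * c)%R B) -muleA; apply: lee_wpmul2l; first by rewrite lee_fin mulr_ge0// ltW.
  by rewrite muleC lee_wpmul2r// bB.
rewrite ge0_integralZl_EFin//; last 2 first.
- by apply: measurable_wsum => // n; apply: cmeasS (ma n).
- by rewrite !mulr_ge0// ltW.
rewrite [X in _ <= X%:E](_ : _ = (2 * c * B) * A)%R; last by ring.
by rewrite (EFinM (2 * c * B)%R A) lee_wpmul2l// lee_fin !mulr_ge0// ltW.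
Qed.

Lemma wsum_ae_fin w a t : (forall n, 0 <= w n)%R -> (forall n, cmeas setT (a n)) ->
  \int[leb R]_(s in `[0%R, t]) wsum w (a^~ s) < +oo ->
  {ae leb R, forall s, `[0%R, t]%classic s -> wsum w (a^~ s) < +oo}.
Proof.
move=> w_0 ma foo.
have i : (leb R).-integrable `[0%R, t] (fun s => wsum w (a^~ s)).
  apply/integrableP; split.
    by apply: measurable_wsum => // n; apply: cmeasS (ma n).
  by under eq_integral do rewrite gee0_abs ?wsum_ge0//.
have := integrable_ae _ i => /(_ (measurable_itv _)); apply: filterS => s h st.
by rewrite -ge0_fin_numE ?wsum_ge0// h.
Qed.

(** [Nl_sub] requires finite dissipation of both arguments, which the integral bounds give at almost
    every time; each slot contributes [2 c r d]. *)
Lemma NN_sub_int a b t (r d : R) : (0 <= r)%R -> (0 <= d)%R ->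
  (forall n, cmeas setT (a n)) -> (forall n, cmeas setT (b n)) ->
  (forall s, (0 <= s)%R -> (s <= t)%R -> wsum w1 (a^~ s) <= r%:E) ->
  \int[leb R]_(s in `[0%R, t]) wsum (w4 nu) (a^~ s) < +oo ->
  (forall s, (0 <= s)%R -> (s <= t)%R -> wsum w1 (b^~ s) <= r%:E) ->
  \int[leb R]_(s in `[0%R, t]) wsum (w4 nu) (b^~ s) <= r%:E ->
  (forall s, (0 <= s)%R -> (s <= t)%R -> wsum w1 (fun n => a n s - b n s)%R <= d%:E) ->
  \int[leb R]_(s in `[0%R, t]) wsum (w4 nu) (fun n => a n s - b n s)%R <= d%:E ->
  \int[leb R]_(s in `[0%R, t]) wsum w1 (fun n => NN a a n s - NN b b n s)%R <=
    (4 * c * (r * d))%:E.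
Proof.
move=> r0 d0 ma mb a1 a4 b1 b4 d1 d4.
pose D n s := (a n s - b n s)%R.
have mD n : cmeas setT (D n) by apply: cmeasD => //; exact: cmeasN.
have mW x y : (forall n, cmeas setT (x n)) -> (forall n, cmeas setT (y n)) ->
    measurable_fun `[0%R, t]%classic (fun s => wsum w1 (fun n => NN x y n s)).
  by move=> mx my; apply: measurable_wsum => // n; apply: cmeasS (NN_cmeas mx my n).
apply: (@le_trans _ _ (\int[leb R]_(s in `[0%R, t])
    (wsum w1 (fun n => NN D a n s) + wsum w1 (fun n => NN b D n s)))).
  apply: ae_ge0_le_integral => //.
  - by move=> s _; exact: wsum_ge0.
  - apply: measurable_wsum => // n; apply: (@cmeasS _ _ _ _ setT) => //.
    by apply: cmeasD; [exact: NN_cmeas|apply: cmeasN; exact: NN_cmeas].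
  - by move=> s _; rewrite adde_ge0 ?wsum_ge0.
  - by apply: emeasurable_funD; exact: mW.
  have b4' := le_lt_trans b4 (ltry _).
  have FF := ae_filter_ringOfSetsType (leb R).
  apply: filterS2 (wsum_ae_fin W4 ma a4) (wsum_ae_fin W4 mb b4') => s ha hb st.
  have {ha} ha := ha st; have {hb} hb := hb st.
  move: st; rewrite /= in_itv/= => /andP[s0 st].
  have a1' := le_lt_trans (a1 _ s0 st) (ltry _).
  have b1' := le_lt_trans (b1 _ s0 st) (ltry _).
  rewrite -/(wsum _ _); under [X in wsum _ X]eq_fun do rewrite /NN Nl_sub//.
  exact: wsumD.
rewrite ge0_integralD//; [|by move=> s _; exact: wsum_ge0|exact: mW|by move=> s _; exact:
  wsum_ge0|exact: mW].
have -> : (4 * c * (r * d) = 2 * c * (d * r) + 2 * c * (r * d))%R by ring.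
by rewrite EFinD leeD//; exact: NN_int.
Qed.

End TimeDependent.

Lemma NN_ext {R : realType} (nu c : R) (a a' b b' : nat -> R -> R[i]) n t :
  (forall k, a k t = a' k t) -> (forall k, b k t = b' k t) ->
  NN nu c a b n t = NN nu c a' b' n t.
Proof.
move=> ha hb; rewrite /NN (_ : a^~ t = a'^~ t); last exact/funext.
by rewrite (_ : b^~ t = b'^~ t); last exact/funext.
Qed.

Lemma duh_ext {R : realType} (l : R) (x : R[i]) (F G : R -> R[i]) t :
  (forall s, 0 <= s -> F s = G s) -> duh l x F t = duh l x G t.
Proof.
move=> h; rewrite /duh; congr (_ * (_ + _)); apply: eq_cint => s.
by rewrite /= in_itv/= => /andP[s0 _]; rewrite h.
Qed.

(** * Picard iteration and mild solutions *)

Section Picard.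
Context {R : realType}.
Local Open Scope ereal_scope.
Implicit Types (a b M : nat -> R -> R[i]).

Lemma nneseries_le_bound (f : nat -> \bar R) (B : \bar R) : (forall n, 0 <= f n) ->
  (forall m, \sum_(0 <= i < m) f i <= B) -> \sum_(i <oo) f i <= B.
Proof.
move=> f0 h; apply: lime_le; first by apply: is_cvg_nneseries => n *.
exact: nearW.
Qed.


Lemma cvg_geometric_steps (u : nat -> R) (q : R) : (0 <= q)%R -> (q < 1)%R ->
  (forall j, `|u j.+1 - u j| <= q ^+ j)%R -> cvgn u.
Proof.
move=> q0 q1 h.
have cs : cvgn (series (fun j => u j.+1 - u j)%R).
  apply: normed_cvg.
  apply: (@series_le_cvg _ (fun j => `|u j.+1 - u j|)%R (fun j => q ^+ j)%R) => //.
  - by move=> n; exact: exprn_ge0.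
  - rewrite (_ : (fun j => q ^+ j)%R = geometric 1 q); last first.
      by apply/funext => n; rewrite /geometric/= mul1r.
    by apply: is_cvg_geometric_series; rewrite ger0_norm.
have -> : u = (fun n => u 0%N + series (fun j => u j.+1 - u j) n)%R.
  by apply/funext => n; rewrite seriesEnat /= telescope_sumr// addrC subrK.
by apply: is_cvgD => //; exact: is_cvg_cst.
Qed.

Lemma cnorm_telescope (u : nat -> R[i]) j m :
  (cnorm (u (j + m)%N - u j))%:E <=
  \sum_(0 <= i < m) (cnorm (u (j + i).+1 - u (j + i)%N))%:E.
Proof.
elim: m => [|m ih]; first by rewrite addn0 subrr Normc.normc0 big_nil.
rewrite big_nat_recr//= addnS.
have -> : (u (j + m).+1 - u j = (u (j + m)%N - u j) + (u (j + m).+1 - u (j + m)%N))%R.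
  by rewrite [RHS]addrC subrKA.
by apply: le_trans (leeD2r _ ih); rewrite -EFinD lee_fin cnormD.
Qed.

(** The arithmetic that makes the ball of radius 1/2 invariant: data of size 1/4 plus the nonlinear
    contribution [2 c (1/2)^2]. *)
Lemma quarter (c : R) : (2 * c < 1 -> 4^-1 + c / 2 <= 2^-1)%R.
Proof. move=> h; have : (4^-1 = 1 / 4 :> R)%R by rewrite mul1r. have : (2^-1 = 1 / 2 :> R)%R by
  rewrite mul1r. lra. Qed.

Variables (nu c : R).
Hypotheses (nu_gt0 : (0 < nu)%R) (c_gt0 : (0 < c)%R) (c_lt : (2 * c < 1)%R).
Variable al : nat -> R[i].
Hypothesis al_small : wsum w1 al <= (4^-1)%:E.

Let W4 := w4_ge0 nu_gt0.
Let W1 n : (0 <= w1 n :> R)%R := w1_ge0 n.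

(** Size at time t plus the dissipation spent up to t. In [EN_le] one radius serves for all times,
    which is what makes the solution global. *)
Definition EN a t := wsum w1 (a^~ t) + \int[leb R]_(s in `[0%R, t]) wsum (w4 nu) (a^~ s).

Definition EN_le a (r : R) := forall t, (0 <= t)%R -> EN a t <= r%:E.

Lemma EN_le1 a r t : EN_le a r -> (0 <= t)%R -> wsum w1 (a^~ t) <= r%:E.
Proof.
move=> h t0; apply: le_trans (h t t0); rewrite leeDl// integral_ge0// => s _.
exact: wsum_ge0.
Qed.

Lemma EN_le4 a r t : EN_le a r -> (0 <= t)%R ->
  \int[leb R]_(s in `[0%R, t]) wsum (w4 nu) (a^~ s) <= r%:E.
Proof. by move=> h t0; apply: le_trans (h t t0); rewrite leeDr// wsum_ge0. Qed.

Definition Sm (be : nat -> R[i]) M n : R -> R[i] := duh (lam nu n) (be n) (M n).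

Lemma Sm_EN be M t : (forall n T, tintegrable T (M n)) -> (0 <= t)%R ->
  EN (Sm be M) t <= wsum w1 be + \int[leb R]_(s in `[0%R, t]) wsum w1 (M^~ s).
Proof. by move=> iM t0; apply: duh_wsum => // n; exact: lam_ge0. Qed.

Lemma NN_tint a r : (forall n, cmeas setT (a n)) -> EN_le a r -> (0 <= r)%R ->
  forall n T, tintegrable T (NN nu c a a n).
Proof.
move=> ma ar r0 n T; case: (leP 0%R T) => [T0|T0]; last first.
  by rewrite /tintegrable set_itv_ge -?ltNge ?bnd_simp//; split; exact: integrable_set0.
apply: (@tintegrable_wsum _ w1) => //.
- by move=> k; rewrite /w1 ler1n.
- exact: NN_cmeas.
apply: le_lt_trans (ltry (2 * c * (r * r))%R).
apply: NN_int => //; last exact: EN_le4.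
by move=> s s0 _; exact: EN_le1.
Qed.

(** Contraction of the Duhamel map: the factor [4 c r] equals [2 c < 1] on the ball of radius
    [r = 1/2]. The common datum [al] cancels in the difference. *)
Lemma EN_sub_le a b r d : (0 <= r)%R -> (0 <= d)%R ->
  (forall n, cmeas setT (a n)) -> (forall n, cmeas setT (b n)) ->
  EN_le a r -> EN_le b r -> EN_le (fun n t => a n t - b n t)%R d ->
  EN_le (fun n t => Sm al (NN nu c a a) n t - Sm al (NN nu c b b) n t)%R (4 * c * (r * d))%R.
Proof.
move=> r0 d0 ma mb ar br abd t t0.
have ia := NN_tint ma ar r0; have ib := NN_tint mb br r0.
have iab n T : tintegrable T (fun s => NN nu c a a n s - NN nu c b b n s)%R.
  by apply: cintegrableB => //; [exact: ia|exact: ib].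
have E : (fun n t => Sm al (NN nu c a a) n t - Sm al (NN nu c b b) n t)%R =
    Sm (fun=> 0%R) (fun n s => NN nu c a a n s - NN nu c b b n s)%R.
  apply/funext => n; apply/funext => s; rewrite /Sm duhB ?subrr//.
rewrite E; apply: le_trans (Sm_EN _ iab t0) _.
rewrite {1}/wsum eseries0 ?add0e; last by move=> n _ _; rewrite Normc.normc0 mulr0.
apply: NN_sub_int => //.
- by move=> s s0 _; exact: EN_le1.
- exact: le_lt_trans (EN_le4 ar t0) (ltry _).
- by move=> s s0 _; exact: EN_le1.
- exact: EN_le4.
- by move=> s s0 _; apply: (EN_le1 abd).
- exact: (EN_le4 abd).
Qed.

Fixpoint pic j : nat -> R -> R[i] :=
  if j is j'.+1 then Sm al (NN nu c (pic j') (pic j')) else fun _ _ => 0%R.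

Lemma pic_prop j : (forall n, ccont (pic j n)) /\ EN_le (pic j) 2^-1.
Proof.
elim: j => [|j [cj ej]].
  split; first by move=> n; exact: ccont_cst.
  move=> t t0; rewrite /EN /= {1}/wsum eseries0; last first.
    by move=> n _ _; rewrite Normc.normc0 mulr0.
  rewrite add0e integral0_eq ?lee_fin ?invr_ge0// => s _; rewrite /wsum eseries0// => n _ _.
  by rewrite Normc.normc0 mulr0.
have mj n : cmeas setT (pic j n) by exact: ccont_cmeas.
have h : (0 <= 2^-1 :> R)%R by rewrite invr_ge0.
have ij := NN_tint mj ej h.
split; first by move=> n; apply: duh_ccont => T; exact: ij.
move=> t t0; apply: le_trans (Sm_EN _ ij t0) _.
apply: (@le_trans _ _ ((4^-1)%:E + (2 * c * (2^-1 * 2^-1))%:E)).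
  apply: leeD => //; apply: NN_int => //; last exact: EN_le4.
  by move=> s s0 _; exact: EN_le1.
by rewrite -EFinD lee_fin (_ : 2 * c * (2^-1 * 2^-1) = c / 2)%R; [exact: quarter|field].
Qed.

Let picm j n : cmeas setT (pic j n).
Proof. by apply: ccont_cmeas => //; case: (pic_prop j). Qed.

Lemma pic_diff j : EN_le (fun n t => pic j.+1 n t - pic j n t)%R ((2 * c) ^+ j).
Proof.
have h : (0 <= 2^-1 :> R)%R by rewrite invr_ge0.
elim: j => [|j ih].
  move=> t t0; rewrite expr0.
  rewrite (_ : (fun n t => pic 1 n t - pic 0 n t)%R = pic 1); last first.
    by apply/funext => n; apply/funext => s; rewrite subr0.
  by have [_ /(_ t t0)] := pic_prop 1; move/le_trans; apply; rewrite lee_fin; lra.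
have -> : ((2 * c) ^+ j.+1 = 4 * c * (2^-1 * (2 * c) ^+ j))%R.
  by rewrite exprS; field.
apply: EN_sub_le => //; first by rewrite exprn_ge0// mulr_ge0// ltW.
- by move=> n; exact: picm j.+1 n.
- by case: (pic_prop j.+1).
- by case: (pic_prop j).
Qed.

Let q : R := (2 * c)%R.
Let q_ge0 : (0 <= q)%R. Proof. by rewrite mulr_ge0// ltW. Qed.

Lemma EN_le_cnorm a r n t : EN_le a r -> (0 <= t)%R -> (cnorm (a n t) <= r)%R.
Proof.
move=> ar t0; rewrite -lee_fin; apply: le_trans (EN_le1 ar t0).
apply: le_trans (wsum_term (a^~ t) n W1).
by rewrite lee_fin ler_peMl ?cnorm_ge0// ler1n.
Qed.

(** The iterates are controlled for [t >= 0] only; freezing negative times at 0 makes the limits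
    exist for all t, hence the limit measurable on the whole line. *)
Definition picl n t : R[i] :=
  Complex (limn (fun j => cRe (pic j n (Num.max t 0)%R)))
          (limn (fun j => cIm (pic j n (Num.max t 0)%R))).

Lemma pic_cvg n t : (0 <= t)%R ->
  (cRe (pic j n t) @[j --> \oo] --> cRe (picl n t)) /\
  (cIm (pic j n t) @[j --> \oo] --> cIm (picl n t)).
Proof.
move=> t0; rewrite /picl/= max_l//; split; apply: (@cvg_geometric_steps _ q) => // j.
- rewrite -cReN -cReD; apply: le_trans (Re_le_cnorm _) _.
  exact: (EN_le_cnorm n (pic_diff j)).
- rewrite -cImN -cImD; apply: le_trans (Im_le_cnorm _) _.
  exact: (EN_le_cnorm n (pic_diff j)).
Qed.

Lemma picl_cmeas n : cmeas setT (picl n).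
Proof.
have cm : continuous (fun t : R => Num.max t 0)%R.
  move=> t; apply: continuous_max; [exact: cvg_id|exact: cvg_cst].
have m0 t : (0 <= Num.max t 0 :> R)%R by rewrite le_max lexx orbT.
have e t : picl n t = picl n (Num.max t 0)%R by rewrite /picl [Num.max (Num.max t 0)%R _]max_l.
have cc (f : R -> R) : continuous f -> measurable_fun setT (fun t : R => f (Num.max t 0)%R).
  move=> cf; apply: continuous_measurable_fun => t.
  by apply: (@continuous_comp _ _ _ (fun t : R => Num.max t 0)%R f); [exact: cm|exact: cf].
split.
  apply: (@measurable_fun_cvg _ (R : measurableType _) R setT
    (fun j t => cRe (pic j n (Num.max t 0)%R)) (fun t => cRe (picl n t))).
    by move=> j; apply: (cc (fun t => cRe (pic j n t))); case: (pic_prop j) => /(_ n) [].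
  by move=> t _; rewrite e; case: (pic_cvg n (m0 t)).
apply: (@measurable_fun_cvg _ (R : measurableType _) R setT
  (fun j t => cIm (pic j n (Num.max t 0)%R)) (fun t => cIm (picl n t))).
  by move=> j; apply: (cc (fun t => cIm (pic j n t))); case: (pic_prop j) => /(_ n) [].
by move=> t _; rewrite e; case: (pic_cvg n (m0 t)).
Qed.

Lemma pic_dist j n t : (0 <= t)%R ->
  (cnorm (picl n t - pic j n t))%:E <=
  \sum_(i <oo) (cnorm (pic (j + i).+1 n t - pic (j + i) n t))%:E.
Proof.
move=> t0.
have pos i : 0 <= (cnorm (pic (j + i).+1 n t - pic (j + i) n t))%:E by rewrite lee_fin cnorm_ge0.
have [fin|] := boolP (\sum_(i <oo) (cnorm (pic (j + i).+1 n t - pic (j + i) n t))%:E < +oo);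
  last by rewrite -leNgt => h; rewrite (le_trans _ h)// leey.
have fS : \sum_(i <oo) (cnorm (pic (j + i).+1 n t - pic (j + i) n t))%:E \is a fin_num.
  by rewrite ge0_fin_numE// nneseries_ge0.
rewrite -(fineK fS) lee_fin; apply/ler_addgt0Pl => e e0.
have [cR cI] := pic_cvg n t0.
have e2 : (0 < e / 2)%R by rewrite divr_gt0.
have /cvgrPdist_lt/(_ _ e2) [m1 _ h1] := cR.
have /cvgrPdist_lt/(_ _ e2) [m2 _ h2] := cI.
pose m := (m1 + m2)%N.
have -> : (picl n t - pic j n t = (picl n t - pic (j + m) n t) + (pic (j + m) n t - pic j n t))%R
  by ring.
apply: le_trans (cnormD _ _) _; apply: lerD.
  apply: le_trans (cnorm_le _) _; rewrite cReD cReN cImD cImN.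
  rewrite [e in (_ <= e)%R]splitr; apply: lerD; apply: ltW.
    by apply: h1; rewrite /= /m addnCA leq_addr.
  by apply: h2; rewrite /= /m addnA leq_addl.
rewrite -lee_fin fineK//.
apply: (@le_trans _ _ (\sum_(0 <= i < m) (cnorm (pic (j + i).+1 n t - pic (j + i) n t))%:E));
  last first.
  exact: nneseries_lim_ge.
exact: (cnorm_telescope (fun i => pic i n t)).
Qed.

(** Countable subadditivity of [EN]. Applied to the telescoping series of the iterates, it plays the
    role of completeness of the space: it bounds the distance from an iterate to the limit. *)
Lemma EN_lim a (dd : nat -> nat -> R -> R[i]) t : (0 <= t)%R ->
  (forall i n, cmeas setT (dd i n)) ->
  (forall n s, (0 <= s)%R -> (cnorm (a n s))%:E <= \sum_(i <oo) (cnorm (dd i n s))%:E) ->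
  EN a t <= \sum_(i <oo) EN (dd i) t.
Proof.
move=> t0 md h; rewrite /EN nneseriesD; last 2 first.
- by move=> i _ _; exact: wsum_ge0.
- by move=> i _ _; apply: integral_ge0 => s _; exact: wsum_ge0.
apply: leeD; first by apply: (wsum_lim (zz := fun i n => dd i n t)) => // n; exact: h.
rewrite -integral_nneseries//.
- apply: ge0_le_integralW => s; first by move=> _; exact: wsum_ge0.
  rewrite /= in_itv/= => /andP[s0 st].
  by apply: (wsum_lim (zz := fun i n => dd i n s)) => // n; exact: h.
- move=> i; apply: measurable_wsum => // n; exact: cmeasS (md i n).
- by move=> i s _; exact: wsum_ge0.
Qed.

Lemma EN_D a b t : (forall n, cmeas setT (a n)) -> (forall n, cmeas setT (b n)) ->
  EN (fun n t => a n t + b n t)%R t <= EN a t + EN b t.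
Proof.
move=> ma mb; rewrite /EN addeACA; apply: leeD; first exact: wsumD.
rewrite -ge0_integralD//.
- by apply: ge0_le_integralW => s _; [exact: wsum_ge0|exact: wsumD].
- by move=> s _; exact: wsum_ge0.
- by apply: measurable_wsum => // n; apply: cmeasS (ma n).
- by move=> s _; exact: wsum_ge0.
- by apply: measurable_wsum => // n; apply: cmeasS (mb n).
Qed.

Lemma picl_pic j : EN_le (fun n t => picl n t - pic j n t)%R (q ^+ j / (1 - q)).
Proof.
move=> t t0.
apply: le_trans (@EN_lim _ (fun i n t => pic (j + i).+1 n t - pic (j + i) n t)%R t t0 _ _) _.
- by move=> i n; apply: cmeasD => //; exact: cmeasN.
- by move=> n s s0; exact: pic_dist.
apply: (@le_trans _ _ (\sum_(i <oo) (q ^+ (j + i))%:E)).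
  apply: lee_nneseries => i *; last exact: pic_diff.
  by rewrite /EN adde_ge0 ?wsum_ge0// integral_ge0// => s _; exact: wsum_ge0.
apply: nneseries_le_bound => [n|m]; first by rewrite lee_fin exprn_ge0.
rewrite sumEFin lee_fin.
have := @geometric_le_lim R m (q ^+ j) q; rewrite exprn_ge0// ger0_norm// => /(_ isT) h.
have q0 : (0 < q)%R by rewrite mulr_gt0.
apply: le_trans (h q0 c_lt).
rewrite le_eqVlt; apply/orP; left; apply/eqP; rewrite seriesEnat/=.
by apply: eq_bigr => i _; rewrite exprD.
Qed.

Lemma cvg_tail (K : R) : (K * q ^+ j @[j --> \oo] --> (0 : R))%R.
Proof.
rewrite -[X in _ --> X](mulr0 K); apply: cvgM; first exact: cvg_cst.
by apply: cvg_expr; rewrite ger0_norm.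
Qed.

Lemma picl_EN : EN_le picl 2^-1.
Proof.
move=> t t0.
have h j : EN picl t <= (2^-1 + (1 - q)^-1 * q ^+ j)%:E.
  have -> : picl = (fun n t => pic j n t + (picl n t - pic j n t))%R.
    by apply/funext => n; apply/funext => s; rewrite addrC subrK.
  apply: le_trans (EN_D _ _ _) _ => //.
    by move=> n; apply: cmeasD; [exact: picl_cmeas|exact: cmeasN].
  rewrite EFinD; apply: leeD; first by case: (pic_prop j) => _; apply.
  by rewrite mulrC; exact: picl_pic.
have f : EN picl t \is a fin_num.
  rewrite ge0_fin_numE; first exact: le_lt_trans (h 0%N) (ltry _).
  by rewrite /EN adde_ge0 ?wsum_ge0// integral_ge0// => s _; exact: wsum_ge0.
rewrite -(fineK f) lee_fin.
have l : (2^-1 + (1 - q)^-1 * q ^+ j @[j --> \oo] --> (2^-1 + 0 : R))%R.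
  by apply: cvgD; [exact: cvg_cst|exact: cvg_tail].
rewrite -[leRHS]addr0 -(cvg_lim _ l)//; apply: limr_ge.
  by apply/cvg_ex; eexists; exact: l.
by apply: nearW => j; rewrite -lee_fin fineK.
Qed.

Lemma picl_fix n t : (0 <= t)%R -> picl n t = Sm al (NN nu c picl picl) n t.
Proof.
move=> t0; set b := Sm _ _.
have h2 : (0 <= 2^-1 :> R)%R by rewrite invr_ge0.
have q1' : (0 < 1 - q)%R by rewrite subr_gt0.
(* Both [b] and [picl] are within [q^(j+1) / (1 - q)] of the iterate j + 1: the first by contraction
   from the iterate j, the second by [picl_pic]. *)
have hb j : (cnorm (b n t - picl n t) <= 2 / (1 - q) * q ^+ j)%R.
  have e j' : (0 <= q ^+ j' / (1 - q))%R by rewrite divr_ge0 ?exprn_ge0// ltW.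
  have [_ pj] := pic_prop j.
  have := EN_sub_le h2 (e j) picl_cmeas (picm j) picl_EN pj (picl_pic j).
  move=> /(EN_le_cnorm n) /(_ t0) h1.
  have := EN_le_cnorm n (picl_pic j.+1) t0 => h3.
  have -> : (b n t - picl n t = (b n t - pic j.+1 n t) - (picl n t - pic j.+1 n t))%R by ring.
  apply: le_trans (cnormB _ _) _; apply: le_trans (lerD h1 h3) _.
  have -> : (4 * c * (2^-1 * (q ^+ j / (1 - q))) = q ^+ j.+1 / (1 - q))%R.
    by rewrite exprS /q; field; rewrite -/q; apply: lt0r_neq0.
  have -> : (q ^+ j.+1 / (1 - q) + q ^+ j.+1 / (1 - q) = q * (2 / (1 - q) * q ^+ j))%R.
    by rewrite exprS; ring.
  by rewrite ler_piMl// ?(ltW c_lt)// mulr_ge0 ?exprn_ge0// divr_ge0// ltW.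
have z : (cnorm (b n t - picl n t) <= 0)%R.
  have l := cvg_tail (2 / (1 - q))%R; rewrite -(cvg_lim _ l)//; apply: limr_ge.
    by apply/cvg_ex; eexists; exact: l.
  exact: nearW.
have : (cnorm (b n t - picl n t) = 0)%R by apply/eqP; rewrite eq_le z cnorm_ge0.
by move=> /Normc.eq0_normc /eqP; rewrite subr_eq0 eq_sym => /eqP.
Qed.

Theorem mild_existence : exists a : nat -> R -> R[i],
  [/\ forall n, ccont (a n), forall n T, tintegrable T (NN nu c a a n),
      forall n t, a n t = Sm al (NN nu c a a) n t & EN_le a 2^-1].
Proof.
have h2 : (0 <= 2^-1 :> R)%R by rewrite invr_ge0.
have ip := NN_tint picl_cmeas picl_EN h2.
(* The limit [picl] is only known to be measurable and solves the equation for [t >= 0] only. One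
   more application of the Duhamel map gives a continuous function with the same values for
   [t >= 0], for which the equation holds at all times. *)
have [a aS] : exists a, a = Sm al (NN nu c picl picl) by exists (Sm al (NN nu c picl picl)).
have ca n : ccont (a n) by rewrite aS; apply: duh_ccont => T; exact: ip.
have ap n t : (0 <= t)%R -> a n t = picl n t by move=> t0; rewrite aS -picl_fix.
have wE w t : (0 <= t)%R -> wsum w (a^~ t) = wsum w (picl^~ t).
  by move=> t0; apply: eq_eseriesr => n _; rewrite ap.
have aE : EN_le a 2^-1.
  move=> t t0; apply: le_trans (picl_EN t0); rewrite /EN wE// leeD2l//.
  apply: ge0_le_integralW => s; first by move=> _; exact: wsum_ge0.
  by rewrite /= in_itv/= => /andP[s0 _]; rewrite wE.
have NE n t : (0 <= t)%R -> NN nu c a a n t = NN nu c picl picl n t.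
  by move=> t0; apply: NN_ext => k; exact: ap.
exists a; split => //.
- by apply: NN_tint aE h2 => n; exact: ccont_cmeas.
- move=> n t; rewrite {1}aS; apply: duh_ext => s s0.
  by rewrite NE.
Qed.

End Picard.

Lemma integrableRZ {d} {T : measurableType d} {R : realType}
    (mu : {measure set T -> \bar R}) (D : set T) (k : R) (f : T -> R) :
  measurable D -> mu.-integrable D (EFin \o f) ->
  mu.-integrable D (EFin \o (fun x => k * f x)).
Proof.
move=> mD i; rewrite (_ : EFin \o _ = (fun x => k%:E * (EFin \o f) x)%E)//.
exact: integrableZl.
Qed.

(** * Gronwall's lemma with an integrable coefficient *)

Section Gronwall.
Context {R : realType}.

(** As [phi] is only measurable and bounded, the argument takes the largest [[0, u]] on which [phi]
    vanishes. Continuity of the primitive of [y] yields [v > u] such that the integral of [y] over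
    []u, v]] is at most 1/2; the supremum M of [phi] there satisfies [M <= M / 2], so [phi] vanishes
    up to v, against the choice of u. *)
Lemma gronwall (phi y : R -> R) (B : R) :
  (forall t, 0 <= phi t <= B) -> measurable_fun setT phi ->
  (forall t, 0 <= y t) -> (forall T, (leb R).-integrable `[0, T] (EFin \o y)) ->
  (forall t, 0 <= t -> phi t <= \int[leb R]_(s in `[0, t]) (y s * phi s)) ->
  forall t, 0 <= t -> phi t = 0.
Proof.
move=> phiB mphi y0 iy h.
have p0 t : 0 <= phi t by case/andP: (phiB t).
have pB t : phi t <= B by case/andP: (phiB t).
have iyp T : (leb R).-integrable `[0, T] (EFin \o (fun s => y s * phi s)).
  apply: (@le_integrable _ _ _ (leb R) _ _ _ (fun s => (B%:E * (y s)%:E)%E)) => //.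
  - apply/measurable_EFinP; apply: measurable_funM; last exact: measurable_funTS.
    by apply/measurable_EFinP; exact: measurable_int (iy T).
  - move=> s _ /=; rewrite lee_fin ger0_norm ?mulr_ge0// ger0_norm; last first.
      by rewrite mulr_ge0// (le_trans (p0 0)).
    by rewrite mulrC ler_wpM2r.
  - by apply: integrableZl => //; exact: iy.
pose S := [set t | 0 <= t /\ forall s, 0 <= s -> s <= t -> phi s = 0].
have zero u : 0 <= u -> (forall s, 0 <= s -> s < u -> phi s = 0) ->
    \int[leb R]_(s in `[0, u]) (y s * phi s) = 0.
  move=> u0 hu; rewrite -Rintegral_itv_bndo_bndc; last first.
    by apply: integrableS (iyp u) => //; apply: subset_itvl; rewrite bnd_simp.
  have -> : \int[leb R]_(s in `[0, u[) (y s * phi s) = \int[leb R]_(s in `[0, u[) 0.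
    apply: eq_Rintegral => s; rewrite inE/= in_itv/= => /andP[s0 su].
    by rewrite hu// mulr0.
  by rewrite /Rintegral integral0_eq.
have p00 : phi 0 = 0.
  apply/eqP; rewrite eq_le p0 andbT; apply: le_trans (h 0 (lexx 0)) _.
  by rewrite zero// => s s0 /(le_lt_trans s0); rewrite ltxx.
have S0 : S 0 by split => // s s0 s0'; rewrite (_ : s = 0)//; apply/eqP; rewrite eq_le s0'.
apply: contrapT => /existsNP[t] /not_implyP[t0 pt].
have Sub : ubound S t.
  move=> s [s0 hs]; rewrite leNgt; apply/negP => ts; apply: pt.
  by apply: hs => //; exact: ltW.
have hS : has_sup S by split; [exists 0|exists t].
set u := sup S.
have subd := @sup_upper_bound R S hS.
have u0 : 0 <= u by apply: subd.
have hu s : 0 <= s -> s < u -> phi s = 0.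
  move=> s0 su; have us0 : 0 < u - s by rewrite subr_gt0.
  have [v [v0 hv] sv] := sup_adherent us0 hS.
  by apply: hv => //; apply: ltW; move: sv; rewrite opprB addrC subrK.
have pu : phi u = 0.
  by apply/eqP; rewrite eq_le p0 andbT; apply: le_trans (h u u0) _; rewrite zero.
have cY := @Rint_continuous R y iy u.
have h2 : 0 < 2^-1 :> R by rewrite invr_gt0.
move/cvgrPdist_lt : cY => /(_ _ h2) /nbhs_ballP[d /= d0 hd].
pose v := u + d / 2.
have uv : u < v by rewrite ltrDl divr_gt0.
have Yv : \int[leb R]_(s in `]u, v]) y s <= 2^-1.
  rewrite -(@Rintegral_itvB _ y (BLeft 0) (BRight v) u) ?bnd_simp ?(ltW uv)//.
  apply: ltW; apply: le_lt_trans (hd v _); last first.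
    rewrite /ball/= /v opprD addrA subrr sub0r normrN ger0_norm ?divr_ge0 ?(ltW d0)//.
    by rewrite ltr_pdivrMr// ltr_pMr// ltr1n.
  by rewrite distrC; exact: ler_norm.
pose A := [set phi s | s in `]u, v]%classic].
have A0 : has_sup A.
  split; first by exists (phi v), v => //=; rewrite in_itv/= uv lexx.
  by exists B => _ [s _ <-].
set M := sup A.
have M0 : 0 <= M.
  by apply: le_trans (p0 v) _; apply: (@sup_upper_bound R A A0); exists v => //=; rewrite
    in_itv/= uv lexx.
have AM s : u < s -> s <= v -> phi s <= M.
  by move=> us sv; apply: (@sup_upper_bound R A A0); exists s => //=; rewrite in_itv/= us.
have iyv : (leb R).-integrable `]u, v] (EFin \o y).
  by apply: integrableS (iy v) => //; apply: subset_itvr; rewrite bnd_simp.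
have MM : M <= M / 2.
  apply: sup_le_ub; first exact: (proj1 A0).
  move=> x [s /=]; rewrite in_itv/= => /andP[us sv] <-.
  have s0 := le_trans u0 (ltW us).
  apply: le_trans (h _ s0) _.
  have <- : \int[leb R]_(r in `]u, s]) (y r * phi r) = \int[leb R]_(r in `[0, s]) (y r * phi r).
    rewrite -(@Rintegral_itvB _ (fun r => y r * phi r) (BLeft 0) (BRight s) u) ?bnd_simp ?(ltW
      us)//.
    by rewrite (zero u u0 hu) subr0.
  apply: (@le_trans _ _ (\int[leb R]_(r in `]u, v]) (M * y r))); last first.
    by rewrite RintegralZl//; rewrite ler_wpM2l.
  have iMy : (leb R).-integrable `]u, v] (EFin \o (fun r => M * y r)).
    exact: integrableRZ.
  apply: (@le_trans _ _ (\int[leb R]_(r in `]u, s]) (M * y r))).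
    apply: le_Rintegral => //.
    - by apply: integrableS (iyp s) => //; apply: subset_itvr; rewrite bnd_simp.
    - by apply: integrableS iMy => //; apply: subset_itvl; rewrite bnd_simp.
    move=> r; rewrite /= in_itv/= => /andP[ur rs]; rewrite mulrC ler_wpM2r// AM//.
    exact: le_trans sv.
  rewrite /Rintegral; apply: fine_le.
  - by apply: integrable_fin_num => //; apply: integrableS iMy => //; apply: subset_itvl; rewrite
    bnd_simp.
  - exact: integrable_fin_num.
  - apply: ge0_subset_integral => //.
    + exact: measurable_int iMy.
    + by move=> r _; rewrite lee_fin mulr_ge0.
    + by apply: subset_itvl; rewrite bnd_simp.
have M00 : M = 0.
  apply/eqP; rewrite eq_le M0 andbT; move: MM.
  by rewrite ler_pdivlMr// mulr_natr mulr2n gerDl.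
have Sv : S v.
  split; first by rewrite (le_trans u0)// ltW.
  move=> s s0 sv; case: (ltgtP s u) => [su|us|->//]; first exact: hu.
  by apply/eqP; rewrite eq_le p0 andbT -M00 AM.
have := subd _ Sv; by rewrite leNgt uv.
Qed.

End Gronwall.

(** * A priori bounds for mild solutions *)

Section MildProperties.
Context {R : realType}.
Local Open Scope ereal_scope.
Implicit Types (a b : nat -> R -> R[i]).
Variables (nu c : R).
Hypotheses (nu_gt0 : (0 < nu)%R) (c_gt0 : (0 < c)%R) (c_lt : (2 * c < 1)%R).
Variable al : nat -> R[i].

Let W4 := w4_ge0 nu_gt0.
Let W1 n : (0 <= w1 n :> R)%R := w1_ge0 n.
Let Lg := @lam_ge0 R nu nu_gt0.

(** The equation is imposed at negative times too, where it reduces to [e^{-lam t} al]; thus [a]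
    equals its Duhamel term as a function on the line. *)
Definition mild a := [/\ forall n, ccont (a n), forall n T, tintegrable T (NN nu c a a n) &
  forall n t, a n t = Sm nu al (NN nu c a a) n t].

Lemma mild_cmeas a n (D : set R) : measurable D -> mild a -> cmeas D (a n).
Proof. by move=> mD [ca _ _]; exact: ccont_cmeas. Qed.

Lemma mild_energy a t : mild a -> (0 <= t)%R ->
  EN nu a t <= wsum w1 al + \int[leb R]_(s in `[0%R, t]) wsum w1 (fun n => NN nu c a a n s).
Proof.
move=> [ca ia ea] t0; have := Sm_EN nu_gt0 al ia t0.
by rewrite (_ : Sm nu al _ = a)//; apply/funext => n; apply/funext => s.
Qed.

(** In the ball of radius 1/2 the forcing integral is at most [2 c (1/2) I <= I], where I is the
    dissipation integral on the left of the energy inequality; I is finite and cancels. *)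
Lemma mild_A1 a t : mild a -> EN_le nu a 2^-1 -> (0 <= t)%R ->
  wsum w1 (a^~ t) <= wsum w1 al.
Proof.
move=> ma aE t0; have ca n : cmeas setT (a n) by exact: mild_cmeas.
set I := \int[leb R]_(s in `[0%R, t]) wsum (w4 nu) (a^~ s).
have I0 : 0 <= I by apply: integral_ge0 => s _; exact: wsum_ge0.
have If : I \is a fin_num.
  by rewrite ge0_fin_numE//; exact: le_lt_trans (EN_le4 aE t0) (ltry _).
have h := mild_energy ma t0.
have hN : \int[leb R]_(s in `[0%R, t]) wsum w1 (fun n => NN nu c a a n s) <= I.
  have h2 : (0 <= 2^-1 :> R)%R by rewrite invr_ge0.
  have hI : I <= (fine I)%:E by rewrite fineK.
  have b1 s : (0 <= s)%R -> (s <= t)%R -> wsum w1 (a^~ s) <= (2^-1)%:E.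
    by move=> s0 _; exact: (EN_le1 nu_gt0 aE s0).
  apply: le_trans (NN_int nu_gt0 c_gt0 h2 ca ca b1 hI) _.
  rewrite -[leRHS]fineK// lee_fin (_ : 2 * c * (fine I * 2^-1) = c * fine I)%R; last by field.
  rewrite ler_piMl ?fine_ge0//.
  by have := c_gt0; have := c_lt; lra.
have h' := le_trans h (leeD2l (wsum w1 al) hN).
by move: h'; rewrite /EN -/I leeD2rE.
Qed.

(* exp (g t) a solves the same equation with lam - g in place of lam. *)
Lemma mild_A0_decay a t (A : R) : mild a -> EN_le nu a 2^-1 -> (0 <= t)%R ->
  wsum w1 al = A%:E -> (A <= 4^-1)%R ->
  wsum w0 (a^~ t) <= wsum w0 al * (expR (- ((1 - 4 * A) * (1 + nu) * t)))%:E.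
Proof.
move=> ma aE t0 alA A4; have ca n : cmeas setT (a n) by exact: mild_cmeas.
have A0 : (0 <= A)%R by rewrite -lee_fin -alA wsum_ge0.
have A4' : (4 * A <= 1)%R.
  by move: A4; rewrite -(ler_pM2l (_ : 0 < 4)%R)// mulfV.
set g := ((1 - 4 * A) * (1 + nu))%R.
(* Origin of the decay rate: [lam >= 1 + nu], and since [4 A >= 2 c A] the difference [lam - g]
   keeps the share [2 c A lam] that absorbs the nonlinearity. *)
have lamg n : (g <= (1 - 2 * c * A) * lam nu n)%R.
  apply: (@le_trans _ _ ((1 - 4 * A) * lam nu n)%R).
    by apply: ler_wpM2l; [rewrite subr_ge0|exact: lam_ge].
  apply: ler_wpM2r; first exact: Lg.
  rewrite lerD2l lerN2 ler_wpM2r//; have := c_lt; lra.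
have lg n : (0 <= lam nu n - g)%R.
  rewrite subr_ge0; apply: le_trans (lamg n) _; rewrite ler_piMl ?Lg// gerBl.
  by rewrite !mulr_ge0// ltW.
pose V n s : R[i] := (RC (expR (g * s)) * a n s)%R.
pose F n s : R[i] := (RC (expR (g * s)) * NN nu c a a n s)%R.
case: (ma) => cca ia ea.
have iF n T : tintegrable T (F n) by exact: tintegrable_expM.
have VE n s : V n s = duh (lam nu n - g) (al n) (F n) s.
  rewrite /V ea /Sm /duh mulrA -rmorphM/= -expRD; congr (RC (expR _) * (_ + _))%R.
    ring.
  apply: eq_cint => r _; rewrite /F mulrA -rmorphM/= -expRD; congr (RC (expR _) * _)%R.
  ring.
have VW w s : (forall n, 0 <= w n)%R -> wsum w (V^~ s) = (expR (g * s))%:E * wsum w (a^~ s).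
  move=> w_0; rewrite /wsum -nneseriesZl; last by move=> n _; rewrite lee_fin mulr_ge0 ?cnorm_ge0.
  apply: eq_eseriesr => n _; rewrite /V Normc.normcM cnormR ger0_norm ?expR_ge0//.
  by rewrite -EFinM mulrCA.
have w00 n : (0 <= w0 n :> R)%R := w0_ge0 n.
have := duh_wsum al w00 lg iF t0.
have -> : (fun n => duh (lam nu n - g) (al n) (F n) t) = V^~ t.
  by apply/funext => n; rewrite VE.
set I := (X in _ + X <= _); move=> h.
have I0 : 0 <= I by apply: integral_ge0 => s _; apply: wsum_ge0 => n; rewrite mulr_ge0.
have hF : \int[leb R]_(s in `[0%R, t]) wsum w0 (F^~ s) <= I.
  apply: ge0_le_integralW => s; first by move=> _; exact: wsum_ge0.
  rewrite /= in_itv/= => /andP[s0 st].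
  have -> : wsum w0 (F^~ s) = (expR (g * s))%:E * wsum w0 (fun n => NN nu c a a n s).
    rewrite /wsum -nneseriesZl; last by move=> n _; rewrite lee_fin mulr_ge0 ?cnorm_ge0.
    apply: eq_eseriesr => n _; rewrite /F Normc.normcM cnormR ger0_norm ?expR_ge0//.
    by rewrite -EFinM mulrCA.
  apply: (@le_trans _ _ ((expR (g * s))%:E * ((2 * c)%:E * (wsum (lam nu) (a^~ s) * A%:E)))).
    apply: lee_wpmul2l; first by rewrite lee_fin expR_ge0.
    have hN := @Nl_bound R nu c nu_gt0 c_gt0 w0 (lam nu) w1 (a^~ s) (a^~ s) w00 Lg W1
      (weight31 nu_gt0).
    apply: (le_trans hN); apply: lee_wpmul2l; first by rewrite lee_fin mulr_ge0// ltW.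
    by apply: lee_wpmul2l; [exact: wsum_ge0|rewrite -alA mild_A1].
  have -> : (expR (g * s))%:E * ((2 * c)%:E * (wsum (lam nu) (a^~ s) * A%:E)) =
      (2 * c * A)%:E * wsum (lam nu) (V^~ s).
    rewrite VW// [wsum _ _ * A%:E]muleC !muleA -!EFinM; congr (_%:E * _); ring.
  rewrite -nneseriesZl; last by move=> n _; rewrite lee_fin mulr_ge0 ?cnorm_ge0.
  apply: lee_nneseries => n *.
    by rewrite -EFinM lee_fin !mulr_ge0 ?cnorm_ge0// ltW.
  rewrite -EFinM lee_fin -VE mulrA ler_wpM2r ?cnorm_ge0// /w0 mul1r.
  by rewrite lerBrDl -lerBrDr; apply: le_trans (lamg n) _; rewrite mulrBl mul1r.
(* Finiteness of I allows its cancellation; the factor [e^{g s}] is bounded on [[0, t]] and the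
   dissipation of [a] is integrable. *)
have If : I \is a fin_num.
  rewrite ge0_fin_numE//.
  have e0 : 0 <= (expR (`|g| * t))%:E by rewrite lee_fin expR_ge0.
  apply: (@le_lt_trans _ _ (\int[leb R]_(s in `[0%R, t]) ((expR (`|g| * t))%:E * wsum (w4 nu)
    (a^~ s)))).
    apply: ge0_le_integralW => s; first by move=> _; apply: wsum_ge0 => n; rewrite mulr_ge0.
    rewrite /= in_itv/= => /andP[s0 st].
    apply: (@le_trans _ _ (wsum (w4 nu) (V^~ s))).
      apply: wsum_le => n; first by rewrite mulr_ge0.
      rewrite -VE ler_wpM2r ?cnorm_ge0// /w0 mul1r /w4.
      apply: (@le_trans _ _ (lam nu n)).
        by rewrite gerBl mulr_ge0 ?subr_ge0// addr_ge0// ltW.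
      by rewrite ler_peMl ?Lg// ler1n.
    by rewrite VW//; apply: lee_wpmul2r; [exact: wsum_ge0|rewrite lee_fin expR_bound].
  rewrite ge0_integralZl_EFin ?expR_ge0//; last 2 first.
  - by move=> s _; exact: wsum_ge0.
  - by apply: measurable_wsum => // n; apply: cmeasS (ca n).
  rewrite lte_mul_pinfty//; exact: le_lt_trans (EN_le4 aE t0) (ltry _).
have : wsum w0 (V^~ t) <= wsum w0 al.
  have h' := le_trans h (leeD2l (wsum w0 al) hF).
  by move: h'; rewrite leeD2rE.
rewrite VW// => h1.
have -> : wsum w0 (a^~ t) = (expR (- (g * t)))%:E * ((expR (g * t))%:E * wsum w0 (a^~ t)).
  by rewrite muleA -EFinM -expRD addNr expR0 mul1e.
by rewrite [leRHS]muleC; apply: lee_wpmul2l => //; rewrite lee_fin expR_ge0.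
Qed.

End MildProperties.

Lemma ccontN {R : realType} (F : R -> R[i]) : ccont F -> ccont (fun t => - F t).
Proof.
move=> cF; have := ccontM (ccont_cst (-1)) cF.
by under eq_fun do rewrite mulN1r.
Qed.

(** * Time modulus and uniqueness of mild solutions *)

Section MildUniqueness.
Context {R : realType}.
Local Open Scope ereal_scope.
Implicit Types (a b : nat -> R -> R[i]).

Lemma cint_itvB (F : R -> R[i]) (t t' : R) : (forall T, tintegrable T F) ->
  (0 <= t')%R -> (t' <= t)%R ->
  (tint t F - tint t' F = cint (leb R) `]t', t] F)%R.
Proof.
move=> iF t0 tt; have [i1 i2] := iF t; apply: complex_ext.
  rewrite cReD cReN/=.
  by rewrite (@Rintegral_itvB R (fun s => cRe (F s)) (BLeft 0%R) (BRight t) t') ?bnd_simp.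
rewrite cImD cImN/=.
by rewrite (@Rintegral_itvB R (fun s => cIm (F s)) (BLeft 0%R) (BRight t) t') ?bnd_simp.
Qed.

Variables (nu c : R).
Hypotheses (nu_gt0 : (0 < nu)%R) (c_gt0 : (0 < c)%R) (c_lt : (2 * c < 1)%R).
Variable al : nat -> R[i].

Let W4 := w4_ge0 nu_gt0.
Let W1 n : (0 <= w1 n :> R)%R := w1_ge0 n.
Let Lg := @lam_ge0 R nu nu_gt0.

Lemma NN_int_fin a (B : R) T : (forall n, cmeas setT (a n)) -> EN_le nu a B -> (0 <= B)%R ->
  \int[leb R]_(s in `[0%R, T]) wsum w1 (fun n => NN nu c a a n s) < +oo.
Proof.
move=> ma aE B0; case: (leP 0%R T) => [T0|T0]; last first.
  by rewrite set_itv_ge ?integral_set0// bnd_simp -ltNge.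
apply: le_lt_trans (ltry (2 * c * (B * B))%R); apply: NN_int => //; last exact: EN_le4.
by move=> s s0 _; exact: (EN_le1 nu_gt0 aE s0).
Qed.

Lemma psi_int_fin a (B : R) T : EN_le nu a B ->
  \int[leb R]_(s in `[0%R, T]) wsum (w4 nu) (a^~ s) < +oo.
Proof.
move=> aE; case: (leP 0%R T) => [T0|T0].
  exact: le_lt_trans (EN_le4 aE T0) (ltry _).
by rewrite set_itv_ge ?integral_set0// bnd_simp -ltNge.
Qed.

Lemma integrable_ge0 (D : set R) (f : R -> \bar R) : measurable_fun D f ->
  (forall s, 0 <= f s) -> \int[leb R]_(s in D) f s < +oo -> (leb R).-integrable D f.
Proof.
move=> mf f0 fin; apply/integrableP; split => //.
by under eq_integral do rewrite gee0_abs//.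
Qed.

(** An increment of [a] in time is the integral of [NN - lam a], so G can be the primitive of the
    dissipation plus the A^1 size of the forcing. This single modulus yields both strong
    measurability and weak continuity in time. *)
Lemma mild_modulus a (B : R) : mild nu c al a -> EN_le nu a B -> (0 <= B)%R ->
  exists G : R -> R, continuous G /\ forall t' t, (0 <= t')%R -> (t' <= t)%R ->
    wsum w1 (fun n => a n t - a n t')%R <= (G t - G t')%:E.
Proof.
move=> ma aE B0; have mea n : cmeas setT (a n) by exact: mild_cmeas ma.
case: (ma) => ca ia ea.
have mN n : cmeas setT (NN nu c a a n) by exact: NN_cmeas.
pose F s := wsum (w4 nu) (a^~ s) + wsum w1 (fun n => NN nu c a a n s).
have F0 s : 0 <= F s by rewrite adde_ge0 ?wsum_ge0.
have m1 (D : set R) : measurable D -> measurable_fun D (fun s => wsum (w4 nu) (a^~ s)).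
  by move=> mD; apply: measurable_wsum => // n; exact: cmeasS (mea n).
have m2 (D : set R) : measurable D -> measurable_fun D (fun s => wsum w1 (fun n => NN nu c a a n
  s)).
  by move=> mD; apply: measurable_wsum => // n; exact: cmeasS (mN n).
have mF (D : set R) : measurable D -> measurable_fun D F.
  by move=> mD; apply: emeasurable_funD; [exact: m1|exact: m2].
have iF T : (leb R).-integrable `[0%R, T] F.
  apply: integrable_ge0 => //; first exact: mF.
  rewrite ge0_integralD//.
  - by rewrite lte_add_pinfty//; [exact: psi_int_fin aE|exact: NN_int_fin aE _].
  - by move=> s _; exact: wsum_ge0.
  - exact: m1.
  - by move=> s _; exact: wsum_ge0.
  - exact: m2.
pose H s := fine (F s).
have iH T : (leb R).-integrable `[0%R, T] (EFin \o H).
  by have [] := @integrable_fine _ _ _ (leb R) _ _ (measurable_itv _) (iF T).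
exists (fun t => \int[leb R]_(s in `[0%R, t]) H s)%R; split; first exact: Rint_continuous.
move=> t' t t0 tt.
rewrite (@Rintegral_itvB R H (BLeft 0%R) (BRight t) t') ?bnd_simp//.
have iF' : (leb R).-integrable `]t', t] F.
  by apply: integrableS (iF t) => //; apply: subset_itvr; rewrite bnd_simp.
have [iH' eH] := @integrable_fine _ _ _ (leb R) _ _ (measurable_itv _) iF'.
rewrite /Rintegral fineK; last exact: integrable_fin_num.
rewrite eH.
pose K n s : R[i] := (NN nu c a a n s - RC (lam nu n) * a n s)%R.
have iK n T : tintegrable T (K n).
  apply: cintegrableB => //; first exact: ia.
  by apply: cintegrableZ => //; exact: ccont_tintegrable.
have aK n s : (0 <= s)%R -> (a n s = al n + tint s (K n))%R.
  move=> s0; have := duh_eq (lam nu n) (al n) (ia n) s0.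
  have -> : duh (lam nu n) (al n) (NN nu c a a n) = a n by apply/funext => r; rewrite ea.
  have -> : (tint s (K n) = tint s (NN nu c a a n) - RC (lam nu n) * tint s (a n))%R.
    rewrite /tint cintB//; last 2 first.
    - exact: ia.
    - by apply: cintegrableZ => //; exact: ccont_tintegrable.
    by rewrite cintZ//; exact: ccont_tintegrable.
  by move=> e; rewrite addrA -e addrK.
have sub : `]t', t]%classic `<=` `[0%R, t]%classic by apply: subset_itvr; rewrite bnd_simp.
have iK' n : cintegrable (leb R) `]t', t] (K n).
  by apply: cintegrableS (iK n t).
have aB n : (a n t - a n t' = cint (leb R) `]t', t] (K n))%R.
  rewrite -cint_itvB// !aK//; first by rewrite opprD addrACA subrr add0r.
  exact: le_trans tt.
apply: (@le_trans _ _ (\sum_(n <oo) (w1 n)%:E * \int[leb R]_(s in `]t', t]) (cnorm (K n s))%:E)).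
  apply: lee_nneseries => n *; first by rewrite lee_fin mulr_ge0 ?cnorm_ge0.
  rewrite EFinM aB; apply: lee_wpmul2l; first by rewrite lee_fin.
  exact: cint_norme.
have mK n (D : set R) : measurable D -> cmeas D (K n).
  move=> mD; apply: cmeasD; first exact: cmeasS (mN n).
  by apply: cmeasN; apply: cmeasM; [exact: cmeas_cst|exact: cmeasS (mea n)].
rewrite -integral_wsum//; last by move=> n; exact: mK.
apply: ge0_le_integralW => s _; first exact: wsum_ge0.
rewrite /F addeC; apply: le_trans (wsumB _ _ W1) _; apply: leeD => //.
apply: wsum_le => // n; rewrite Normc.normcM cnormR ger0_norm ?Lg// mulrA.
by rewrite /w4.
Qed.

Theorem mild_unique a b (B : R) : mild nu c al a -> mild nu c al b ->
  EN_le nu a 2^-1 -> EN_le nu b B -> forall n t, (0 <= t)%R -> b n t = a n t.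
Proof.
move=> ma mb aE bE.
have B0 : (0 <= B)%R.
  by rewrite -lee_fin; apply: le_trans (EN_le1 nu_gt0 bE (lexx 0%R)); exact: wsum_ge0.
have h2 : (0 <= 2^-1 :> R)%R by rewrite invr_ge0.
have mea n : cmeas setT (a n) by exact: mild_cmeas ma.
have meb n : cmeas setT (b n) by exact: mild_cmeas mb.
case: (ma) => ca ia ea; case: (mb) => cb ib eb.
pose w n s := (a n s - b n s)%R.
have cw n : ccont (w n).
  by apply: ccontD => //; exact: ccontN.
have mew n : cmeas setT (w n) by exact: ccont_cmeas.
have w_b s : (0 <= s)%R -> wsum w1 (w^~ s) <= (B + 2^-1)%:E.
  move=> s0; apply: le_trans (wsumB _ _ W1) _; rewrite addrC EFinD; apply: leeD.
    exact: (EN_le1 nu_gt0 bE s0).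
  exact: (EN_le1 nu_gt0 aE s0).
pose M n s := (NN nu c a a n s - NN nu c b b n s)%R.
have iM n T : tintegrable T (M n) by apply: cintegrableB => //; [exact: ia|exact: ib].
have wM n s : w n s = Sm nu (fun=> 0%R) M n s.
  by rewrite /w ea eb /Sm duhB// subrr.
have m4 x (D : set R) : (forall n, cmeas setT (x n)) -> measurable D ->
    measurable_fun D (fun s => wsum (w4 nu) (x^~ s)).
  by move=> mx mD; apply: measurable_wsum => // n; exact: cmeasS (mx n).
have m1 x (D : set R) : (forall n, cmeas setT (x n)) -> measurable D ->
    measurable_fun D (fun s => wsum w1 (x^~ s)).
  by move=> mx mD; apply: measurable_wsum => // n; exact: cmeasS (mx n).
have mM n : cmeas setT (M n) by apply: cmeasD; [exact: NN_cmeas|apply: cmeasN; exact: NN_cmeas].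
have FF := ae_filter_ringOfSetsType (leb R).
have aeb t := wsum_ae_fin W4 meb (psi_int_fin t bE).
have aea t := wsum_ae_fin W4 mea (psi_int_fin t aE).
have key t : (0 <= t)%R -> wsum w1 (w^~ t) <=
    \int[leb R]_(s in `[0%R, t]) (wsum (w4 nu) (b^~ s) * wsum w1 (w^~ s)).
  move=> t0; have := Sm_EN nu_gt0 (fun=> 0%R) iM t0.
  rewrite (_ : Sm nu _ _ = w); last by apply/funext => n; apply/funext => s; rewrite wM.
  rewrite [wsum w1 (fun=> 0%R)]/wsum eseries0 ?add0e; last first.
    by move=> n _ _; rewrite Normc.normc0 mulr0.
  rewrite /EN; set I := \int[leb R]_(s in _) wsum (w4 nu) _ => h.
  have I0 : 0 <= I by apply: integral_ge0 => s _; exact: wsum_ge0.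
  have If : I \is a fin_num.
    rewrite ge0_fin_numE//; apply: (@le_lt_trans _ _ (\int[leb R]_(s in `[0%R, t])
      (wsum (w4 nu) (a^~ s) + wsum (w4 nu) (b^~ s)))).
      by apply: ge0_le_integralW => s _; [exact: wsum_ge0|exact: wsumB].
    rewrite ge0_integralD//.
    - by rewrite lte_add_pinfty//; [exact: psi_int_fin aE|exact: psi_int_fin bE].
    - by move=> s _; exact: wsum_ge0.
    - exact: m4.
    - by move=> s _; exact: wsum_ge0.
    - exact: m4.
  (* The part [NN w a] costs at most I, as [2 c < 1] and [a] is below 1 in A^1; the part [NN b w] is
     left for Gronwall. I is finite and will cancel. *)
  have hM : \int[leb R]_(s in `[0%R, t]) wsum w1 (M^~ s) <=
      I + \int[leb R]_(s in `[0%R, t]) (wsum (w4 nu) (b^~ s) * wsum w1 (w^~ s)).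
    rewrite /I -ge0_integralD//; last 4 first.
    - by move=> s _; exact: wsum_ge0.
    - exact: m4.
    - by move=> s _; rewrite mule_ge0 ?wsum_ge0.
    - by apply: emeasurable_funM; [exact: m4|exact: m1].
    apply: ae_ge0_le_integral => //.
    - by move=> s _; exact: wsum_ge0.
    - exact: m1.
    - by move=> s _; rewrite adde_ge0 ?mule_ge0 ?wsum_ge0.
    - by apply: emeasurable_funD; [exact: m4|apply: emeasurable_funM; [exact: m4|exact: m1]].
    apply: filterS2 (aea t) (aeb t) => s ha hb st.
    have {ha} ha := ha st; have {hb} hb := hb st.
    move: st; rewrite /= in_itv/= => /andP[s0 st].
    have a1' := le_lt_trans (EN_le1 nu_gt0 aE s0) (ltry _).
    have b1' := le_lt_trans (EN_le1 nu_gt0 bE s0) (ltry _).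
    have -> : wsum w1 (M^~ s) = wsum w1 (fun n => NN nu c w a n s + NN nu c b w n s)%R.
      apply: eq_eseriesr => n _.
      have e := Nl_sub c nu_gt0 ha a1' hb b1' n.
      have e' : (M n s = NN nu c w a n s + NN nu c b w n s)%R by exact: e.
      by rewrite e'.
    apply: le_trans (wsumD _ _ W1) _; apply: leeD.
      have hN := @Nl_bound R nu c nu_gt0 c_gt0 w1 (w4 nu) w1 (w^~ s) (a^~ s) W1 W4 W1
        (weight41 nu_gt0).
      apply: (le_trans hN).
      apply: (@le_trans _ _ ((2 * c)%:E * (wsum (w4 nu) (w^~ s) * 1%:E))).
        apply: lee_wpmul2l; first by rewrite lee_fin mulr_ge0// ltW.
        apply: lee_wpmul2l; first exact: wsum_ge0.
        by apply: le_trans (EN_le1 nu_gt0 aE s0) _; rewrite lee_fin invf_le1// ler1n.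
      by rewrite mule1 gee_pMl ?lee_fin ?wsum_ge0 ?(ltW c_lt)// fin_num.
    have hN := @Nl_bound R nu c nu_gt0 c_gt0 w1 (w4 nu) w1 (b^~ s) (w^~ s) W1 W4 W1
      (weight41 nu_gt0).
    apply: (le_trans hN).
    by rewrite gee_pMl ?lee_fin ?mule_ge0 ?wsum_ge0 ?(ltW c_lt).
  have := le_trans h hM.
  by rewrite [leRHS]addeC leeD2rE.
(* [gronwall] asks for bounds at all real times, so the difference is frozen at its value at 0 for
   negative times. *)
pose m0 (s : R) := Num.max s 0%R.
have m0E s : (0 <= s)%R -> m0 s = s by move=> s0; rewrite /m0 max_l.
have m00 s : (0 <= m0 s)%R by rewrite /m0 le_max lexx orbT.
pose w' n s := w n (m0 s).
have cw' n : ccont (w' n).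
  have cm : continuous m0 by move=> s; apply: continuous_max; [exact: cvg_id|exact: cvg_cst].
  have [cR cI] := cw n; split => s.
    by apply: (@continuous_comp _ _ _ m0 (fun t => cRe (w n t))); [exact: cm|exact: cR].
  by apply: (@continuous_comp _ _ _ m0 (fun t => cIm (w n t))); [exact: cm|exact: cI].
pose phi s := fine (wsum w1 (w'^~ s)).
have fw s : wsum w1 (w'^~ s) \is a fin_num.
  by rewrite ge0_fin_numE ?wsum_ge0//; apply: le_lt_trans (w_b _ (m00 s)) (ltry _).
pose y s := fine (wsum (w4 nu) (b^~ s)).
have iy T : (leb R).-integrable `[0%R, T] (EFin \o y).
  have i : (leb R).-integrable `[0%R, T] (fun s => wsum (w4 nu) (b^~ s)).
    by apply: integrable_ge0; [exact: m4|move=> s; exact: wsum_ge0|exact: psi_int_fin bE].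
  by have [] := @integrable_fine _ _ _ (leb R) _ _ (measurable_itv _) i.
have mphi : measurable_fun setT phi.
  apply: (measurableT_comp (f := fine)) => //; apply: m1 => // n; exact: ccont_cmeas.
have phi0 s : (0 <= phi s)%R by rewrite fine_ge0// wsum_ge0.
have phiB s : (phi s <= B + 2^-1)%R.
  by rewrite -lee_fin fineK//; exact: w_b.
have := @gronwall R phi y (B + 2^-1)%R.
have G1 t : (0 <= phi t <= B + 2^-1)%R by rewrite phi0 phiB.
have y0 t : (0 <= y t)%R by rewrite fine_ge0// wsum_ge0.
move=> /(_ G1 mphi y0 iy) G.
have h t : (0 <= t)%R -> (phi t <= \int[leb R]_(s in `[0%R, t]) (y s * phi s))%R.
  move=> t0; rewrite -lee_fin fineK//.
  have -> : w'^~ t = w^~ t by apply/funext => n; rewrite /w' m0E.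
  apply: le_trans (key _ t0) _.
  rewrite (@ae_eq_integralW _ _ _ (leb R) _ _ (fun s => (y s * phi s)%:E))//; last first.
    apply: filterS (aeb t) => s hb st; have {hb} hb := hb st.
    move: st; rewrite /= in_itv/= => /andP[s0 _].
    rewrite EFinM !fineK//; last by rewrite ge0_fin_numE// wsum_ge0.
    by congr (_ * wsum _ _); apply/funext => n; rewrite /w' m0E.
  rewrite /Rintegral fineK//.
  have iyp : (leb R).-integrable `[0%R, t] (EFin \o (fun s => y s * phi s)%R).
    apply: (@le_integrable _ _ _ (leb R) _ _ _ (EFin \o (fun s => (B + 2^-1) * y s)%R)) => //.
    - apply/measurable_EFinP; apply: measurable_funM; last exact: measurable_funTS.
      by apply/measurable_EFinP; exact: measurable_int (iy t).
    - move=> s _ /=; rewrite lee_fin ger0_norm ?mulr_ge0// ger0_norm; last first.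
        by rewrite mulr_ge0// (le_trans (phi0 0%R)).
      by rewrite mulrC ler_wpM2r.
    - by apply: integrableRZ.
  exact: integrable_fin_num.
move=> n t t0; have := G h t t0 => pt.
have : wsum w1 (w'^~ t) = 0 by rewrite -(fineK (fw t)) -/(phi t) pt.
move=> wt; have := wsum_term (w'^~ t) n W1; rewrite wt lee_fin => hn.
have : (cnorm (w' n t) <= 0)%R.
  by move: hn; rewrite pmulr_rle0// /w1.
rewrite /w' m0E// => hw; have : (cnorm (w n t) = 0)%R by apply/eqP; rewrite eq_le hw cnorm_ge0.
by move=> /Normc.eq0_normc /eqP; rewrite subr_eq0 eq_sym => /eqP.
Qed.

End MildUniqueness.

(** * Fourier series on the circle *)

Section Characters.
Context {R : realType}.
Implicit Types (x y k : R) (n : int).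

Lemma cisD x y : cis (x + y) = cis x * cis y :> R[i].
Proof.
by apply: complex_ext; rewrite ?(cReM, cImM)/= ?cosD ?sinD// addrC [cos x * _]mulrC mulrC.
Qed.

Lemma cisN x : cis (- x) = conjc (cis x) :> R[i].
Proof. by rewrite /cis cosN sinN. Qed.

Lemma cis0 : cis 0 = 1 :> R[i].
Proof. by rewrite /cis cos0 sin0. Qed.

Lemma conjcM (z w : R[i]) : conjc (z * w) = conjc z * conjc w.
Proof. by case: z w => a b [a' b']; apply: complex_ext => /=; ring. Qed.

Lemma conjcR x : conjc (RC x) = RC x.
Proof. by apply: complex_ext; rewrite //= oppr0. Qed.

Lemma continuous_linear k : continuous (fun x : R => k * x).
Proof. by move=> x; apply: cvgM; [exact: cvg_cst|exact: cvg_id]. Qed.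

Lemma cis_ccont k : ccont (fun x => cis (k * x)).
Proof.
split => x.
  by apply: (@continuous_comp _ _ _ (fun x => k * x) cos);
    [exact: continuous_linear|exact: continuous_cos].
by apply: (@continuous_comp _ _ _ (fun x => k * x) sin);
  [exact: continuous_linear|exact: continuous_sin].
Qed.

Lemma cis_cmeas k (D : set R) : measurable D -> cmeas D (fun x => cis (k * x)).
Proof. by move=> mD; apply: ccont_cmeas => //; exact: cis_ccont. Qed.

Lemma pi2_gt0 : 0 < 2 * pi :> R. Proof. by rewrite mulr_gt0// pi_gt0. Qed.

Lemma sin_pi2_int n : sin (n%:~R * (2 * pi)) = 0 :> R.
Proof.
have sn (m : nat) : sin (m%:R * (2 * pi)) = 0 :> R.
  have := periodicn (@sinD2pi R) m 0; rewrite add0r sin0 => h.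
  by rewrite -[RHS]h -[in RHS]mulr_natl -[in RHS](mulr_natl pi 2).
case: (intP n) => [|m|m]; first by rewrite mul0r sin0.
  exact: sn.
by rewrite mulrNz mulNr sinN sn oppr0.
Qed.

Lemma cos_pi2_int n : cos (n%:~R * (2 * pi)) = 1 :> R.
Proof.
have cn (m : nat) : cos (m%:R * (2 * pi)) = 1 :> R.
  have := periodicn (@cosD2pi R) m 0; rewrite add0r cos0 => h.
  by rewrite -[RHS]h -[in RHS]mulr_natl -[in RHS](mulr_natl pi 2).
case: (intP n) => [|m|m]; first by rewrite mul0r cos0.
  exact: cn.
by rewrite mulrNz mulNr cosN cn.
Qed.

Lemma cis_pi2_int n : cis (n%:~R * (2 * pi)) = 1 :> R[i].
Proof. by rewrite /cis sin_pi2_int cos_pi2_int. Qed.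

(** With the factor [i k] on the left the case [k = 0] is included. *)
Lemma cint_cis k (s t : R) : s <= t ->
  Complex 0 k * cint (leb R) `[s, t] (fun x => cis (k * x)) = cis (k * t) - cis (k * s).
Proof.
rewrite le_eqVlt => /predU1P[->|st].
  by rewrite subrr set_itv1 /cint !Rintegral_set1 mulr0.
have dsin x : is_derive x 1 (fun x : R => sin (k * x)) (k * cos (k * x)).
  by apply: is_derive_eq; rewrite /GRing.scale/= mulr1 mulrC.
have dcos x : is_derive x 1 (fun x : R => cos (k * x)) (- (k * sin (k * x))).
  by apply: is_derive_eq; rewrite /GRing.scale/= mulr1 mulrC mulrN.
have [cc cs] := cis_ccont k.
have [ic is'] : cintegrable (leb R) `[s, t] (fun x => cis (k * x)).
  by split; apply: continuous_compact_integrable;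
    try exact: segment_compact; exact: continuous_subspaceT.
apply: complex_ext.
- rewrite cReM cReD cReN/= mul0r sub0r -RintegralZl//.
  rewrite -[LHS]mulN1r -RintegralZl//; last exact: integrableRZ.
  rewrite /Rintegral (@continuous_FTC2 _ _ (fun x => cos (k * x)))//=.
  + apply: continuous_subspaceT => x; apply: cvgM; first exact: cvg_cst.
    by apply: cvgM; [exact: cvg_cst|exact: cs].
  + by split => //; [apply: cvg_at_right_filter; exact: cc|apply: cvg_at_left_filter; exact: cc].
  + by move=> x _; rewrite derive1E; have /@derive_val -> := dcos x; rewrite mulN1r.
- rewrite cImM cImD cImN/= mul0r add0r -RintegralZl//.
  rewrite /Rintegral (@continuous_FTC2 _ _ (fun x => sin (k * x)))//=.
  + by apply: continuous_subspaceT => x; apply: cvgM; [exact: cvg_cst|exact: cc].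
  + by split => //; [apply: cvg_at_right_filter; exact: cs|apply: cvg_at_left_filter; exact: cs].
  + by move=> x _; rewrite derive1E; have /@derive_val -> := dsin x.
Qed.

Lemma measurable_circle : measurable (circle R).
Proof. exact: measurable_itv. Qed.

Lemma leb_itvcc (a b : R) : a <= b -> leb R `[a, b]%classic = (b - a)%:E.
Proof.
rewrite le_eqVlt => /predU1P[->|ab]; rewrite lebesgue_measure_itv/= lte_fin ?ltxx ?subrr//.
by rewrite ab.
Qed.

Lemma leb_circle : leb R (circle R) = (2 * pi)%:E.
Proof.
by have := leb_itvcc (ltW pi2_gt0); rewrite subr0.
Qed.

Lemma cis_circle_integrable k : cintegrable (leb R) (circle R) (fun x => cis (k * x)).
Proof.
have [cc cs] := cis_ccont k.
by split; apply: continuous_compact_integrable;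
  try exact: segment_compact; exact: continuous_subspaceT.
Qed.

Lemma cint_circle_cis n :
  cint (leb R) (circle R) (fun x => cis (n%:~R * x)) = if n == 0 then RC (2 * pi) else 0.
Proof.
case: eqVneq => [->|n0].
  rewrite (@eq_cint _ _ _ (leb R) _ _ (fun=> RC 1)); last first.
    by move=> x _; rewrite mul0r cis0.
  rewrite cintR Rintegral_cst; last exact: measurable_circle.
  rewrite mul1r; congr (RC _); exact: (congr1 fine leb_circle).
have := cint_cis n%:~R (ltW pi2_gt0); rewrite cis_pi2_int mulr0 cis0 subrr => /eqP.
rewrite mulf_eq0 => /orP[|/eqP//]; rewrite eq_complex/= eqxx/= intr_eq0.
by rewrite (negbTE n0).
Qed.

Definition cth : R := (Num.sqrt (2 * pi))^-1.

Lemma cth_gt0 : 0 < cth.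
Proof. by rewrite invr_gt0 sqrtr_gt0 pi2_gt0. Qed.

Lemma cth_sqr : cth ^+ 2 * (2 * pi) = 1.
Proof.
rewrite exprVn sqr_sqrtr ?(ltW pi2_gt0)// mulVf//.
exact: lt0r_neq0 pi2_gt0.
Qed.

(** As [(2 c)^2 * 2 pi = 4], the claim is [pi > 2]; equality is excluded because [cos 1 > 0] while
    [cos (pi / 2) = 0]. *)
Lemma cth_lt : 2 * cth < 1.
Proof.
have pi2 : 2 < pi :> R.
  rewrite lt_neqAle pi_ge2 andbT; apply/eqP => pi2.
  have := @cos1_gt0 R; rewrite (_ : 1 = pi / 2 :> R) ?cos_pihalf ?ltxx//.
  by rewrite -pi2 divff.
have h : (2 * cth) ^+ 2 < 1 ^+ 2.
  have e : (2 * cth) ^+ 2 * (2 * pi) = 4 by rewrite exprMn -mulrA cth_sqr; ring.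
  by rewrite expr1n -(ltr_pM2r pi2_gt0) e mul1r (_ : 4 = 2 * 2 :> R) ?ltr_pM2l//; ring.
by move: h; rewrite ltr_pXn2r// ?nnegrE ?mulr_ge0// ltW// cth_gt0.
Qed.

End Characters.

Section FourierCoefficients.
Context {R : realType}.
Implicit Types (u v : R -> R) (n : int).

Definition cintble u := (leb R).-integrable (circle R) (EFin \o u).

Lemma cintbleD u v : cintble u -> cintble v -> cintble (fun x => u x + v x).
Proof. move=> iu iv; rewrite /cintble (_ : EFin \o _ = ((EFin \o u) \+ (EFin \o v))%E)//.
by apply: integrableD => //; exact: measurable_circle. Qed.

Lemma cintbleZ k u : cintble u -> cintble (fun x => k * u x).
Proof. by apply: integrableRZ; exact: measurable_circle. Qed.

Lemma cintbleB u v : cintble u -> cintble v -> cintble (fun x => u x - v x).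
Proof. move=> iu iv; rewrite /cintble (_ : EFin \o _ = ((EFin \o u) \- (EFin \o v))%E)//.
by apply: integrableB => //; exact: measurable_circle. Qed.

Lemma cintble_continuous u : continuous u -> cintble u.
Proof.
by move=> cu; apply: continuous_compact_integrable;
  [exact: segment_compact|exact: continuous_subspaceT].
Qed.

Lemma cintble_cst k : cintble (fun=> k).
Proof. by apply: cintble_continuous => x; exact: cvg_cst. Qed.

Lemma fourierE u n : fourier u n =
  RC cth * cint (leb R) (circle R) (fun x => RC (u x) * cis (- (n%:~R * x))).
Proof. by []. Qed.

Lemma RCcis_integrable u k : cintble u ->
  cintegrable (leb R) (circle R) (fun x => RC (u x) * cis (k * x)).
Proof.
move=> iu; have -> : (fun x => RC (u x) * cis (k * x)) = (fun x => cis (k * x) * RC (u x)).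
  by apply/funext => x; rewrite mulrC.
apply: (@cintegrableM_bounded _ _ _ _ _ _ _ 1); first exact: measurable_circle.
- exact: cis_cmeas measurable_circle.
- by move=> x _; rewrite cnorm_cis.
- by apply: cintegrableR => //; exact: measurable_circle.
Qed.

Lemma RCcisN_integrable u k : cintble u ->
  cintegrable (leb R) (circle R) (fun x => RC (u x) * cis (- (k * x))).
Proof.
move=> iu; have := RCcis_integrable (- k) iu.
by under eq_fun do rewrite mulNr.
Qed.

Lemma fourierN u n : cintble u -> fourier u (- n) = conjc (fourier u n).
Proof.
move=> iu; rewrite !fourierE conjcM conjcR; congr (_ * _).
rewrite -cintJ; [|exact: measurable_circle|exact: RCcisN_integrable].
by apply: eq_cint => x _; rewrite conjcM conjcR -cisN rmorphN/= mulNr.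
Qed.

Lemma fourierD u v n : cintble u -> cintble v ->
  fourier (fun x => u x + v x) n = fourier u n + fourier v n.
Proof.
move=> iu iv; rewrite !fourierE -mulrDr; congr (_ * _).
rewrite -cintD; [|exact: measurable_circle|exact: RCcisN_integrable..].
by apply: eq_cint => x _; rewrite -mulrDl -rmorphD.
Qed.

Lemma fourierZ k u n : cintble u -> fourier (fun x => k * u x) n = RC k * fourier u n.
Proof.
move=> iu; rewrite !fourierE mulrCA; congr (_ * _).
rewrite -cintZ; [|exact: measurable_circle|exact: RCcisN_integrable].
by apply: eq_cint => x _; rewrite rmorphM/= mulrA.
Qed.

Lemma fourierB u v n : cintble u -> cintble v ->
  fourier (fun x => u x - v x) n = fourier u n - fourier v n.
Proof.
move=> iu iv; rewrite (_ : (fun x => _) = fun x => u x + (-1) * v x); last first.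
  by apply/funext => x; rewrite mulN1r.
rewrite fourierD//; last by apply: integrableRZ => //; exact: measurable_circle.
by rewrite fourierZ// rmorphN/= mulN1r.
Qed.

Lemma fourier_cos u n : cintble u ->
  \int[leb R]_(x in circle R) (u x * cos (n%:~R * x)) = cth^-1 * cRe (fourier u n).
Proof.
move=> iu; rewrite fourierE cReMR mulKf ?lt0r_neq0 ?cth_gt0//.
by apply: eq_Rintegral => x _; rewrite cReM/= mul0r subr0 cosN.
Qed.

Lemma fourier_sin u n : cintble u ->
  \int[leb R]_(x in circle R) (u x * sin (n%:~R * x)) = - (cth^-1 * cIm (fourier u n)).
Proof.
move=> iu; rewrite fourierE.
have -> (x : R) (z : R[i]) : cIm (RC x * z) = x * cIm z by case: z => a b /=; rewrite mul0r addr0.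
rewrite mulKf ?lt0r_neq0 ?cth_gt0//.
have i := RCcisN_integrable n%:~R iu.
rewrite -mulN1r -RintegralZl; [|exact: measurable_circle|by case: i].
by apply: eq_Rintegral => x _; rewrite cImM/= mul0r addr0 sinN; ring.
Qed.

Lemma fourier_mean u : fourier u 0 = RC (cth * \int[leb R]_(x in circle R) u x).
Proof.
rewrite fourierE (@eq_cint _ _ _ (leb R) _ _ (fun x => RC (u x))); last first.
  by move=> x _; rewrite mul0r oppr0 cis0 mulr1.
by rewrite cintR -rmorphM.
Qed.

End FourierCoefficients.

(** * Injectivity of the Fourier coefficients *)

Section Injectivity.
Context {R : realType}.
Implicit Types (u : R -> R) (n : int).

Let mC := @measurable_circle R.

Lemma cos_norm (x : R) : cos `|x| = cos x.
Proof. by have [x0|x0] := ger0P x; rewrite ?(ger0_norm x0)// ?(ltr0_norm x0) ?cosN. Qed.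

Lemma cos_lt (x y : R) : 0 <= x -> x < y -> y <= pi -> cos y < cos x.
Proof.
move=> x0 xy yp; rewrite ltr_cos// in_itv/= ?x0 ?yp ?andbT /=.
  exact: (le_trans (ltW xy) yp).
exact: (le_trans x0 (ltW xy)).
Qed.

Lemma cos_le (x y : R) : 0 <= x -> x <= y -> y <= pi -> cos y <= cos x.
Proof. by move=> x0; rewrite le_eqVlt => /predU1P[->//|xy] yp; apply/ltW/cos_lt. Qed.

(* q >= rho > 1 near x0 and |q| <= 1 away from x0: the powers of this
   trigonometric polynomial detect the sign of V x0. *)
Lemma continuous_fourier_nonpos (V : R -> R) (x0 : R) : continuous V ->
  (forall n, cint (leb R) (circle R) (fun x => RC (V x) * cis (n%:~R * x)) = 0) ->
  0 < x0 < 2 * pi -> V x0 <= 0.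
Proof.
move=> cV hV /andP[x00 x0p]; rewrite leNgt; apply/negP => Vx0.
have Vh : 0 < V x0 / 2 by rewrite divr_gt0.
have /cvgrPdist_lt/(_ _ Vh) /nbhs_ballP[d1 /= d10 hd1] := cV x0.
(* The window around x0 must stay inside the circle and inside the zone where [V > V x0 / 2]; its
   size is at most pi, where the cosine is monotone. *)
pose d := Num.min (d1 / 2) (Num.min x0 (Num.min (2 * pi - x0) pi)) .
have d0 : 0 < d by rewrite !lt_min divr_gt0// x00 subr_gt0 x0p pi_gt0.
have dd1 : d < d1.
  by rewrite /d gt_min; apply/orP; left; rewrite ltr_pdivrMr// ltr_pMr// ltr1n.
have dx0 : d <= x0 by rewrite /d !ge_min lexx !orbT.
have dx1 : d <= 2 * pi - x0 by rewrite /d !ge_min lexx !orbT.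
have dpi : d <= pi by rewrite /d !ge_min lexx !orbT.
pose q (y : R) := 1 + cos (y - x0) - cos d.
have cq : continuous q.
  move=> y; apply: cvgB; last exact: cvg_cst.
  apply: cvgD; first exact: cvg_cst.
  apply: (@continuous_comp _ _ _ (fun y => y - x0) cos); last exact: continuous_cos.
  by apply: cvgB; [exact: cvg_id|exact: cvg_cst].
have cqk k : continuous (fun y => q y ^+ k).
  elim: k => [|k ih]; first by move=> y; under eq_fun do rewrite expr0; exact: cvg_cst.
  have -> : (fun y => q y ^+ k.+1) = fun y => q y * q y ^+ k by apply/funext => y; rewrite exprS.
  by move=> y; apply: cvgM; [exact: cq|exact: ih].
have cVq k : continuous (fun y => V y * q y ^+ k).
  by move=> y; apply: cvgM; [exact: cV|exact: cqk].
have zero k : forall n, cint (leb R) (circle R) (fun x => RC (V x * q x ^+ k) * cis (n%:~R * x))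
  = 0.
  elim: k => [|k ih] n.
    by rewrite -(hV n); apply: eq_cint => x _; rewrite expr0 mulr1.
  (* q is a trigonometric polynomial of degree one: multiplication by q shifts frequencies by -1, 0
     and 1, so orthogonality to all characters is inherited. *)
  pose al := RC (1 - cos d); pose be := RC (2^-1) * cis (- x0); pose ga := RC (2^-1) * cis x0.
  have qE x : RC (q x) * cis (n%:~R * x) = al * cis (n%:~R * x) +
      (be * cis ((n + 1)%:~R * x) + ga * cis ((n - 1)%:~R * x)).
    have -> : (n + 1)%:~R * x = n%:~R * x + x by rewrite rmorphD/= mulrDl mul1r.
    have -> : (n - 1)%:~R * x = n%:~R * x + - x by rewrite rmorphB/= mulrBl mul1r.
    rewrite /be /ga /al !cisD [_ * (_ * cis x)]mulrCA -mulrA.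
    have -> : RC (q x) = RC (1 - cos d) + RC (2^-1) * (cis (- x0) * cis x + cis x0 * cis (- x)).
      rewrite -!cisD addrC.
      apply: complex_ext; rewrite ?(cReD, cImD, cReM, cImM)/= !(mul0r, subr0, addr0, add0r).
        by rewrite /q -[x0 - x]opprB cosN [- x0 + x]addrC; field.
      by rewrite -[x0 - x]opprB sinN [- x0 + x]addrC subrr mulr0.
    ring.
  have Ii m : cintegrable (leb R) (circle R) (fun x => RC (V x * q x ^+ k) * cis (m%:~R * x)).
    by apply: RCcis_integrable; exact: cintble_continuous.
  have -> : cint (leb R) (circle R) (fun x => RC (V x * q x ^+ k.+1) * cis (n%:~R * x)) =
      cint (leb R) (circle R) (fun x => al * (RC (V x * q x ^+ k) * cis (n%:~R * x)) +
        (be * (RC (V x * q x ^+ k) * cis ((n + 1)%:~R * x)) +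
         ga * (RC (V x * q x ^+ k) * cis ((n - 1)%:~R * x)))).
    apply: eq_cint => x _; rewrite exprS mulrCA rmorphM/= [RC (q x) * _]mulrC -mulrA qE.
    ring.
  rewrite cintD ?cintD ?cintZ//; try (exact: cintegrableZ).
    by rewrite !ih !mulr0 !addr0.
  by apply: cintegrableD => //; exact: cintegrableZ.
have zeroR k : \int[leb R]_(x in circle R) (V x * q x ^+ k) = 0.
  transitivity (cRe (cint (leb R) (circle R) (fun x => RC (V x * q x ^+ k) * cis (0%:~R * x))));
    last first.
    by rewrite zero.
  by apply: eq_Rintegral => x _; rewrite mul0r cis0 mulr1.
have [B hB] : exists B, forall y, circle R y -> `|V y| <= B.
  have cpt : compact (circle R) by exact: segment_compact.
  have /(continuous_compact (continuous_subspaceT cV)) /compact_bounded [B [_ hB]] := cpt.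
  exists (B + 1) => y yc; apply: (hB (B + 1)); first by rewrite ltrDl.
  by exists y.
have q_out y : circle R y -> d <= `|y - x0| -> `|q y| <= 1.
  rewrite /circle/= in_itv/= => /andP[y0 yp] dy.
  have yd : `|y - x0| <= 2 * pi - d.
    rewrite ler_norml; apply/andP; split; last first.
      by rewrite lerBlDr; apply: (le_trans yp); rewrite -lerBlDl opprB addrC subrK.
    by rewrite lerNl opprB; rewrite lerBlDr; lra.
  have hc : cos (y - x0) <= cos d.
    rewrite -cos_norm; have [ypi|ypi] := leP `|y - x0| pi.
      by apply: cos_le => //; exact: ltW.
    have -> : cos `|y - x0| = cos (2 * pi - `|y - x0|).
      by rewrite -[in RHS]cosN opprB mulr_natl -[RHS]cosD2pi subrK.
    by apply: cos_le; lra.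
  rewrite ler_norml /q; have := cos_geN1 (y - x0); have := cos_le1 d.
  by move=> *; apply/andP; split; lra.
pose rho := q (x0 + d / 2).
have d2 : 0 < d / 2 by rewrite divr_gt0.
have rhoE : rho = 1 + cos (d / 2) - cos d by rewrite /rho /q [x0 + _]addrC addrK.
have rho1 : 1 < rho.
  have : cos d < cos (d / 2) by apply: cos_lt => //; lra.
  by rewrite rhoE; lra.
have q_in y : `|y - x0| <= d / 2 -> rho <= q y.
  move=> yd; have : cos (d / 2) <= cos (y - x0).
    by rewrite -(cos_norm (y - x0)); apply: cos_le => //; lra.
  by rewrite rhoE /q; lra.
have q_mid y : `|y - x0| <= d -> 0 <= q y.
  move=> yd; have : cos d <= cos (y - x0).
    by rewrite -(cos_norm (y - x0)); apply: cos_le.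
  by rewrite /q; lra.
have V_in y : `|y - x0| < d1 -> V x0 / 2 < V y.
  move=> yd; have := hd1 y; rewrite /ball/= distrC => /(_ yd).
  by move=> /(le_lt_trans (ler_norm _)); lra.
have B0 : 0 <= B by apply: le_trans (hB x0 _); rewrite ?normr_ge0// /circle/= in_itv/= !ltW.
pose J := `[x0 - d / 2, x0 + d / 2]%classic : set R.
have mJ : measurable J by exact: measurable_itv.
have iJ : cintble (\1_J : R -> R).
  apply: (@integrableS _ _ R (leb R) setT) => //.
  exact: (@integrable_indic_itv R (x0 - d / 2) (x0 + d / 2) true false).
(* The integral of [V q^k] is 0, yet the integrand is at least [-B] on the circle, improved by
   [V x0 / 2 * rho^k] on the window J of length d. A large k is then contradictory. *)
have low k : - B * (2 * pi) + V x0 / 2 * rho ^+ k * d <= 0.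
  rewrite -(zeroR k).
  have -> : - B * (2 * pi) + V x0 / 2 * rho ^+ k * d =
     \int[leb R]_(y in circle R) (- B + V x0 / 2 * rho ^+ k * \1_J y).
    rewrite RintegralD//; last 2 first.
    - by apply: cintble_continuous => y; exact: cvg_cst.
    - by apply: integrableRZ => //; exact: iJ.
    rewrite Rintegral_cst// RintegralZl//.
    congr (_ * _ + _ * _).
      exact: esym (congr1 fine leb_circle).
    rewrite /Rintegral integral_indic// (_ : J `&` _ = J)/=.
      have JE : leb R J = (x0 + d / 2 - (x0 - d / 2))%:E by apply: leb_itvcc; lra.
      apply: etrans (esym (congr1 fine JE)); rewrite /=; lra.
    apply/seteqP; split => [y []//|y Jy]; split => //; move: Jy.
    by rewrite /J /circle/= !in_itv/= => /andP[? ?]; apply/andP; split; lra.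
  apply: le_Rintegral => //.
  - by apply: cintbleD; [exact: cintble_cst|exact: cintbleZ].
  - exact: cintble_continuous.
  move=> y yc; rewrite indicE.
  have rk : 0 <= rho ^+ k by rewrite exprn_ge0// ltW// (lt_trans ltr01).
  have Bq : - B <= V y * q y ^+ k.
    have [yd|yd] := leP d `|y - x0|.
      have : `|V y * q y ^+ k| <= B * 1.
        by rewrite normrM normrX ler_pM ?exprn_ge0// ?hB// exprn_ile1// q_out.
      by rewrite mulr1 ler_norml => /andP[].
    apply: (@le_trans _ _ 0); first by rewrite oppr_le0.
    by rewrite mulr_ge0 ?exprn_ge0 ?q_mid// ltW// (lt_trans Vh)// V_in// (lt_trans yd).
  case: (boolP (y \in J)) => [yJ|_] /=; last by rewrite mulr0 addr0.
  have yd : `|y - x0| <= d / 2.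
    move: yJ; rewrite inE /J/= in_itv/= => /andP[? ?].
    by rewrite ler_norml; apply/andP; split; lra.
  rewrite mulr1; apply: (@le_trans _ _ (V x0 / 2 * rho ^+ k)); first by rewrite gerDr oppr_le0.
  apply: ler_pM => //; first exact: ltW.
    by apply: ltW; apply: V_in; apply: le_lt_trans yd _; lra.
  apply: lerXn2r; rewrite ?nnegrE ?(ltW (lt_trans ltr01 rho1))//; last exact: q_in.
  by rewrite q_mid//; lra.
have [k hk] : exists k : nat, B * (2 * pi) / (V x0 / 2 * d) < rho ^+ k.
  have bern k : 1 + k%:R * (rho - 1) <= rho ^+ k.
    elim: k => [|k ih]; first by rewrite mul0r addr0 expr0.
    have k0 : 0 <= k%:R * (rho - 1) ^+ 2 by rewrite mulr_ge0 ?sqr_ge0.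
    rewrite exprS; apply: le_trans (ler_wpM2l (ltW (lt_trans ltr01 rho1)) ih).
    by rewrite -natr1; move: k0; rewrite expr2; lra.
  have r0 : 0 < rho - 1 by rewrite subr_gt0.
  set K := B * _ / _.
  exists (Num.truncn (`|K| / (rho - 1))).+1; apply: lt_le_trans (bern _).
  apply: (le_lt_trans (ler_norm K)).
  have := truncnS_gt (`|K| / (rho - 1)); rewrite ltr_pdivrMr// => h.
  by apply: (lt_trans h); rewrite ltrDr.
have := low k; rewrite mulNr addrC subr_le0 leNgt => /negP; apply.
have VXd : 0 < V x0 / 2 * d by rewrite mulr_gt0.
move: hk; rewrite (ltr_pdivrMr _ _ VXd).
by have -> : rho ^+ k * (V x0 / 2 * d) = V x0 / 2 * rho ^+ k * d by ring.
Qed.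


(** Reduction to continuous functions: the primitive F is continuous and, after an exchange of
    integrals, its coefficients vanish at [n <> 0]. So [F - m], with m the mean of F, is orthogonal
    to all characters; the continuous case applied to it and to its opposite makes F constant inside
    the circle, and differentiating almost everywhere returns [u = 0]. *)
Lemma fourier_injective0 u : cintble u -> (forall n, fourier u n = 0) ->
  {ae leb R, forall x, circle R x -> u x = 0}.
Proof.
move=> iu u0; have FF := ae_filter_ringOfSetsType (leb R).
pose f := u \_ (circle R).
have fE x : circle R x -> f x = u x by move=> xc; rewrite /f patchE mem_set.
have fi D : measurable D -> (leb R).-integrable D (EFin \o f).
  move=> mD; apply: (@integrableS _ _ R (leb R) setT) => //.
  by rewrite /f; rewrite -restrict_EFin; apply: (iffLR (@integrable_mkcond _ _ R (leb R) _ _ mC)).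
pose F x := \int[leb R]_(s in `[0, x]) f s.
have cF : continuous F by apply: Rint_continuous => T; apply: fi; exact: measurable_itv.
have FE t : circle R t -> RC (F t) = cint (leb R) `[0, t] (fun s => RC (u s)).
  rewrite /circle/= in_itv/= => /andP[t0 tp]; rewrite cintR; congr (RC _).
  apply: eq_Rintegral => s; rewrite inE/= in_itv/= => /andP[s0 st].
  by rewrite fE// /circle/= in_itv/= s0 (le_trans st).
have cth0 : RC cth != 0 :> R[i].
  by rewrite (_ : 0 = RC 0)// (inj_eq (@complexI R)) lt0r_neq0// cth_gt0.
have uz n : cint (leb R) (circle R) (fun x => RC (u x) * cis (n%:~R * x)) = 0.
  have /eqP := u0 (- n); rewrite fourierE mulf_eq0 (negbTE cth0)/= => /eqP <-.
  by apply: eq_cint => x _; rewrite rmorphN/= mulNr opprK.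
have uz0 : cint (leb R) (circle R) (fun x => RC (u x)) = 0.
  by rewrite -[RHS](uz 0); apply: eq_cint => x _; rewrite mul0r cis0 mulr1.
have iRu : cintegrable (leb R) (circle R) (fun x => RC (u x)).
  by apply: cintegrableR.
have Fz n : n != 0 -> cint (leb R) (circle R) (fun x => RC (F x) * cis (n%:~R * x)) = 0.
  move=> n0; have -> : cint (leb R) (circle R) (fun x => RC (F x) * cis (n%:~R * x)) =
      cint (leb R) `[0, 2 * pi] (fun t => cis (n%:~R * t) * cint (leb R) `[0, t] (fun s => RC (u
        s))).
    by apply: eq_cint => t tc; rewrite FE// mulrC.
  rewrite triangle_fubini//; last exact: cis_circle_integrable.
  have in0 : Complex 0 n%:~R != 0 :> R[i] by rewrite eq_complex/= eqxx/= intr_eq0.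
  rewrite (@eq_cint _ _ _ (leb R) _ _ (fun x => (Complex 0 n%:~R)^-1 *
      (RC (u x) - RC (u x) * cis (n%:~R * x)))); last first.
    move=> x; rewrite /= in_itv/= => /andP[x0 xp]; apply: (mulfI in0).
    by rewrite mulrA cint_cis// cis_pi2_int mulrA divff// mul1r mulrBl mul1r [cis _ * _]mulrC.
  have iuc := RCcis_integrable n%:~R iu.
  rewrite cintZ; [|exact: mC|exact: cintegrableB].
  by rewrite cintB// [X in X - _]uz0 [X in _ - X]uz subrr mulr0.
pose m := (\int[leb R]_(x in circle R) F x) / (2 * pi).
have iF : cintble F by exact: cintble_continuous.
have Vz n : cint (leb R) (circle R) (fun x => RC (F x - m) * cis (n%:~R * x)) = 0.
  rewrite (@eq_cint _ _ _ (leb R) _ _ (fun x => RC (F x) * cis (n%:~R * x) - RC m * cis (n%:~R *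
    x))); last first.
    by move=> x _; rewrite rmorphB mulrBl.
  rewrite cintB; [|exact: mC|exact: RCcis_integrable|by apply: cintegrableZ => //; exact:
    cis_circle_integrable].
  rewrite cintZ; [|exact: mC|exact: cis_circle_integrable].
  rewrite cint_circle_cis; case: eqVneq => [->|n0]; last by rewrite Fz// mulr0 subr0.
  rewrite (@eq_cint _ _ _ (leb R) _ _ (fun x => RC (F x))); last first.
    by move=> x _; rewrite mul0r cis0 mulr1.
  by rewrite cintR -rmorphM /m divfK ?subrr// lt0r_neq0// pi2_gt0.
have cV : continuous (fun x => F x - m).
  by move=> x; apply: cvgB; [exact: cF|exact: cvg_cst].
have Fm x : 0 < x < 2 * pi -> F x = m.
  move=> x0; apply/eqP; rewrite eq_le -subr_le0 (continuous_fourier_nonpos cV Vz x0)/=.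
  rewrite -subr_le0 -opprB; apply: (@continuous_fourier_nonpos (fun x => - (F x - m))) x0.
    by move=> y; apply: cvgN; exact: cV.
  move=> n; rewrite (@eq_cint _ _ _ (leb R) _ _ (fun x => - (RC (F x - m) * cis (n%:~R * x)))).
    rewrite cintN ?Vz ?oppr0//; apply: RCcis_integrable; exact: cintble_continuous.
  by move=> y _; rewrite rmorphN mulNr.
have h := @FTC1 R f (BLeft 0) (fun y => fi _ (measurable_itv _)) (integrable_locally mC iu).
have nn (x : R) : {ae leb R, forall y, y <> x}.
  exists [set x]; split; [exact: measurable_set1|exact: lebesgue_measure_set1|].
  by move=> y /=; apply: contra_notP.
apply: filterS3 (nn 0) (nn (2 * pi)) h => x nx0 nx2 hx xc.
have := xc; rewrite /circle/= in_itv/= => /andP[x0 xp].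
have {}x0 : 0 < x by rewrite lt_neqAle x0 andbT eq_sym; apply/eqP.
have {}xp : x < 2 * pi by rewrite lt_neqAle xp andbT; apply/eqP.
have [|_] := hx; first by rewrite /= lte_fin.
rewrite fE// => <-; rewrite derive1E.
rewrite (@near_eq_derive _ _ _ _ (cst m)) ?derive_cst//.
near=> y; apply: Fm.
by apply/andP; split; near: y; [exact: lt_nbhsr|exact: lt_nbhsl].
Unshelve. all: by end_near.
Qed.

End Injectivity.

(** * Absolutely convergent series *)

Section Series.
Context {R : realType}.
Implicit Types (z w : nat -> R[i]) (n : int).

Lemma cnorm0 : cnorm (0 : R[i]) = 0.
Proof. by rewrite /Normc.normc/= expr0n/= addr0 sqrtr0. Qed.

Definition summable_seq z := (\sum_(n <oo) (cnorm (z n))%:E < +oo)%E.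

Lemma summable_le z w (C : R) : 0 <= C -> (forall k, cnorm (z k) <= C * cnorm (w k)) ->
  summable_seq w -> summable_seq z.
Proof.
move=> C0 zw sw; apply: (@le_lt_trans _ _ (C%:E * \sum_(n <oo) (cnorm (w n))%:E)%E); last first.
  by rewrite lte_mul_pinfty.
rewrite -nneseriesZl//; last by move=> k _; rewrite lee_fin cnorm_ge0.
by apply: lee_nneseries => k *; rewrite -?EFinM lee_fin ?cnorm_ge0.
Qed.

Lemma summableJ z : summable_seq z -> summable_seq (fun k => conjc (z k)).
Proof. by apply: (@summable_le _ _ 1) => // k; rewrite cnormJ mul1r. Qed.

Lemma summableMb z w (C : R) : (forall k, cnorm (w k) <= C) -> summable_seq z ->
  summable_seq (fun k => w k * z k).
Proof.
move=> wC; apply: (@summable_le _ _ C).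
  exact: le_trans (cnorm_ge0 _) (wC 0%N).
by move=> k; rewrite Normc.normcM ler_wpM2r ?cnorm_ge0.
Qed.

Lemma summableD z w : summable_seq z -> summable_seq w ->
  summable_seq (fun k => z k + w k).
Proof.
move=> /csummableP iz /csummableP iw.
by apply/csummableP; apply: cintegrableD.
Qed.

Lemma csumD z w : summable_seq z -> summable_seq w ->
  csum (fun k => z k + w k) = csum z + csum w.
Proof. by move=> /csummableP ? /csummableP ?; apply: cintD. Qed.

Lemma csumB z w : summable_seq z -> summable_seq w ->
  csum (fun k => z k - w k) = csum z - csum w.
Proof. by move=> /csummableP ? /csummableP ?; apply: cintB. Qed.

Lemma csumZ (v : R[i]) z : summable_seq z -> csum (fun k => v * z k) = v * csum z.
Proof. by move=> /csummableP ?; apply: cintZ. Qed.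

Lemma csumJ z : summable_seq z -> csum (fun k => conjc (z k)) = conjc (csum z).
Proof. by move=> /csummableP ?; apply: cintJ. Qed.

Lemma eq_csum z w : (forall k, z k = w k) -> csum z = csum w.
Proof. by move=> zw; apply: eq_cint. Qed.

Lemma csum0 : csum (fun=> 0 : R[i]) = 0.
Proof. exact: cint0. Qed.

Lemma csum_delta j (v : R[i]) : csum (fun k => if k == j then v else 0) = v.
Proof.
rewrite /csum (@cint_if _ _ _ _ setT [set j] (fun=> v) (fun k => k == j)); last first.
  by move=> k; split => [[_ /eqP]|/= ->].
have one : fine (@counting nat R [set j]) = 1.
  by rewrite /counting/= asboolT// fset_set1 finmap.cardfs1.
by apply: complex_ext; rewrite /= Rintegral_cst// [X in _ * X]one mulr1.
Qed.

Lemma summable_finite z N : summable_seq (fun k => if (k < N)%N then z k else 0).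
Proof.
rewrite /summable_seq (nneseries_split 0 N); last by move=> k _; rewrite lee_fin cnorm_ge0.
rewrite add0n [X in (_ + X)%E]eseries0 ?adde0; last first.
  by move=> k kN _; rewrite ltnNge kN cnorm0.
by rewrite [X in (X < _)%E](_ : _ = (\sum_(0 <= k < N) cnorm (if (k < N)%N then z k else 0))%:E)
  ?ltry// sumEFin.
Qed.

Lemma csum_finite z N : csum (fun k => if (k < N)%N then z k else 0) = \sum_(k < N) z k.
Proof.
elim: N => [|N ih]; first by rewrite big_ord0 -[RHS]csum0; apply: eq_csum.
rewrite big_ord_recr/= -ih -[z N in RHS](csum_delta N) -csumD.
- apply: eq_csum => k; rewrite ltnS leq_eqVlt; case: eqVneq => [->|] /=.
    by rewrite ltnn add0r.
  by rewrite addr0.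
- exact: summable_finite.
- rewrite (_ : (fun k => _) = fun k => if (k < N.+1)%N then (if k == N then z N else 0) else 0).
    exact: summable_finite.
  by apply/funext => k; case: eqVneq => [->|]; rewrite ?ltnS ?leqnn// if_same.
Qed.

Lemma csum_tail z N : summable_seq z ->
  ((cnorm (csum z - \sum_(k < N) z k))%:E <= \sum_(N <= k <oo) (cnorm (z k))%:E)%E.
Proof.
move=> sz; rewrite -csum_finite -csumB//; last exact: summable_finite.
apply: le_trans (csum_norme _) _.
rewrite (nneseries_split 0 N); last by move=> k _; rewrite lee_fin cnorm_ge0.
rewrite add0n big_nat_cond big1 ?add0e; last first.
  by move=> k /andP[/andP[_ ->] _]; rewrite subrr cnorm0.
apply: lee_nneseries => k; first by rewrite lee_fin cnorm_ge0.
by move=> _; case: ifP => _; rewrite ?subr0// subrr cnorm0 lee_fin cnorm_ge0.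
Qed.

Lemma csum_cvg z : summable_seq z ->
  cRe (\sum_(k < N) z k) @[N --> \oo] --> cRe (csum z).
Proof.
move=> sz; have /fine_cvgP[fin0 tail] : (\sum_(N <= k <oo) (cnorm (z k))%:E)%E @[N --> \oo] --> 0%E.
  by apply: nneseries_tail_cvg => // k; rewrite lee_fin cnorm_ge0.
apply/cvgrPdist_le => e e0.
have /cvgrPdist_le/(_ _ e0) h := tail.
near=> N; rewrite -cReN -cReD; apply: le_trans (Re_le_cnorm _) _.
rewrite -lee_fin; apply: le_trans (csum_tail _ sz) _.
have fN : (\sum_(N <= k <oo) (cnorm (z k))%:E)%E \is a fin_num by near: N.
rewrite -(fineK fN) lee_fin.
have : `|0 - fine (\sum_(N <= k <oo) (cnorm (z k))%:E)%E| <= e by near: N.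
by rewrite sub0r normrN; apply: le_trans; exact: ler_norm.
Unshelve. all: by end_near.
Qed.

End Series.

(** Lets the product-measure theorems pair the counting measure with Lebesgue measure. *)
HB.instance Definition _ (R : realType) :=
  @Measure_isSigmaFinite.Build _ _ _ (@counting _ R) (sigma_finite_counting R).

(** * Synthesis of a real function from its positive modes *)

Section Synthesis.
Context {R : realType}.
Implicit Types (z w : nat -> R[i]) (u v psi : R -> R) (n : int).

Let mC := @measurable_circle R.

Lemma csum_cint (D : set R) (F : nat -> R -> R[i]) : measurable D ->
  (forall k, cmeas D (F k)) ->
  (\sum_(k <oo) \int[leb R]_(x in D) (cnorm (F k x))%:E < +oo)%E ->
  [/\ summable_seq (fun k => cint (leb R) D (F k)),
      cintegrable (leb R) D (fun x => csum (F^~ x)) &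
      csum (fun k => cint (leb R) D (F k)) = cint (leb R) D (fun x => csum (F^~ x))].
Proof.
move=> mD mF Foo.
have mFF : cmeas (setT `*` D) (fun p : nat * R => F p.1 p.2) by exact: cmeas_nat.
have Foo1 : (\int[@counting nat R]_(k in setT) \int[leb R]_(x in D) (cnorm (F k x))%:E < +oo)%E.
  by rewrite ge0_integral_count// => k; apply: integral_ge0 => x _; rewrite lee_fin cnorm_ge0.
have [i1 e1] := cfubini (m1 := @counting nat R) (m2 := leb R) measurableT mD mFF Foo1.
split=> //; first exact/csummableP.
have mG : cmeas (D `*` setT) (fun p : R * nat => F p.2 p.1).
  by split; apply: (measurable_fun_dom_swap (f := fun k x => _ (F k x))) => //; case: mFF.
have [] // := cfubini (m1 := leb R) (m2 := @counting nat R) mD measurableT (F := fun x k => F k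
  x) mG.
rewrite -(@fubini_tonelli_dom _ _ _ _ _ (@counting nat R) (leb R) setT D)//.
- by apply/measurable_EFinP; exact: (cmeas_norm mFF).
- by move=> *; rewrite lee_fin cnorm_ge0.
Qed.

Lemma cisN_cmeas (t : R) (D : set R) : measurable D -> cmeas D (fun x => cis (- (t * x))).
Proof.
move=> mD; have := cis_cmeas (- t) mD.
by rewrite (_ : (fun x => cis (- t * x)) = fun x => cis (- (t * x)))//; apply/funext => x;
  rewrite mulNr.
Qed.

(** For a real function of zero mean the positive frequencies determine the others, which are
    conjugates. *)
Definition modes u (k : nat) : R[i] := fourier u k.+1%:Z.

(** The conjugate terms at frequencies k + 1 and - k - 1 add up to twice a real part. *)
Definition synth z (x : R) : R :=
  2 * cth * cRe (csum (fun k => z k * cis (k.+1%:R * x))).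

Lemma synth_periodic z : periodic (synth z) (2 * pi).
Proof.
move=> x; rewrite /synth; congr (_ * cRe _); apply: eq_csum => k.
have := cis_pi2_int (R := R) k.+1%:Z; rewrite -[_%:~R]/(k.+1%:R) => h.
by rewrite mulrDr cisD h mulr1.
Qed.

Lemma measurable_synth z (D : set R) : measurable D -> measurable_fun D (synth z).
Proof.
move=> mD; apply: measurable_funS (measurableT) _ _ => //.
apply: measurable_funM => //.
have [] // := @cmeas_csum R _ _ (fun k (x : R) => z k * cis (k.+1%:R * x)) _.
by move=> k; apply: cmeasM; [exact: cmeas_cst|exact: cis_cmeas].
Qed.

Lemma summable_cis z x : summable_seq z ->
  summable_seq (fun k => z k * cis (k.+1%:R * x)).
Proof.
apply: (@summable_le _ _ _ 1) => // k.
by rewrite Normc.normcM cnorm_cis mulr1 mul1r.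
Qed.

Lemma synthE z x : summable_seq z ->
  RC (synth z x) = RC cth * csum (fun k => z k * cis (k.+1%:R * x) +
                                   conjc (z k) * cis (- (k.+1%:R * x))).
Proof.
move=> sz; have sc := summable_cis x sz.
rewrite (@eq_csum _ _ (fun k => z k * cis (k.+1%:R * x) +
    conjc (z k * cis (k.+1%:R * x)))); last by move=> k; rewrite conjcM -cisN.
rewrite csumD ?csumJ//; last exact: summableJ.
rewrite /synth; case: (csum _) => a b; apply: complex_ext => /=; ring.
Qed.

Lemma synth_bound z x (S : R) : (\sum_(n <oo) (cnorm (z n))%:E <= S%:E)%E ->
  `|synth z x| <= 2 * cth * S.
Proof.
move=> zS; have c0 : 0 <= 2 * cth :> R by rewrite mulr_ge0// ltW// cth_gt0.
rewrite /synth normrM (ger0_norm c0) ler_wpM2l//.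
apply: le_trans (Re_le_cnorm _) _; rewrite -lee_fin.
apply: le_trans (csum_norme _) _; apply: le_trans zS.
apply: lee_nneseries => k *; first by rewrite lee_fin cnorm_ge0.
by rewrite Normc.normcM cnorm_cis mulr1.
Qed.

Lemma summable_ex z : summable_seq z ->
  exists2 S : R, 0 <= S & (\sum_(n <oo) (cnorm (z n))%:E = S%:E)%E.
Proof.
move=> sz; have z0 : (0 <= \sum_(n <oo) (cnorm (z n))%:E)%E.
  by apply: nneseries_ge0 => k *; rewrite lee_fin cnorm_ge0.
exists (fine (\sum_(n <oo) (cnorm (z n))%:E)%E); first exact: fine_ge0.
by rewrite fineK// ge0_fin_numE.
Qed.

Lemma synthM_cintble z u : summable_seq z -> cintble u -> cintble (fun x => u x * synth z x).
Proof.
move=> sz iu; have [S _ SE] := summable_ex sz.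
have mu : measurable_fun (circle R) u by case/integrableP : iu => /measurable_EFinP.
apply: (@le_integrable _ _ R (leb R) _ mC _ (EFin \o (fun x => 2 * cth * S * u x))).
- by apply/measurable_EFinP; apply: measurable_funM => //; exact: measurable_synth.
- move=> x _; rewrite [X in (_ <= X)%E]/= lee_fin normrM [X in _ <= X]normrM mulrC ler_wpM2r//.
  have b := @synth_bound z x S; rewrite SE lexx in b.
  by apply: le_trans (b isT) _; exact: ler_norm.
- exact: cintbleZ.
Qed.

Lemma synth_cintble z : summable_seq z -> cintble (synth z).
Proof.
move=> sz; have := synthM_cintble sz (cintble_cst 1).
by under eq_fun do rewrite mul1r.
Qed.

(** Convolution formula with one factor only integrable: the absolutely convergent series of the
    other factor is integrated term by term against it. With [u = 1] it gives the coefficients of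
    [synth], with [n = 0] Parseval's identity, and in general the modes of the commutator. *)
Lemma fourier_synthM z u n : summable_seq z -> cintble u ->
  fourier (fun x => u x * synth z x) n =
  RC cth * csum (fun k => z k * fourier u (n - k.+1%:Z) +
                          conjc (z k) * fourier u (n + k.+1%:Z)).
Proof.
move=> sz iu.
pose H k x := RC (u x) * cis (- (n%:~R * x)) * (z k * cis (k.+1%:R * x)).
pose K k x := RC (u x) * cis (- (n%:~R * x)) * (conjc (z k) * cis (- (k.+1%:R * x))).
have iG := RCcisN_integrable n%:~R iu.
pose I : \bar R := (\int[leb R]_(x in circle R) (cnorm (RC (u x) * cis (- (n%:~R * x))))%:E)%E.
have I0 : (0 <= I)%E by apply: integral_ge0 => x _; rewrite lee_fin cnorm_ge0.
have /cintegrableP[//|mG Ioo] := iG; rewrite -/I in Ioo.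
have bnd (F : nat -> R -> R[i]) : (forall k x, cnorm (F k x) = cnorm (z k)) ->
    (forall k, cmeas (circle R) (F k)) ->
    [/\ forall k, cmeas (circle R) (fun x => RC (u x) * cis (- (n%:~R * x)) * F k x) &
    (\sum_(k <oo) \int[leb R]_(x in circle R)
      (cnorm (RC (u x) * cis (- (n%:~R * x)) * F k x))%:E < +oo)%E].
  move=> FE mF; split => [k|]; first exact: cmeasM.
  apply: (@le_lt_trans _ _ (\sum_(k <oo) I * (cnorm (z k))%:E)%E).
    apply: lee_nneseries => [k _ _|k _].
      by apply: integral_ge0 => x _; rewrite lee_fin cnorm_ge0.
    rewrite muleC -ge0_integralZl ?lee_fin ?cnorm_ge0//; last 2 first.
    - by apply/measurable_EFinP; exact: cmeas_norm.
    - by move=> x _; rewrite lee_fin cnorm_ge0.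
    apply: ge0_le_integralW => [x _|x _]; first by rewrite lee_fin cnorm_ge0.
    by rewrite [X in (X%:E <= _)%E]Normc.normcM FE mulrC EFinM.
  have /fineK <- : I \is a fin_num by rewrite ge0_fin_numE.
  rewrite nneseriesZl//; last by move=> k _; rewrite lee_fin cnorm_ge0.
  by apply: lte_mul_pinfty; rewrite ?lee_fin ?fine_ge0.
have [mH Hoo] := bnd (fun k x => z k * cis (k.+1%:R * x))
  (fun k x => ltac:(by rewrite Normc.normcM cnorm_cis mulr1))
  (fun k => cmeasM (cmeas_cst _ _) (cis_cmeas _ mC)).
have [mK Koo] := bnd (fun k x => conjc (z k) * cis (- (k.+1%:R * x)))
  (fun k x => ltac:(by rewrite Normc.normcM cnorm_cis mulr1 cnormJ))
  (fun k => cmeasM (cmeas_cst _ _) (cisN_cmeas _ mC)).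
have [sH iH eH] := csum_cint mC mH Hoo.
have [sK iK eK] := csum_cint mC mK Koo.
rewrite fourierE; congr (_ * _).
rewrite (@eq_cint _ _ _ (leb R) _ _ (fun x => RC cth * (csum (H^~ x) + csum (K^~ x)))); last first.
  move=> x _; rewrite rmorphM/= synthE// -csumD; last 2 first.
  - apply: (@summable_le _ _ z (cnorm (RC (u x) * cis (- (n%:~R * x))))) => // [|k].
      exact: cnorm_ge0.
    by rewrite /H !Normc.normcM [cnorm (cis (k.+1%:R * x))]cnorm_cis mulr1.
  - apply: (@summable_le _ _ z (cnorm (RC (u x) * cis (- (n%:~R * x))))) => // [|k].
      exact: cnorm_ge0.
    by rewrite /K !Normc.normcM [cnorm (cis (- (k.+1%:R * x)))]cnorm_cis mulr1 cnormJ.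
  rewrite [RC (u x) * (_ * _)]mulrCA -[LHS]mulrA; congr (_ * _).
  rewrite mulrAC -csumZ; last first.
    apply: summableD; first exact: summable_cis.
    apply: (@summable_le _ _ z 1) => // k.
    by rewrite Normc.normcM cnorm_cis mulr1 cnormJ mul1r.
  by apply: eq_csum => k; rewrite /H /K mulrDr.
rewrite cintZ//; last exact: cintegrableD.
rewrite cintD// -eH -eK -csumD//.
rewrite -csumZ; last exact: summableD.
apply: eq_csum => k; rewrite mulrDr !fourierE; congr (_ + _).
  rewrite [RHS]mulrCA; congr (_ * _).
  rewrite -cintZ//; last exact: RCcisN_integrable.
  apply: eq_cint => x _; rewrite /H mulrCA -mulrA; congr (_ * (_ * _)).
  by rewrite -cisD rmorphB/= mulrBl opprB addrC.
rewrite [RHS]mulrCA; congr (_ * _).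
rewrite -cintZ//; last exact: RCcisN_integrable.
apply: eq_cint => x _; rewrite /K mulrCA -mulrA; congr (_ * (_ * _)).
by rewrite -cisD rmorphD/= mulrDl opprD.
Qed.


Lemma fourier_cst1 n : fourier (fun=> 1 : R) n = if n == 0 then RC cth^-1 else 0.
Proof.
rewrite fourierE (@eq_cint _ _ _ (leb R) _ _ (fun x => cis ((- n)%:~R * x))); last first.
  by move=> x _; rewrite rmorph1 mul1r rmorphN/= mulNr.
rewrite cint_circle_cis oppr_eq0; case: eqVneq => _; last by rewrite mulr0.
rewrite -rmorphM; congr (RC _).
by apply: (mulfI (lt0r_neq0 cth_gt0)); rewrite mulrA -expr2 cth_sqr divff// lt0r_neq0// cth_gt0.
Qed.

Lemma fourier_synth z n : summable_seq z -> fourier (synth z) n =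
  match n with Posz 0 => 0 | Posz k.+1 => z k | Negz k => conjc (z k) end.
Proof.
move=> sz; have -> : synth z = fun x => 1 * synth z x by apply/funext => x; rewrite mul1r.
have c0 : RC cth * RC cth^-1 = 1 :> R[i].
  by rewrite -rmorphM divff ?rmorph1// lt0r_neq0// cth_gt0.
rewrite fourier_synthM//; last exact: cintble_cst.
case: n => [[|j]|j].
- rewrite (@eq_csum _ _ (fun=> 0)) ?csum0 ?mulr0// => k.
  by rewrite !fourier_cst1 subr_eq0 (_ : (0%Z + k.+1 == 0) = false)// !mulr0 addr0.
- rewrite (@eq_csum _ _ (fun k => if k == j then z j * RC cth^-1 else 0)).
    by rewrite csum_delta mulrCA c0 mulr1.
  move=> k; rewrite !fourier_cst1 subr_eq0 (_ : (j.+1%:Z + k.+1%:Z == 0) = false)// mulr0 addr0.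
  rewrite -[_ == _]/(j == k) eq_sym; case: eqVneq => [->//|_]; exact: mulr0.
- rewrite (@eq_csum _ _ (fun k => if k == j then conjc (z j) * RC cth^-1 else 0)).
    by rewrite csum_delta mulrCA c0 mulr1.
  move=> k; rewrite !fourier_cst1 NegzE -opprD oppr_eq0 (_ : (j.+1%:Z + k.+1%:Z == 0) = false)//.
  rewrite mulr0 add0r addrC subr_eq0 -[k.+1%:Z == _]/(k == j).
  by case: eqVneq => [->//|_]; exact: mulr0.
Qed.

Lemma modes_synth z : summable_seq z -> modes (synth z) = z.
Proof. by move=> sz; apply/funext => k; rewrite /modes fourier_synth. Qed.

Lemma modes_ext u v : cintble u -> cintble v -> fourier u 0 = fourier v 0 ->
  modes u = modes v -> {ae leb R, forall x, circle R x -> u x = v x}.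
Proof.
move=> iu iv e0 em; have FF := ae_filter_ringOfSetsType (leb R).
have em' k : fourier u k.+1%:Z = fourier v k.+1%:Z by rewrite -/(modes u k) em.
have := @fourier_injective0 _ _ (cintbleB iu iv); move=> h.
have {}h : {ae leb R, forall x, circle R x -> u x - v x = 0}.
  apply: h => n; rewrite fourierB//; apply/eqP; rewrite subr_eq0; apply/eqP.
  by case: n => [[|k]|k] //; rewrite NegzE !fourierN// em'.
by apply: filterS h => x hx xc; apply/eqP; rewrite -subr_eq0 hx.
Qed.

Lemma synth_modes u : cintble u -> fourier u 0 = 0 -> summable_seq (modes u) ->
  {ae leb R, forall x, circle R x -> u x = synth (modes u) x}.
Proof.
move=> iu u0 su; apply: modes_ext => //; first exact: synth_cintble.
  by rewrite fourier_synth.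
by rewrite modes_synth.
Qed.

Lemma fourier_bound u n : cintble u ->
  cnorm (fourier u n) <= cth * \int[leb R]_(x in circle R) `|u x|.
Proof.
move=> iu; rewrite fourierE Normc.normcM cnormR ger0_norm ?(ltW cth_gt0)//.
rewrite ler_wpM2l ?(ltW cth_gt0)//.
have := @cint_norm _ _ R (leb R) _ _ mC (RCcisN_integrable n%:~R iu).
by under eq_Rintegral do rewrite Normc.normcM cnorm_cis mulr1 cnormR.
Qed.

Lemma parseval z psi : summable_seq z -> cintble psi ->
  \int[leb R]_(x in circle R) (synth z x * psi x) =
  2 * cRe (csum (fun k => z k * conjc (modes psi k))).
Proof.
move=> sz ip.
have c0 : cth != 0 :> R by rewrite lt0r_neq0// cth_gt0.
have h : cRe (csum (fun k => z k * fourier psi (0 - k.+1%:Z) +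
    conjc (z k) * fourier psi (0 + k.+1%:Z))) = \int[leb R]_(x in circle R) (psi x * synth z x).
  by apply: (mulfI c0); rewrite -cReMR -fourier_synthM// fourier_mean.
have -> : \int[leb R]_(x in circle R) (synth z x * psi x) =
    \int[leb R]_(x in circle R) (psi x * synth z x).
  by apply: eq_Rintegral => x _; rewrite mulrC.
rewrite -h (@eq_csum _ _ (fun k => z k * conjc (modes psi k) + conjc (z k * conjc (modes psi k)))).
  have [S _ SE] := summable_ex sz.
  have sP : summable_seq (fun k => z k * conjc (modes psi k)).
    pose I := \int[leb R]_(x in circle R) `|psi x|.
    apply: (@summable_le _ _ z (cth * I)) => // [|k].
      by rewrite mulr_ge0 ?(ltW cth_gt0)// Rintegral_ge0.
    by rewrite Normc.normcM cnormJ mulrC ler_wpM2r ?cnorm_ge0// fourier_bound.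
  by rewrite csumD ?csumJ// ?cReD ?cReJ; [ring|exact: summableJ].
move=> k; rewrite sub0r add0r fourierN// conjcM.
by rewrite (_ : conjc (conjc _) = modes psi k)//; apply: conjcK.
Qed.

End Synthesis.

(** * Fourier multipliers and Wiener norms *)

Section Multipliers.
Context {R : realType}.
Implicit Types (z w : nat -> R[i]) (u v psi : R -> R) (n : int).

Let mC := @measurable_circle R.

Definition wpow (m k : nat) : R := k.+1%:R ^+ m.

Lemma wpow_ge1 m k : 1 <= wpow m k.
Proof. by rewrite exprn_ege1// ler1n. Qed.

Lemma wpow_ge0 m k : 0 <= wpow m k.
Proof. exact: le_trans ler01 (wpow_ge1 m k). Qed.

Lemma sum_symmetric (V : zmodType) (g : int -> V) N :
  \sum_(j < N.*2.+1) g ((j : nat)%:Z - N%:Z) =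
  g 0 + \sum_(k < N) (g k.+1%:Z + g (- k.+1%:Z)).
Proof.
elim: N => [|N ih]; first by rewrite big_ord_recl !big_ord0 subrr.
rewrite doubleS big_ord_recl big_ord_recr/= [in RHS]big_ord_recr/= [RHS]addrA -ih.
have -> : g (N.*2.+2%:Z - N.+1%:Z) = g N.+1%:Z.
  by congr g; rewrite -addnn -addnS -addSn PoszD addrK.
rewrite sub0r [LHS]addrC -[LHS]addrA; congr (_ + _).
by apply: eq_bigr => j _; congr g; rewrite /bump/= add1n !intS; ring.
Qed.

Lemma nneseries_range (F : int -> \bar R) (f : nat -> int) : (forall k, 0 <= F k)%E ->
  injective f -> (\sum_(k <oo) F (f k) = \esum_(k in range f) F k)%E.
Proof.
move=> F0 fi; rewrite (@reindex_esum _ _ _ setT _ f) ?nneseries_esumT//.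
by split; [move=> k _; exists k|move=> i j _ _ /fi|].
Qed.

Lemma nneseries_le_esum (F : int -> \bar R) (f : nat -> int) : (forall k, 0 <= F k)%E ->
  injective f -> (\sum_(k <oo) F (f k) <= \esum_(k in [set: int]) F k)%E.
Proof.
move=> F0 fi; rewrite nneseries_range// [leRHS](esumID (range f)); last by move=> k _.
by rewrite setTI leeDl// esum_ge0.
Qed.

(** An equality at every point, not only almost everywhere, because [multiplier] sees [u] through
    its coefficients alone. The condition at frequency 0 is met for the powers of Lambda by the zero
    mean, for the Hilbert transform because its symbol vanishes there. *)
Lemma multiplier_synth (m : int -> R[i]) u :
  (forall k : nat, m (- k.+1%:Z) = conjc (m k.+1%:Z)) -> cintble u ->
  m 0 * fourier u 0 = 0 -> summable_seq (fun k => m k.+1%:Z * modes u k) ->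
  multiplier m u = synth (fun k => m k.+1%:Z * modes u k).
Proof.
move=> mJ iu m0 sm; apply/funext => x; rewrite /multiplier.
have sc := summable_cis x sm.
apply/cvg_lim; first exact: Rhausdorff.
have -> : (fun N : nat => (Num.sqrt (2 * pi))^-1 * cRe (\sum_(j < N.*2.+1)
     let n := (j : nat)%:Z - N%:Z in m n * fourier u n * cis (n%:~R * x))) =
   fun N => 2 * cth * cRe (\sum_(k < N) (m k.+1%:Z * modes u k * cis (k.+1%:R * x))).
  apply/funext => N; rewrite (sum_symmetric (fun n => m n * fourier u n * cis (n%:~R * x))).
  rewrite m0 mul0r add0r [2 * cth]mulrC -mulrA; congr (_ * _).
  rewrite mulr_natl mulr2n -[X in _ = _ + X]cReJ -cReD; congr cRe.
  rewrite big_split/=; congr (_ + _).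
  rewrite (big_morph conjc (id1 := 0) (op1 := +%R)); last 2 first.
  - by move=> a b; rewrite rmorphD.
  - by rewrite rmorph0.
  apply: eq_bigr => k _; rewrite mJ fourierN// !conjcM -cisN; congr (_ * _ * cis _).
  by rewrite rmorphN/= mulNr.
by apply: cvgM; [exact: cvg_cst|exact: csum_cvg].
Qed.

Lemma wiener_normE (m : nat) u : cintble u -> fourier u 0 = 0 ->
  (wiener_norm m%:R u = 2%:E * wsum (wpow m) (modes u))%E.
Proof.
move=> iu u0; rewrite /wiener_norm.
set F : int -> \bar R := fun k => _.
have F0 k : (0 <= F k)%E by rewrite lee_fin mulr_ge0 ?powR_ge0 ?cnorm_ge0.
have Fz : F 0 = 0%E by rewrite /F u0 cnorm0 mulr0.
have FP k : F k.+1%:Z = (wpow m k * cnorm (modes u k))%:E.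
  by rewrite /F/= powR_mulrn.
have FN k : F (Negz k) = F k.+1%:Z.
  by rewrite /F NegzE fourierN// cnormJ abszN.
clearbody F.
have rng (f : nat -> int) (fi : injective f) := nneseries_range F0 fi.
rewrite (esumID (range (fun k : nat => k.+1%:Z))); last by move=> k _; exact: F0.
rewrite setTI -rng; last by move=> i j [].
rewrite (esumID (range Negz)); last by move=> k _; exact: F0.
rewrite (_ : [set: int] `&` ~` _ `&` range Negz = range Negz); last first.
  apply/seteqP; split => [k []//|k [i _ <-]]; split; last by exists i.
  by split=> //= -[].
rewrite -rng; last by move=> i j [].
rewrite esum1 ?adde0; last first.
  move=> [[|k]|k]; first by rewrite Fz.
    by move=> [[_ /= h] _]; exfalso; apply: h; exists k.
  by move=> [[_ _] /= h]; exfalso; apply: h; exists k.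
under [X in (X + _)%E]eq_eseriesr do rewrite FP.
under [X in (_ + X)%E]eq_eseriesr do rewrite FN FP.
by rewrite mule_natl mule2n.
Qed.

Lemma wsum_summable (w : nat -> R) z : (forall k, 1 <= w k) -> (wsum w z < +oo)%E ->
  summable_seq z.
Proof.
move=> w_1; apply: le_lt_trans; apply: lee_nneseries => k *; rewrite lee_fin ?cnorm_ge0//.
by rewrite ler_peMl ?cnorm_ge0.
Qed.

Definition mean0 u := cintble u /\ fourier u 0 = 0.

Lemma wienerP (m : nat) u : wiener m%:R u <->
  [/\ periodic u (2 * pi), mean0 u & (wsum (wpow m) (modes u) < +oo)%E].
Proof.
have c0 : cth != 0 :> R by rewrite lt0r_neq0// cth_gt0.
have key : cintble u -> fourier u 0 = 0 ->
    (wiener_norm m%:R u < +oo)%E = (wsum (wpow m) (modes u) < +oo)%E.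
  move=> iu u0; rewrite wiener_normE//.
  have : (0 <= wsum (wpow m) (modes u))%E.
    by apply: wsum_ge0 => k; exact: wpow_ge0.
  case: (wsum _ _) => [r| |]//; first by rewrite -EFinM !ltry.
  by rewrite gt0_muley// lte_fin.
split=> [[pu iu u0 wu]|[pu [iu u0] wu]].
  have f0 : fourier u 0 = 0 by rewrite fourier_mean u0 mulr0.
  by split; rewrite -?key.
split => //; last by rewrite key.
by move: u0; rewrite fourier_mean => /(congr1 (@complex.Re _))/= /eqP; rewrite mulf_eq0 (negbTE
  c0)/= => /eqP.
Qed.

Lemma wiener_synth (m : nat) z : (wsum (wpow m) z < +oo)%E ->
  wiener m%:R (synth z).
Proof.
move=> wz; have sz : summable_seq z.
  by apply: wsum_summable wz => k; exact: wpow_ge1.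
apply/wienerP; rewrite modes_synth//; split => //; first exact: synth_periodic.
by split; [exact: synth_cintble|rewrite fourier_synth].
Qed.

Lemma Lambda_synth (s : nat) u : mean0 u ->
  summable_seq (fun k => RC (k.+1%:R ^+ s) * modes u k) ->
  Lambda s u = synth (fun k => RC (k.+1%:R ^+ s) * modes u k).
Proof.
move=> [iu u0] su; have e k : (absz k.+1%:Z)%:R ^+ s = RC (k.+1%:R ^+ s) :> R[i].
  by rewrite /= rmorphXn/= rmorph_nat.
rewrite /Lambda multiplier_synth//.
- by congr synth; apply/funext => k; rewrite e.
- by move=> k; rewrite abszN e conjcR.
- by rewrite u0 mulr0.
- by under eq_fun do rewrite e.
Qed.

Lemma hilbert_synth u : cintble u -> summable_seq (modes u) ->
  hilbert u = synth (fun k => - Complex 0 1 * modes u k).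
Proof.
move=> iu su; rewrite /hilbert multiplier_synth//.
- by congr synth; apply/funext => k; rewrite mulr1.
- by move=> k /=; rewrite mulr1; apply: complex_ext => /=; ring.
- by rewrite sgz0 mulr0 mul0r.
- under eq_fun do rewrite mulr1.
  apply: summable_le su => [|k]; first exact: ler01.
  by rewrite Normc.normcM cnormN mul1r {1}/Normc.normc/= expr0n/= expr1n add0r sqrtr1 mul1r.
Qed.

End Multipliers.

(** * The commutator in Fourier variables at a fixed time *)

Section Slices.
Context {R : realType}.
Implicit Types (z y : nat -> R[i]) (h u psi : R -> R) (n : int).

Let mC := @measurable_circle R.

(** The Wiener algebra property: the coefficients of the product form a convolution, and for each
    mode of [y] the two shifted sums are at most the full l^1 norm of the coefficients of [h]. *)
Lemma modes_mul_summable h y : mean0 h -> summable_seq (modes h) -> summable_seq y ->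
  summable_seq (modes (fun x => h x * synth y x)).
Proof.
move=> [ih h0] sh sy.
pose Z n : \bar R := (cnorm (fourier h n))%:E.
have Z0 n : (0 <= Z n)%E by rewrite lee_fin cnorm_ge0.
pose W : \bar R := (\esum_(n in [set: int]) Z n)%E.
have WE : W = wiener_norm 0%:R h.
  by apply: eq_esum => k _; rewrite powRr0 mul1r.
have [w W0 wE] : exists2 w : R, 0 <= w & W = w%:E.
  have [S S0 SE] := summable_ex sh; exists (2 * S); first by rewrite mulr_ge0.
  rewrite WE wiener_normE// EFinM -SE; congr (_ * _)%E.
  by apply: eq_eseriesr => k _; rewrite mul1r.
have [S S0 SE] := summable_ex sy.
have c0 := ltW (@cth_gt0 R).
pose dif (i k : nat) : int := i.+1%:Z - k.+1%:Z.
pose tot (i k : nat) : int := i.+1%:Z + k.+1%:Z.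
pose B k (i : nat) : \bar R := ((cnorm (y k))%:E * (Z (dif i k) + Z (tot i k)))%E.
have B0 k i : (0 <= B k i)%E by rewrite mule_ge0 ?adde_ge0 ?lee_fin ?cnorm_ge0.
apply: (@le_lt_trans _ _ (\sum_(i <oo) (cth : R)%:E * \sum_(k <oo) B k i)%E).
  apply: lee_nneseries => i *; first by rewrite lee_fin cnorm_ge0.
  rewrite /modes fourier_synthM// Normc.normcM cnormR ger0_norm// EFinM lee_wpmul2l//.
  apply: le_trans (csum_norme _) _; apply: lee_nneseries => k *.
    by rewrite lee_fin cnorm_ge0.
  rewrite /B /Z -EFinD -EFinM lee_fin mulrDr; apply: le_trans (cnormD _ _) _.
  by rewrite !Normc.normcM cnormJ.
rewrite nneseriesZl; last by move=> i _; apply: nneseries_ge0.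
rewrite nneseries_interchange//.
apply: (@le_lt_trans _ _ ((cth : R)%:E * ((2 * w)%:E * S%:E))%E); last by rewrite -!EFinM ltry.
rewrite lee_wpmul2l// -SE -nneseriesZl; last by move=> k _; rewrite lee_fin cnorm_ge0.
apply: lee_nneseries => k *; first exact: nneseries_ge0.
rewrite nneseriesZl; last by move=> i _; rewrite adde_ge0.
rewrite muleC lee_wpmul2r ?lee_fin ?cnorm_ge0//.
rewrite nneseriesD// mulr_natl mulr2n EFinD -wE leeD//.
  by apply: (nneseries_le_esum (f := dif^~ k)) => // i j /addIr[].
by apply: (nneseries_le_esum (f := tot^~ k)) => // i j /addIr[].
Qed.

Lemma synthD y z x : summable_seq y -> summable_seq z ->
  synth (fun k => y k + z k) x = synth y x + synth z x.
Proof.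
move=> sy sz; rewrite /synth -mulrDr -cReD -csumD; try exact: summable_cis.
by congr (_ * cRe _); apply: eq_csum => k; rewrite mulrDl.
Qed.

Lemma synthZ (a : R) y x : summable_seq y ->
  synth (fun k => RC a * y k) x = a * synth y x.
Proof.
move=> sy; rewrite /synth mulrCA -(cReMR a) -csumZ; last exact: summable_cis.
by congr (_ * cRe _); apply: eq_csum => k; rewrite mulrA.
Qed.

Variable nu : R.
Hypothesis nu_gt0 : 0 < nu.

Definition flux h x : R := nu * Lambda 3 h x + Lambda 1 h x.

Lemma wsum4_summable z : (wsum (w4 nu) z < +oo)%E ->
  [/\ summable_seq z, (wsum w1 z < +oo)%E, summable_seq (fun k => RC (lam nu k) * z k),
      summable_seq (fun k => RC (k.+1%:R ^+ 3) * z k) &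
      summable_seq (fun k => RC (k.+1%:R ^+ 1) * z k)].
Proof.
move=> sz.
have key (C : R) (w : nat -> R) : 0 <= C -> (forall k, 0 <= w k) ->
    (forall k, w k <= C * w4 nu k) -> (wsum w z < +oo)%E.
  move=> C0 w_0 wC; apply: (@le_lt_trans _ _ (C%:E * wsum (w4 nu) z)%E); last exact: lte_mul_pinfty.
  rewrite -nneseriesZl//; last by move=> k _; rewrite lee_fin mulr_ge0 ?cnorm_ge0// w4_ge0.
  apply: lee_nneseries => k *; first by rewrite lee_fin mulr_ge0 ?cnorm_ge0.
  by rewrite -EFinM lee_fin mulrA ler_wpM2r ?cnorm_ge0.
have fin (w : nat -> R) : (forall k, 0 <= w k) -> (wsum w z < +oo)%E ->
    summable_seq (fun k => RC (w k) * z k).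
  move=> w_0; apply: le_lt_trans; apply: lee_nneseries => k *; rewrite lee_fin ?cnorm_ge0//.
  by rewrite Normc.normcM cnormR ger0_norm.
have N1 k : 1 <= k.+1%:R :> R by rewrite ler1n.
have lamN k : k.+1%:R <= lam nu k.
  by rewrite /lam lerDr mulr_ge0 ?exprn_ge0// ltW.
have lam0 := lam_ge0 nu_gt0.
have lw4 k : lam nu k <= w4 nu k by rewrite /w4 ler_peMl.
have i1 : (wsum w1 z < +oo)%E.
  apply: (key 1) => // k.
  by rewrite mul1r; apply: le_trans (lw4 k); exact: lamN.
split => //.
- by apply: wsum_summable i1 => k; exact: N1.
- by apply: fin => //; apply: (key 1) => // k; rewrite mul1r.
- apply: fin => [k|]; first exact: exprn_ge0.
  apply: (key nu^-1) => [|k|k]; first by rewrite invr_ge0 ltW.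
    exact: exprn_ge0.
  rewrite -(ler_pM2l nu_gt0) mulVKf ?gt_eqF// (le_trans _ (lw4 k))//.
  by rewrite /lam lerDl.
- by apply: fin => [k|]; rewrite ?exprn_ge0// expr1.
Qed.

Lemma fluxE h : mean0 h -> (wsum (w4 nu) (modes h) < +oo)%E ->
  flux h = synth (fun k => RC (lam nu k) * modes h k).
Proof.
move=> mh /wsum4_summable[sz s1 sl s3 s1']; apply/funext => x.
rewrite /flux !Lambda_synth// -synthZ// -synthD//; last first.
  by apply: summable_le s3 => [|k]; [exact: ltW nu_gt0|rewrite Normc.normcM cnormR gtr0_norm].
congr (synth _ x); apply/funext => k.
by rewrite mulrA -mulrDl -rmorphM -rmorphD expr1.
Qed.

(** [Nl] already contains the outer space derivative, which is undone here: multiplication by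
    [i (n + 1)] returns [Nl]. *)
Definition comm_modes h (n : nat) : R[i] :=
  - Complex 0 1 * RC (n.+1%:R^-1) * Nl nu cth (modes h) (modes h) n.

(* In frequencies, [\hat{[H,f]g}(n) = -2i (2pi)^{-1/2} \sum_{k>0} f^(n+k) conj (g^(k))] for n > 0:
   the contributions of g^(k) f^(n-k) cancel. *)
Lemma comm_synth h : mean0 h -> (wsum (w4 nu) (modes h) < +oo)%E ->
  summable_seq (comm_modes h) /\
  {ae leb R, forall x, circle R x -> hilbert_comm h (flux h) x = synth (comm_modes h) x}.
Proof.
move=> mh s4; set ka := comm_modes h; have [ih h0] := mh; have [sz s1 sl s3 s1'] :=
  wsum4_summable s4.
pose y k := RC (lam nu k) * modes h k.
have sI (z : nat -> R[i]) : summable_seq z -> summable_seq (fun k => - Complex 0 1 * z k).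
  apply: summable_le => [|k]; first exact: ler01.
  by rewrite Normc.normcM cnormN {1}/Normc.normc/= expr0n/= expr1n add0r sqrtr1 mul1r.
have iP := synthM_cintble sl ih.
have sP := modes_mul_summable mh sz sl.
have iS := synthM_cintble (sI _ sl) ih.
have c0 := @cth_gt0 R.
have ska : summable_seq ka.
  apply: (@le_lt_trans _ _ (wsum w1 (Nl nu cth (modes h) (modes h)))).
    apply: lee_nneseries => k *; rewrite lee_fin ?cnorm_ge0//.
    rewrite /ka /comm_modes Normc.normcM ler_wpM2r ?cnorm_ge0// Normc.normcM cnormN cnormR.
    rewrite {1}/Normc.normc/= expr0n/= expr1n add0r sqrtr1 mul1r ger0_norm//.
    by apply: (@le_trans _ _ 1); rewrite ?invf_le1 /w1 ?ler1n.
  have W10 := @w1_ge0 R; have W40 := w4_ge0 nu_gt0.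
  apply: (le_lt_trans (@Nl_bound R nu cth nu_gt0 c0 w1 (w4 nu) w1 (modes h) (modes h) W10 W40 W10
    (weight41 nu_gt0))).
  have /fineK <- : wsum (w4 nu) (modes h) \is a fin_num by rewrite ge0_fin_numE// wsum_ge0.
  have /fineK <- : wsum w1 (modes h) \is a fin_num by rewrite ge0_fin_numE// wsum_ge0.
  by rewrite -!EFinM ltry.
split => //.
have commE : hilbert_comm h (flux h) = fun x =>
    synth (fun k => - Complex 0 1 * modes (fun x => h x * synth y x) k) x -
    h x * synth (fun k => - Complex 0 1 * y k) x.
  have e1 : hilbert (fun x => h x * synth y x) =
      synth (fun k => - Complex 0 1 * modes (fun x => h x * synth y x) k) by exact: hilbert_synth.
  have e2 : hilbert (synth y) = synth (fun k => - Complex 0 1 * y k).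
    by rewrite hilbert_synth ?modes_synth//; exact: synth_cintble.
  by apply/funext => x; rewrite /hilbert_comm fluxE// e1 e2.
have iQ := synth_cintble (sI _ sP).
rewrite commE; apply: modes_ext; [exact: cintbleB|exact: synth_cintble| |].
  rewrite (fourierB 0 iQ iS) (fourier_synth 0 (sI _ sP)) (fourier_synth 0 ska) sub0r.
  rewrite (fourier_synthM 0 (sI _ sl) ih).
  (* The zero mode of the product of h with the transform of its flux vanishes since [lam] is real:
     the two contributions are [- i lam |h_k|^2] and [+ i lam |h_k|^2]. *)
  rewrite (@eq_csum _ _ (fun=> 0)) ?csum0 ?mulr0 ?oppr0// => k.
  rewrite sub0r add0r fourierN// -/(modes h k) /y !conjcM conjcR.
  rewrite (_ : conjc (- Complex 0 1) = Complex 0 1 :> R[i]); last first.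
    by apply: complex_ext => /=; rewrite ?oppr0 ?opprK.
  ring.
apply/funext => n; rewrite (modes_synth ska) {1}/modes (fourierB n.+1%:Z iQ iS).
rewrite (fourier_synth n.+1%:Z (sI _ sP)) (fourier_synthM n.+1%:Z (sI _ sl) ih).
rewrite {1}/modes (fourier_synthM n.+1%:Z sl ih).
have bA k : cnorm (fourier h k) <= cth * \int[leb R]_(x in circle R) `|h x| by exact: fourier_bound.
pose A k := y k * fourier h (n.+1%:Z - k.+1%:Z).
pose B k := conjc (y k) * fourier h (n.+1%:Z + k.+1%:Z).
have sA : summable_seq A.
  rewrite (_ : A = fun k => fourier h (n.+1%:Z - k.+1%:Z) * y k); last by apply/funext => k;
    rewrite mulrC.
  exact: (summableMb (fun k => bA _) sl).
have sB : summable_seq B.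
  rewrite (_ : B = fun k => fourier h (n.+1%:Z + k.+1%:Z) * conjc (y k)); last by apply/funext =>
    k; rewrite mulrC.
  exact: (summableMb (fun k => bA _) (summableJ sl)).
(* With A for the differences of frequencies and B for the sums, the transform of the product
   contributes [- i c (A + B)] and the product with the transform [c (- i A + i B)]: A drops out and
   [- 2 i c B] remains. *)
rewrite (@eq_csum _ (fun k => - Complex 0 1 * y k * _ + _) (fun k => - Complex 0 1 * A k +
  Complex 0 1 * B k)); last first.
  move=> k; rewrite conjcM (_ : conjc (- Complex 0 1) = Complex 0 1 :> R[i]); last first.
    by apply: complex_ext => /=; rewrite ?oppr0 ?opprK.
  by rewrite /A /B !mulrA.
have sIB : summable_seq (fun k => Complex 0 1 * B k).
  apply: summable_le sB => [|k]; first exact: ler01.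
  by rewrite Normc.normcM {1}/Normc.normc/= expr0n/= expr1n add0r sqrtr1 mul1r.
rewrite (csumD (sI _ sA) sIB) (csumZ (- Complex 0 1) sA) (csumZ (Complex 0 1) sB).
have eAB : csum (fun k => y k * fourier h (n.+1%:Z - k.+1%:Z) +
    conjc (y k) * fourier h (n.+1%:Z + k.+1%:Z)) = csum A + csum B := csumD sA sB.
rewrite [X in _ * (_ * X) - _]eAB /ka /comm_modes /Nl.
have -> : csum (bil nu (modes h) (modes h) n) = csum B.
  apply: eq_csum => k; rewrite /bil /B /y conjcM conjcR mulrAC; congr (_ * _).
  by rewrite /modes -PoszD addSn addnS.
have e : RC n.+1%:R^-1 * RC (2 * cth * n.+1%:R) = RC cth + RC cth :> R[i].
  by rewrite -rmorphM -rmorphD; congr (RC _); rewrite mulrC mulfK ?pnatr_eq0//; ring.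
rewrite -[RHS]mulrA [RC n.+1%:R^-1 * _]mulrA e.
move: (csum A) (csum B) (RC cth) (Complex 0 1) => a b c i; ring.
Qed.

(** The spatial side of the weak equation at one time. The derivative sits on the test function,
    where it multiplies modes by [i (k + 1)]; after conjugation it turns [comm_modes] into
    [- Nl]. *)
Lemma slice_pairing h psi dpsi : mean0 h -> (wsum (w4 nu) (modes h) < +oo)%E ->
  cintble psi -> cintble dpsi ->
  (forall k, modes dpsi k = Complex 0 k.+1%:R * modes psi k) ->
  \int[leb R]_(x in circle R) (flux h x * psi x + hilbert_comm h (flux h) x * dpsi x) =
  2 * cRe (csum (fun k => (RC (lam nu k) * modes h k - Nl nu cth (modes h) (modes h) k) *
                          conjc (modes psi k))).
Proof.
move=> mh s4 ip id' dE; have [ska ae] := comm_synth mh s4.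
set ka := comm_modes h in ska ae.
have [sz s1 sl s3 s1'] := wsum4_summable s4; have FF := ae_filter_ringOfSetsType (leb R).
pose y k := RC (lam nu k) * modes h k.
have C (z : nat -> R[i]) (u : R -> R) : summable_seq z -> cintble u -> cintble (fun x => synth z
  x * u x).
  by move=> sy iu; have := synthM_cintble sy iu; under eq_fun do rewrite mulrC.
transitivity (\int[leb R]_(x in circle R) (synth y x * psi x + synth ka x * dpsi x)).
  apply: ae_eq_Rintegral => //; apply: filterS ae => x hx xc.
  by rewrite hx// fluxE.
rewrite RintegralD//; try exact: C.
rewrite !parseval// -mulrDr -cReD -csumD; last 2 first.
- apply: (@summable_le _ _ y (cth * \int[leb R]_(x in circle R) `|psi x|)) => // [|k].
    by rewrite mulr_ge0 ?(ltW cth_gt0)// Rintegral_ge0.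
  by rewrite Normc.normcM cnormJ mulrC ler_wpM2r ?cnorm_ge0// fourier_bound.
- apply: (@summable_le _ _ ka (cth * \int[leb R]_(x in circle R) `|dpsi x|)) => // [|k].
    by rewrite mulr_ge0 ?(ltW cth_gt0)// Rintegral_ge0.
  by rewrite Normc.normcM cnormJ mulrC ler_wpM2r ?cnorm_ge0// fourier_bound.
congr (_ * cRe _); apply: eq_csum => k; rewrite dE (conjcM (Complex 0 k.+1%:R)) [RHS]mulrBl;
  congr (_ + _).
rewrite /ka /comm_modes mulrA -mulNr; congr (_ * _).
rewrite mulrAC -[RHS]mulN1r; congr (_ * _).
have n0 : k.+1%:R != 0 :> R by rewrite pnatr_eq0.
by apply: complex_ext; rewrite /= !(mul0r, mulr0, subr0, sub0r, addr0, add0r, oppr0, mulNr,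
  mulrN, opprK) ?mul1r ?mulVf.
Qed.

End Slices.

(** * Periodic functions and null sets of the line *)

Section PeriodicFunctions.
Context {R : realType}.
Implicit Types (u v : R -> R) (c x : R).

(** Translation invariance, from the uniqueness of the measure that gives half-open intervals their
    length. *)
Lemma lebesgue_negligible_shift c (A : set R) : (leb R).-negligible A ->
  (leb R).-negligible [set x | A (x + c)].
Proof.
move=> [B [mB B0 AB]].
have mf : measurable_fun [set: measurableTypeR R] (fun x : R => (x + c : measurableTypeR R)).
  by apply: (@measurable_funD _ _ R) => //; exact: measurable_cst.
pose f : {mfun measurableTypeR R >-> measurableTypeR R} := @mfun_Sub _ _ (measurableTypeR R)
  (measurableTypeR R) _ (mem_set mf).
exists (f @^-1` B); split; last by move=> x /= /AB.
  by rewrite -[f @^-1` B]setTI; exact: (mf measurableT _ mB).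
apply: etrans B0; apply/esym.
apply: (@lebesgue_measure_unique R (pushforward (leb R) f)) => // X /ocitvP[->|[[p q] /= pq ->]].
  by rewrite !measure0.
rewrite /pushforward (_ : _ @^-1` _ = `]p - c, q - c]%classic); last first.
  apply/seteqP; split => x /=; rewrite !in_itv/= => /andP[? ?].
    by rewrite ltrBlDr lerBrDr; apply/andP.
  by rewrite -ltrBlDr -lerBrDr; apply/andP.
rewrite !lebesgue_measure_itv/= !lte_fin ltrD2r pq -!EFinD; congr (_%:E); ring.
Qed.

Lemma periodic_int u (k : int) x : periodic u (2 * pi) -> u (x + k%:~R * (2 * pi)) = u x.
Proof.
move=> pu; have pn (m : nat) y : u (y + m%:R * (2 * pi)) = u y.
  elim: m y => [|m ih] y; first by rewrite mul0r addr0.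
  by rewrite -natr1 mulrDl mul1r addrA pu ih.
case: k => m; first exact: pn.
rewrite NegzE rmorphN/= mulNr; rewrite -[in RHS](subrK (m.+1%:R * (2 * pi)) x).
exact/esym/pn.
Qed.

(** Fourier arguments control one period while the equalities sought are on the line; countably many
    translates of one null set cover the exceptional points. *)
Lemma periodic_ae u v : periodic u (2 * pi) -> periodic v (2 * pi) ->
  {ae leb R, forall x, circle R x -> u x = v x} -> {ae leb R, forall x, u x = v x}.
Proof.
move=> pu pv; set A := ~` [set x | circle R x -> u x = v x] => nA.
have p0 := @pi2_gt0 R.
pose S (j : nat) (s : bool) : set R := [set x | A (x + (if s then j%:R else - j%:R) * (2 * pi))].
apply: (@negligibleS _ _ _ (leb R) (\bigcup_j (S j true `|` S j false))); last first.
  by apply: negligible_bigcup => j; apply: negligibleU; exact: lebesgue_negligible_shift.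
move=> x /= uvx.
pose k := Num.floor (x / (2 * pi)).
have [kx xk] : k%:~R * (2 * pi) <= x /\ x < (k + 1)%:~R * (2 * pi).
  by rewrite -ler_pdivlMr// -ltr_pdivrMr// ge_floor floorD1_gt.
have : A (x - k%:~R * (2 * pi)).
  rewrite /A/= => h; apply: uvx.
  have e (w : R -> R) : periodic w (2 * pi) -> w x = w (x - k%:~R * (2 * pi)).
    by move=> pw; rewrite -(periodic_int (- k) x pw) rmorphN mulNr.
  rewrite (e u)// (e v)// h// /circle/= in_itv/= subr_ge0 kx lerBlDr.
  by move: xk; rewrite rmorphD mulrDl mul1r addrC => /ltW.
case: k {kx xk} => m Ax.
  by exists m => //; right; rewrite /S/= mulNr.
exists m.+1 => //; left; rewrite /S/=; move: Ax.
by rewrite NegzE rmorphN mulNr opprK.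
Qed.

End PeriodicFunctions.

(** * Mild solutions are weak solutions *)

Section VectorMeasure.
Context {R : realType}.
Local Open Scope ereal_scope.

Lemma measurable_half_line : measurable (half_line R).
Proof. exact: measurable_itv. Qed.

Lemma half_line_ge0 t : half_line R t = (0 <= t)%R :> Prop.
Proof. by rewrite /half_line/= in_itv/= andbT. Qed.

Lemma half_lineE : half_line R = \bigcup_n `[0%R, n%:R]%classic.
Proof.
rewrite /half_line itv_bndy_bigcup_BRight; apply: eq_bigcupr => n _.
by rewrite add0r.
Qed.

Lemma half_line_bound (g : R -> \bar R) (B : \bar R) : measurable_fun setT g ->
  (forall t, 0 <= g t) ->
  (forall T, (0 <= T)%R -> \int[leb R]_(t in `[0%R, T]) g t <= B) ->
  \int[leb R]_(t in half_line R) g t <= B.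
Proof.
move=> mg g0 gB; rewrite half_lineE.
have h : \int[leb R]_(t in `[0%R, n%:R]%classic) g t @[n --> \oo] -->
    \int[leb R]_(t in \bigcup_n `[0%R, n%:R]%classic) g t.
  apply: ge0_nondecreasing_set_cvg_integral => //.
  - move=> n m nm; apply/subsetPset => t /=; rewrite !in_itv/= => /andP[-> tn].
    by rewrite (le_trans tn)// ler_nat.
  - by move=> n; exact: measurable_funTS.
rewrite -(cvg_lim _ h)//; apply: lime_le; first by apply/cvg_ex; eexists; exact: h.
by near=> n; exact: gB.
Unshelve. all: by end_near.
Qed.

Variables (a : nat -> R -> R[i]) (K : R).
Hypothesis ma : forall n (D : set R), measurable D -> cmeas D (a n).
Let phi t := wsum (wpow 4) (a^~ t).
Hypothesis aK : \int[leb R]_(t in half_line R) phi t <= K%:E.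

Let phi0 t : 0 <= phi t. Proof. by apply: wsum_ge0 => k; exact: wpow_ge0. Qed.

Let mphi (D : set R) : measurable D -> measurable_fun D phi.
Proof. by move=> mD; apply: measurable_wsum => [k|n]; [exact: wpow_ge0|exact: ma]. Qed.

Let phiK (E : set R) : measurable E -> E `<=` half_line R -> \int[leb R]_(t in E) phi t <= K%:E.
Proof.
move=> mE EH; apply: le_trans aK; apply: ge0_subset_integral => //.
- exact: measurable_half_line.
- exact: mphi measurable_half_line.
Qed.

Definition tmodes (E : set R) n : R[i] := cint (leb R) E (a n).

Lemma tmodes_integrable (E : set R) n : measurable E -> E `<=` half_line R ->
  cintegrable (leb R) E (a n).
Proof.
move=> mE EH; apply/cintegrableP => //; split; first exact: ma.
apply: (@le_lt_trans _ _ K%:E); last exact: ltry.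
apply: le_trans (phiK mE EH); apply: ge0_le_integralW => t _; rewrite ?lee_fin ?cnorm_ge0//.
apply: le_trans (wsum_term _ n (wpow_ge0 (R := R) 4)).
by rewrite lee_fin ler_peMl ?cnorm_ge0// wpow_ge1.
Qed.

Lemma tmodes_wsum (E : set R) : measurable E -> E `<=` half_line R ->
  wsum (wpow 4) (tmodes E) <= \int[leb R]_(t in E) phi t.
Proof.
move=> mE EH; rewrite /phi integral_wsum//; last 2 first.
- by move=> k; exact: wpow_ge0.
- by move=> n; exact: ma.
apply: lee_nneseries => k *; first by rewrite lee_fin mulr_ge0 ?cnorm_ge0 ?wpow_ge0.
rewrite EFinM lee_wpmul2l ?lee_fin ?wpow_ge0//.
by apply: (@cint_norme _ _ R (leb R)) => //; exact: tmodes_integrable.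
Qed.

Lemma tmodes_fin (E : set R) : measurable E -> E `<=` half_line R ->
  wsum (wpow 4) (tmodes E) < +oo.
Proof.
move=> mE EH; apply: le_lt_trans (tmodes_wsum mE EH) _.
exact: le_lt_trans (phiK mE EH) (ltry _).
Qed.

Lemma tmodes_summable (E : set R) : measurable E -> E `<=` half_line R ->
  summable_seq (tmodes E).
Proof.
by move=> mE EH; apply: wsum_summable (tmodes_fin mE EH) => k; exact: wpow_ge1.
Qed.

Lemma wiener_norm_tmodes (E : set R) : measurable E -> E `<=` half_line R ->
  wiener_norm 4%:R (synth (tmodes E)) <= 2%:E * \int[leb R]_(t in E) phi t.
Proof.
move=> mE EH; have sE := tmodes_summable mE EH.
rewrite wiener_normE; [|exact: synth_cintble|by rewrite fourier_synth].
by rewrite modes_synth// lee_wpmul2l// tmodes_wsum.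
Qed.

Lemma tmodesU (E F : set R) : measurable E -> measurable F ->
  E `<=` half_line R -> F `<=` half_line R -> [disjoint E & F] ->
  forall n, tmodes (E `|` F) n = (tmodes E n + tmodes F n)%R.
Proof.
move=> mE mF EH FH EF n.
have [i1 i2] : cintegrable (leb R) (E `|` F) (a n).
  by apply: tmodes_integrable; [exact: measurableU|rewrite subUset].
by rewrite /tmodes /cint !Rintegral_setU.
Qed.

(** Up to a factor 2 the integral of [phi] over E dominates the A^4 norm of the value on E.
    Finiteness of the total integral then gives bounded variation and, through the tail of a
    convergent series, countable additivity. *)
Lemma wiener_vmeasure_synth : wiener_vmeasure 4%:R (fun E => synth (tmodes E)).
Proof.
split.
- by move=> E mE EH; apply: wiener_synth; exact: tmodes_fin.
- move=> F mF FH tF.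
  pose U n := \bigcup_k F (k + n)%N.
  have mU n : measurable (U n) by apply: bigcupT_measurable.
  have UH n : U n `<=` half_line R by apply: bigcup_sub => k _; exact: FH.
  have US n : U n = F n `|` U n.+1.
    apply/seteqP; split => [t [[|k] _ Ft]|t [Ft|[k _ Ft]]].
    - by left; move: Ft; rewrite add0n.
    - by right; exists k => //; move: Ft; rewrite addSnnS.
    - by exists 0%N => //; rewrite add0n.
    - by exists k.+1 => //; rewrite addSnnS.
  have dFU n : [disjoint F n & U n.+1].
    apply/disj_setPS => t [Fn [k _ Fk]].
    have /eqP := tF n (k + n.+1)%N I I (ex_intro _ t (conj Fn Fk)).
    by rewrite addnS -addSn -[X in X == _]add0n eqn_add2r.
  (* What remains after n sets is the value on the union of the later ones, as an identity of
     functions at every point. *)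
  have UE n : (fun x => synth (tmodes (\bigcup_i F i)) x - \sum_(i < n) synth (tmodes (F i)) x)%R =
      synth (tmodes (U n)).
    have -> : \bigcup_i F i = U 0%N by apply: eq_bigcupr => k _; rewrite addn0.
    elim: n => [|n ih]; apply/funext => x; first by rewrite big_ord0 subr0.
    rewrite big_ord_recr/= opprD addrA; have := congr1 (fun f => f x) ih; rewrite /= => ->.
    have -> : tmodes (U n) = fun k => (tmodes (F n) k + tmodes (U n.+1) k)%R.
      by apply/funext => k; rewrite US tmodesU.
    by rewrite synthD; [rewrite addrAC subrr add0r|exact: tmodes_summable..].
  under eq_fun do rewrite UE.
  have tail : 2%:E * \sum_(n <= k <oo) (\int[leb R]_(t in F k) phi t) @[n --> \oo] --> 2%:E * 0.
    apply: cvgeZl => //; apply: nneseries_tail_cvg => [|k _]; last exact: integral_ge0.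
    rewrite -ge0_integral_bigcup//; last by apply: mphi; apply: bigcupT_measurable.
    apply: le_lt_trans (phiK _ _) (ltry K); first by apply: bigcupT_measurable.
    by apply: bigcup_sub => k _; exact: FH.
  rewrite mule0 in tail; apply: squeeze_cvge (cvg_cst _) tail.
  near=> n; rewrite esum_ge0/=; last by move=> k _; rewrite lee_fin mulr_ge0 ?powR_ge0 ?cnorm_ge0.
  apply: le_trans (wiener_norm_tmodes (mU n) (UH n)) _.
  rewrite lee_wpmul2l// ge0_integral_bigcup//; last 3 first.
  - by move=> k; exact: mF.
  - exact: mphi (mU n).
  - move=> i j _ _ [t [Fi Fj]]; have /eqP := tF _ _ I I (ex_intro _ t (conj Fi Fj)).
    by rewrite eqn_add2r => /eqP.
  rewrite (@nneseries_addn R (fun i => \int[leb R]_(x in F i) phi x) n)// => i.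
  exact: integral_ge0.
- exists (2 * K)%R => n F mF FH tF.
  apply: (@le_trans _ _ (\sum_(i < n) 2%:E * \int[leb R]_(t in F i) phi t)).
    by apply: lee_sum => i _; exact: wiener_norm_tmodes.
  rewrite -ge0_sume_distrr; last by move=> i _; exact: integral_ge0.
  rewrite EFinM lee_wpmul2l// -ge0_integral_bigsetU//; last 3 first.
  - exact: index_enum_uniq.
  - by move=> i j _ _; exact: tF.
  - by apply: mphi; apply: bigsetU_measurable.
  apply: phiK; first exact: bigsetU_measurable.
  by elim/big_rec: _ => [t []|i D _ DH t [/FH|/DH]].
Unshelve. all: by end_near.
Qed.

Lemma in_wiener_vmeasure_synth :
  (forall t, (0 <= t)%R -> summable_seq (a^~ t)) ->
  in_wiener_vmeasure 4%:R (fun t => synth (a^~ t)).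
Proof.
move=> sa; exists (fun E => synth (tmodes E)); split; first exact: wiener_vmeasure_synth.
move=> T E mE ET n.
have EH : E `<=` half_line R.
  by move=> t /ET; rewrite /half_line/= !in_itv/= andbT => /andP[].
have E0 t : E t -> summable_seq (a^~ t).
  by move=> /EH; rewrite half_line_ge0; exact: sa.
rewrite fourier_synth; last exact: tmodes_summable.
rewrite -[cintegral _ _]/(cint (leb R) E (fun t => fourier (synth (a^~ t)) n)).
case: n => [[|k]|k].
- by rewrite (@eq_cint _ _ _ (leb R) _ _ (fun=> 0%R)) ?cint0// => t Et; rewrite fourier_synth//;
  exact: E0.
- by apply: eq_cint => t Et; rewrite fourier_synth//; exact: E0.
- rewrite -cintJ//; last exact: tmodes_integrable.
  by apply: eq_cint => t Et; rewrite fourier_synth//; exact: E0.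
Qed.

End VectorMeasure.

Section SynthesisBounds.
Context {R : realType}.

Lemma synthB (y z : nat -> R[i]) x : summable_seq y -> summable_seq z ->
  synth (fun k => y k - z k) x = synth y x - synth z x.
Proof.
move=> sy sz; rewrite /synth -mulrBr -cReN -cReD -csumB; try exact: summable_cis.
by congr (_ * cRe _); apply: eq_csum => k; rewrite mulrBl.
Qed.

Lemma synth_pairing_bound (z : nat -> R[i]) (psi : R -> R) (S : R) : cintble psi ->
  (\sum_(n <oo) (cnorm (z n))%:E <= S%:E)%E ->
  `|\int[leb R]_(x in circle R) (synth z x * psi x)| <=
    2 * cth * S * \int[leb R]_(x in circle R) `|psi x|.
Proof.
move=> ip zS; have sz : summable_seq z by exact: le_lt_trans zS (ltry _).
have iz : cintble (fun x => synth z x * psi x).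
  by have := synthM_cintble sz ip; under eq_fun do rewrite mulrC.
have mC := @measurable_circle R.
have ian : cintble (fun x => `|psi x|) by exact: (integrable_norm ip).
have hz := @le_normr_Rintegral _ _ R (leb R) _ _ mC iz; apply: (le_trans hz).
rewrite -RintegralZl//; apply: le_Rintegral => //; first exact: (integrable_norm iz).
  exact: cintbleZ.
by move=> x _; rewrite normrM ler_wpM2r// synth_bound.
Qed.

End SynthesisBounds.

(** * Regularity in time of the constructed solution *)

Section MildSolution.
Context {R : realType}.
Variables (nu : R) (al : nat -> R[i]) (a : nat -> R -> R[i]).
Hypotheses (nu_gt0 : 0 < nu) (hm : mild nu cth al a) (hE : EN_le nu a 2^-1).
Let f t := synth (a^~ t).
Let c_gt0 := @cth_gt0 R.
Let c_lt := @cth_lt R.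

Lemma mild_wsum1 t : 0 <= t -> (wsum w1 (a^~ t) <= (2^-1)%:E)%E.
Proof. exact: (EN_le1 nu_gt0 hE). Qed.

Lemma mild_summable t : 0 <= t -> summable_seq (a^~ t).
Proof.
move=> t0; apply: (@wsum_summable _ w1) => [k|]; first by rewrite ler1n.
exact: le_lt_trans (mild_wsum1 t0) (ltry _).
Qed.

Lemma wiener_norm1_synth (z : nat -> R[i]) : (wsum w1 z < +oo)%E ->
  wiener_norm 1 (synth z) = (2%:E * wsum w1 z)%E.
Proof.
move=> wz; have sz : summable_seq z.
  by apply: (@wsum_summable _ w1) wz => k; rewrite ler1n.
have := @wiener_normE R 1 _ (synth_cintble sz); rewrite fourier_synth// modes_synth//.
by move=> /(_ erefl) ->.
Qed.

Lemma mild_wiener t : 0 <= t -> wiener 1 (f t).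
Proof.
move=> t0; apply: (@wiener_synth R 1); exact: le_lt_trans (mild_wsum1 t0) (ltry _).
Qed.

Lemma mild_dist : exists G : R -> R, continuous G /\
  forall t' t, 0 <= t' -> t' <= t ->
    (wsum w1 (fun n => (a n t - a n t')%R) <= (G t - G t')%:E)%E.
Proof. by apply: (mild_modulus nu_gt0 c_gt0 hm hE); rewrite invr_ge0. Qed.

Definition tgrid (j : nat) (t : R) : R := (Num.truncn (t * j.+1%:R))%:R / j.+1%:R.

Lemma tgrid_itv j t : 0 <= t -> [/\ 0 <= tgrid j t, tgrid j t <= t & t - tgrid j t <= j.+1%:R^-1].
Proof.
move=> t0; have N0 : 0 < j.+1%:R :> R by [].
have /andP[h1 h2] : (Num.truncn (t * j.+1%:R))%:R <= t * j.+1%:R < (Num.truncn (t * j.+1%:R)).+1%:R.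
  by apply: truncn_itv; rewrite mulr_ge0.
split; rewrite /tgrid.
- by rewrite divr_ge0.
- by rewrite ler_pdivrMr.
- by rewrite -(ler_pM2r N0) mulrBl divfK ?gt_eqF// mulVf ?gt_eqF// lerBlDl natr1 ltW.
Qed.

Lemma tgrid_cvg t : 0 <= t -> tgrid j t @[j --> \oo] --> t.
Proof.
move=> t0; apply: (@squeeze_cvgr _ _ _ _ (fun j => t - harmonic j) (cst t)).
- near=> j; have [_ h1 h2] := tgrid_itv j t0; rewrite h1 andbT.
  by rewrite lerBlDl -lerBlDr.
- rewrite -[X in _ --> X]subr0; apply: cvgB; [exact: cvg_cst|exact: cvg_harmonic].
- exact: cvg_cst.
Unshelve. all: by end_near.
Qed.

(** The simple functions freeze the solution at the left ends of cells of length [1 / (j + 1)]. The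
    cells cover [[0, j + 1[], which contains t for large j, and the error is controlled by the
    increment of the modulus G from the left end of the cell to t. *)
Lemma mild_wiener_measurable : wiener_measurable 1 f.
Proof.
pose E j (i : 'I_(j.+1 * j.+1)) : set R := `[i%:R / j.+1%:R, i.+1%:R / j.+1%:R[%classic.
exists (fun j t x => \sum_(i < j.+1 * j.+1) \1_(E j i) t * f (i%:R / j.+1%:R) x); split.
  move=> j; exists (j.+1 * j.+1)%N, (E j), (fun i => f (i%:R / j.+1%:R)); split => // i.
    exact: measurable_itv.
  by apply: mild_wiener; rewrite divr_ge0.
have [G [cG hG]] := mild_dist.
move=> t t0.
have lim0 : (2%:E * (G t - G (tgrid j t))%:E)%E @[j --> \oo] --> 0%E.
  rewrite -(mule0 2%:E); apply: cvgeZl => //; apply: cvg_EFin; first by near=> j.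
  rewrite -[X in _ --> X](subrr (G t)); apply: cvgB; first exact: cvg_cst.
  by apply: continuous_cvg; [exact: cG|exact: tgrid_cvg].
apply: squeeze_cvge (cvg_cst _) lim0.
near=> j; have [g0 gt _] := tgrid_itv j t0.
rewrite esum_ge0/=; last by move=> k _; rewrite lee_fin mulr_ge0 ?powR_ge0 ?cnorm_ge0.
have tj : t < j.+1%:R.
  have : t < j%:R by near: j; exact: nbhs_infty_gtr.
  by move=> /lt_trans; apply; rewrite ltr_nat.
have N0 : 0 < j.+1%:R :> R by [].
have /andP[h1 h2] : (Num.truncn (t * j.+1%:R))%:R <= t * j.+1%:R < (Num.truncn (t * j.+1%:R)).+1%:R.
  by apply: truncn_itv; rewrite mulr_ge0.
have iN : (Num.truncn (t * j.+1%:R) < j.+1 * j.+1)%N.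
  by rewrite -(ltr_nat R) (le_lt_trans h1)// natrM ltr_pM2r.
rewrite (_ : (fun x => _) = synth (fun k => a k t - a k (tgrid j t))); last first.
  apply/funext => x; rewrite (bigD1 (Ordinal iN))//= big1 ?addr0; last first.
    move=> i ni; rewrite indicE memNset ?mul0r// /E/= in_itv/= ler_pdivrMr// ltr_pdivlMr//.
    move=> /andP[i1 i2]; move/negP: ni; apply; apply/eqP/val_inj => /=.
    apply/eqP; rewrite eqn_leq; apply/andP; split.
      by have := le_lt_trans i1 h2; rewrite ltr_nat ltnS.
    by have := le_lt_trans h1 i2; rewrite ltr_nat ltnS.
  rewrite indicE mem_set ?mul1r; last first.
    by rewrite /E/= in_itv/= ler_pdivrMr// ltr_pdivlMr// h1 h2.
  by rewrite synthB//; exact: mild_summable.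
have hd := hG _ _ g0 gt.
by rewrite wiener_norm1_synth ?lee_wpmul2l//; exact: le_lt_trans hd (ltry _).
Unshelve. all: by end_near.
Qed.

Lemma mild_wiener_norm1 t : 0 <= t ->
  (wiener_norm 1 (f t) <= 2%:E * wsum w1 al)%E.
Proof.
move=> t0; rewrite wiener_norm1_synth; last exact: le_lt_trans (mild_wsum1 t0) (ltry _).
by rewrite lee_wpmul2l//; apply: (mild_A1 nu_gt0 c_gt0 c_lt hm hE t0).
Qed.

Lemma mild_Linfty : Linfty_wiener 1 f.
Proof.
split; [exact: mild_wiener|exact: mild_wiener_measurable|].
exists 1; apply: aeW => t t0.
rewrite wiener_norm1_synth; last exact: le_lt_trans (mild_wsum1 t0) (ltry _).
apply: (@le_trans _ _ (2%:E * (2^-1)%:E)%E); first by rewrite lee_wpmul2l// mild_wsum1.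
by rewrite -EFinM divff// pnatr_eq0.
Qed.

Lemma mild_vmeasure : in_wiener_vmeasure 4 f.
Proof.
have W4 := w4_ge0 nu_gt0.
(* The constant: [nu (k + 1)^4 <= w4 nu k], and the total dissipation is at most 1/2. *)
apply: (@in_wiener_vmeasure_synth R a (nu^-1 * 2^-1)) => [n D mD||]; last exact: mild_summable.
  exact: (mild_cmeas n mD hm).
apply: half_line_bound.
- apply: measurable_wsum => [k|n]; first exact: wpow_ge0.
  exact: (mild_cmeas n measurableT hm).
- by move=> t; apply: wsum_ge0 => k; exact: wpow_ge0.
move=> T T0; apply: (@le_trans _ _ (\int[leb R]_(t in `[0%R, T]) (nu^-1%:E * wsum (w4 nu) (a^~
  t)))%E).
  apply: ge0_le_integralW => t _; first by apply: wsum_ge0 => k; exact: wpow_ge0.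
  rewrite -nneseriesZl//; last by move=> k _; rewrite lee_fin mulr_ge0 ?cnorm_ge0.
  apply: lee_nneseries => k *; first by rewrite lee_fin mulr_ge0 ?cnorm_ge0 ?wpow_ge0.
  rewrite -EFinM lee_fin mulrA ler_wpM2r ?cnorm_ge0// /wpow /w4 /lam.
  rewrite mulrDr mulrDr [k.+1%:R * (nu * _)]mulrCA mulKf ?gt_eqF// -exprS lerDl.
  by rewrite mulr_ge0 ?invr_ge0 ?mulr_ge0// ltW.
rewrite ge0_integralZl ?lee_fin ?invr_ge0 ?(ltW nu_gt0)//; last 2 first.
- apply: measurable_wsum => // n; apply: (mild_cmeas n _ hm); exact: measurable_itv.
- by move=> t _; exact: wsum_ge0.
by rewrite EFinM lee_wpmul2l ?lee_fin ?invr_ge0 ?(ltW nu_gt0)//; exact: (EN_le4 hE).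
Qed.

(** The pairing with psi is bounded by the sum of the norms of the modes, whose increments are at
    most those of the modulus G; continuity within the half line is obtained by composing with
    [max t 0]. *)
Lemma mild_weakly_continuous : weakly_continuous f.
Proof.
move=> psi [spsi _]; have [cpsi _] := spsi [::]; rewrite /= in cpsi.
have ip : cintble psi by exact: cintble_continuous.
have [G [cG hG]] := mild_dist.
pose F t := \int[leb R]_(x in circle R) (f t x * psi x).
pose C := 2 * cth * \int[leb R]_(x in circle R) `|psi x|.
have C0 : 0 <= C by rewrite !mulr_ge0 ?(ltW c_gt0)// Rintegral_ge0.
have iF t : 0 <= t -> cintble (fun x => f t x * psi x).
  move=> t0; have := synthM_cintble (mild_summable t0) ip.
  by under eq_fun do rewrite mulrC.
have key t' t : 0 <= t' -> t' <= t -> `|F t - F t'| <= C * `|G t - G t'|.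
  move=> t'0 tt'; have t0 := le_trans t'0 tt'.
  have hd := hG _ _ t'0 tt'.
  have i1 := iF _ t0; have i2 := iF _ t'0.
  have mC := @measurable_circle R; rewrite /F -RintegralB//.
  rewrite (_ : \int[leb R]_(x in circle R) (f t x * psi x - f t' x * psi x) =
      \int[leb R]_(x in circle R) (synth (fun k => a k t - a k t') x * psi x)); last first.
    apply: eq_Rintegral => x _; rewrite synthB ?mulrBl//; exact: mild_summable.
  apply: le_trans (@synth_pairing_bound _ _ _ (G t - G t') ip _) _.
    apply: le_trans hd; apply: lee_nneseries => k *; rewrite lee_fin ?cnorm_ge0//.
    by rewrite ler_peMl ?cnorm_ge0// /w1 ler1n.
  by rewrite /C mulrAC ler_wpM2l// ler_norm.
have cmax : continuous (fun t : R => Num.max t 0).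
  by move=> t; apply: continuous_max; [exact: cvg_id|exact: cvg_cst].
have m0 (t : R) : 0 <= Num.max t 0 by rewrite le_max lexx orbT.
have cF : continuous (fun t : R => F (Num.max t 0)).
  move=> t; apply/cvgrPdist_le => e e0.
  have C1 : 0 < e / (C + 1) by rewrite divr_gt0// ltr_wpDl.
  have cGm : continuous (fun t : R => G (Num.max t 0)).
    by move=> s; apply: (continuous_comp (cmax s)); exact: cG.
  have /cvgrPdist_le/(_ _ C1) := cGm t.
  apply: filterS => s hs.
  apply: (@le_trans _ _ (C * `|G (Num.max t 0) - G (Num.max s 0)|)).
    have [st|/ltW ts] := leP (Num.max s 0) (Num.max t 0); first exact: key.
    by rewrite distrC [X in _ * X]distrC; exact: key.
  apply: (@le_trans _ _ (C * (e / (C + 1)))); first by rewrite ler_wpM2l.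
  by rewrite mulrCA ler_piMr ?(ltW e0)// ler_pdivrMr ?ltr_wpDl// mul1r lerDl.
apply: (@subspace_eq_continuous _ _ _ (fun t : R => F (Num.max t 0))); last exact:
  continuous_subspaceT.
by move=> t; rewrite inE half_line_ge0 => t0; rewrite /F max_l.
Qed.

End MildSolution.

(** * Integrals depending on a parameter *)

Section ParametricIntegrals.
Context {R : realType}.
Implicit Types (F : R^o * R^o -> R^o) (w : R -> R).

Let mC := @measurable_circle R.

Lemma continuous_slice F t : continuous F -> continuous (fun x : R => F (t, x) : R).
Proof.
move=> cF x; apply: (@continuous_comp _ _ _ (fun x : R^o => (t, x) : R^o * R^o) F); last exact: cF.
exact: (cvg_pair (cvg_cst t) cvg_id).
Qed.

Lemma continuous_slice1 F x : continuous F -> continuous (fun t : R => F (t, x) : R).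
Proof.
move=> cF t; apply: (@continuous_comp _ _ _ (fun t : R^o => (t, x) : R^o * R^o) F); last exact: cF.
exact: (cvg_pair cvg_id (cvg_cst x)).
Qed.

(** Compactness of the rectangle provides the constant that dominates the integrands when passing to
    the limit or differentiating under the integral. *)
Lemma rectangle_bounded F (p q : R) : continuous F ->
  exists2 M, 0 <= M & forall t x, p <= t <= q -> circle R x -> `|F (t, x)| <= M.
Proof.
move=> cF.
have cpt : compact (`[p, q]%classic `*` circle R : set (R^o * R^o)).
  by apply: compact_setX; exact: segment_compact.
have /(continuous_compact (continuous_subspaceT cF)) /compact_bounded [B [_ hB]] := cpt.
exists (`|B| + 1) => [|t x tpq xc]; first by rewrite addr_ge0.
apply: (hB (`|B| + 1)); first by rewrite ltr_pwDr// ler_norm.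
by exists (t, x) => //; split => //=; rewrite in_itv.
Qed.

Lemma cintM_bound F w (p q : R) : continuous F -> continuous w ->
  exists2 M, 0 <= M & forall t x, p <= t <= q -> circle R x -> `|F (t, x) * w x| <= M.
Proof.
move=> cF cw; have cG : continuous (fun z : R^o * R^o => F z * w z.2 : R^o).
  move=> z; apply: cvgM; first exact: cF.
  by apply: (@continuous_comp _ _ _ snd w); [exact: cvg_snd|exact: cw].
have [M M0 hM] := rectangle_bounded p q cG.
by exists M.
Qed.

Lemma in_nbhs_itv (t : R) : `]t - 1, t + 1[%classic t.
Proof. by rewrite /= in_itv/= ltrBlDr ltrDl ltr01. Qed.

Lemma slice_cintble F w t : continuous F -> continuous w ->
  cintble (fun x => F (t, x) * w x).
Proof.
move=> cF cw; apply: cintble_continuous => x.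
by apply: cvgM; [exact: continuous_slice|exact: cw].
Qed.

Lemma continuous_param F w : continuous F -> continuous w ->
  continuous (fun t : R => \int[leb R]_(x in circle R) (F (t, x) * w x)).
Proof.
move=> cF cw t.
have [M M0 hM] := cintM_bound (t - 1) (t + 1) cF cw.
have := @continuity_under_integral R _ _ (leb R) (fun t x => F (t, x) * w x) (circle R) mC
  (t - 1) (t + 1) _ _ (cst M) (cintble_cst M) _.
apply; last exact/mem_set/in_nbhs_itv.
- by move=> s _; exact: slice_cintble.
- have cts (y : R) : continuous (fun t : R => F (t, y) * w y).
    by move=> s; apply: cvgM; [exact: continuous_slice1|exact: cvg_cst].
  by apply: aeW => x _ s _; exact: (cts x).
- move=> s; rewrite /= in_itv/= => /andP[s1 s2]; apply: aeW => x xc.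
  by apply: hM => //; rewrite !ltW.
Qed.

Lemma derive_param F F1 w t : continuous F -> continuous F1 -> continuous w ->
  (forall s x, is_derive (s : R^o) 1 (fun s : R^o => F (s, x)) (F1 (s, x))) ->
  is_derive (t : R^o) 1 (fun s : R^o => \int[leb R]_(x in circle R) (F (s, x) * w x) : R^o)
    (\int[leb R]_(x in circle R) (F1 (t, x) * w x)).
Proof.
move=> cF cF1 cw dF.
have [M M0 hM] := cintM_bound (t - 1) (t + 1) cF1 cw.
have dFw s x : is_derive (s : R^o) 1 (fun s : R^o => F (s, x) * w x : R^o) (F1 (s, x) * w x).
  have := dF s x => d; apply: is_derive_eq.
  by rewrite /GRing.scale/= mulr0 add0r mulrC.
have p1 x s : (partial1of2 (fun t x => F (t, x) * w x)) s x = F1 (s, x) * w x.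
  by rewrite partial1of2E; have /@derive_val := dFw s x.
have int s : `]t - 1, t + 1[%classic s -> (leb R).-integrable (circle R) (EFin \o (fun x => F (s,
  x) * w x)).
  by move=> _; exact: slice_cintble.
have der s x : `]t - 1, t + 1[%classic s -> circle R x -> derivable (fun t : R^o => F (t, x) * w
  x : R^o) s 1.
  by move=> _ _; have /@ex_derive := dFw s x.
have ub s x : `]t - 1, t + 1[%classic s -> circle R x ->
    `|(partial1of2 (fun t x => F (t, x) * w x)) s x| <= cst M x.
  move=> + xc; rewrite p1 /= in_itv/= => /andP[s1 s2].
  by apply: hM => //; rewrite !ltW.
have D := @derivable_under_integral R _ _ (leb R) (fun t x => F (t, x) * w x) (circle R) mC
  t (t - 1) (t + 1) (in_nbhs_itv t) int der (cst M) (fun=> M0) (cintble_cst M) ub.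
have E := @differentiation_under_integral R _ _ (leb R) (fun t x => F (t, x) * w x) (circle R) mC
  t (t - 1) (t + 1) (in_nbhs_itv t) int der (cst M) (fun=> M0) (cintble_cst M) ub.
split => //; rewrite -derive1E E; apply: eq_Rintegral => x _; exact: p1.
Qed.

End ParametricIntegrals.

(** * Modes of test functions *)

Section TestFunctions.
Context {R : realType}.

Let mC := @measurable_circle R.

Lemma modesRe (u : R -> R) k : cintble u ->
  cRe (modes u k) = cth * \int[leb R]_(x in circle R) (u x * cos (k.+1%:R * x)).
Proof.
move=> iu; have := fourier_cos k.+1%:Z iu; rewrite -[_%:~R]/(k.+1%:R) => ->.
by rewrite mulVKf// lt0r_neq0// cth_gt0.
Qed.

Lemma modesIm (u : R -> R) k : cintble u ->
  cIm (modes u k) = - (cth * \int[leb R]_(x in circle R) (u x * sin (k.+1%:R * x))).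
Proof.
move=> iu; have := fourier_sin k.+1%:Z iu; rewrite -[_%:~R]/(k.+1%:R) => ->.
by rewrite mulrN mulVKf ?opprK// lt0r_neq0// cth_gt0.
Qed.

Lemma FTC_full (u du : R -> R) (p q : R) : p <= q -> continuous du ->
  (forall x, is_derive (x : R^o) 1 (u : R^o -> R^o) (du x)) ->
  \int[leb R]_(x in `[p, q]) du x = u q - u p.
Proof.
rewrite le_eqVlt => /predU1P[->|pq] cdu hd; first by rewrite set_itv1 Rintegral_set1 subrr.
have cu : continuous (u : R -> R).
  by move=> x; apply: differentiable_continuous; apply/derivable1_diffP; have /@ex_derive := hd x.
rewrite /Rintegral (@continuous_FTC2 _ _ u)//.
- exact: continuous_subspaceT.
- split=> [x _||]; first by have /@ex_derive := hd x.
    by apply: cvg_at_right_filter; exact: cu.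
  by apply: cvg_at_left_filter; exact: cu.
- by move=> x _; rewrite derive1E; have /@derive_val := hd x.
Qed.

(** Integration by parts against sine and cosine; the equal values at the ends of the period remove
    the boundary terms. *)
Lemma modes_derive (psi dpsi : R -> R) k : continuous dpsi ->
  (forall x, is_derive (x : R^o) 1 (psi : R^o -> R^o) (dpsi x)) -> psi 0 = psi (2 * pi) ->
  modes dpsi k = Complex 0 k.+1%:R * modes psi k.
Proof.
move=> cd hd per; set N : R := k.+1%:R.
have cpsi : continuous psi.
  by move=> x; apply: differentiable_continuous; apply/derivable1_diffP; have /@ex_derive := hd x.
have [cc cs] := @cis_ccont R N.
have ip := cintble_continuous cpsi; have id' := cintble_continuous cd.
have ccM (u w : R -> R) : continuous u -> continuous w -> continuous (fun x => u x * w x).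
  by move=> cu cw x; apply: cvgM; [exact: cu|exact: cw].
have dsin x : is_derive (x : R^o) 1 (fun x : R^o => psi x * sin (N * x) : R^o)
    (dpsi x * sin (N * x) + N * (psi x * cos (N * x))).
  have := hd x => h; apply: is_derive_eq; rewrite /GRing.scale/=; ring.
have dcos x : is_derive (x : R^o) 1 (fun x : R^o => psi x * cos (N * x) : R^o)
    (dpsi x * cos (N * x) + - N * (psi x * sin (N * x))).
  have := hd x => h; apply: is_derive_eq; rewrite /GRing.scale/=; ring.
have sin2 : sin (N * (2 * pi)) = 0 by exact: (sin_pi2_int (R := R) k.+1%:Z).
have cos2 : cos (N * (2 * pi)) = 1 by exact: (cos_pi2_int (R := R) k.+1%:Z).
have e1 := FTC_full (ltW (@pi2_gt0 R)) _ dcos.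
have e2 := FTC_full (ltW (@pi2_gt0 R)) _ dsin.
have {}e1 : \int[leb R]_(x in circle R) (dpsi x * cos (N * x)) =
    N * \int[leb R]_(x in circle R) (psi x * sin (N * x)).
  have : \int[leb R]_(x in circle R) (dpsi x * cos (N * x) + - N * (psi x * sin (N * x))) = 0.
    rewrite [LHS]e1; last first.
      by move=> x; apply: cvgD; [exact: ccM|apply: cvgM; [exact: cvg_cst|exact: ccM]].
    by rewrite cos2 mulr0 cos0 per subrr.
  rewrite RintegralD//; [|exact: cintble_continuous (ccM _ _ cd cc)|]; last first.
    by apply: cintbleZ; exact: cintble_continuous (ccM _ _ cpsi cs).
  rewrite RintegralZl//; last exact: cintble_continuous (ccM _ _ cpsi cs).
  by rewrite mulNr => /eqP; rewrite subr_eq0 => /eqP.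
have {}e2 : \int[leb R]_(x in circle R) (dpsi x * sin (N * x)) =
    - (N * \int[leb R]_(x in circle R) (psi x * cos (N * x))).
  have : \int[leb R]_(x in circle R) (dpsi x * sin (N * x) + N * (psi x * cos (N * x))) = 0.
    rewrite [LHS]e2; last first.
      by move=> x; apply: cvgD; [exact: ccM|apply: cvgM; [exact: cvg_cst|exact: ccM]].
    by rewrite sin2 !mulr0 sin0 mulr0 subrr.
  rewrite RintegralD//; [|exact: cintble_continuous (ccM _ _ cd cs)|]; last first.
    by apply: cintbleZ; exact: cintble_continuous (ccM _ _ cpsi cc).
  rewrite RintegralZl//; last exact: cintble_continuous (ccM _ _ cpsi cc).
  by move=> /eqP; rewrite addr_eq0 => /eqP.
apply: complex_ext.
  by rewrite (cReM (Complex 0 N)) !modesRe// modesIm// -/N e1 /=; ring.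
by rewrite (cImM (Complex 0 N)) modesRe// !modesIm// -/N e2 /=; ring.
Qed.

Variable phi : R^o * R^o -> R^o.
Hypothesis sphi : smooth phi.

Definition phit (z : R^o * R^o) : R^o := 'D_((1, 0) : R^o * R^o) phi z.
Definition phix (z : R^o * R^o) : R^o := 'D_((0, 1) : R^o * R^o) phi z.

Lemma phi_continuous : continuous phi. Proof. by have [] := sphi [::]. Qed.
Lemma phit_continuous : continuous phit. Proof. by have [] := sphi [:: (1, 0)]. Qed.
Lemma phix_continuous : continuous phix. Proof. by have [] := sphi [:: (0, 1)]. Qed.

Lemma phi_derive_t s x : is_derive (s : R^o) 1 (fun s : R^o => phi (s, x)) (phit (s, x)).
Proof.
have e : (fun h : R^o => h^-1 *: (phi (h *: ((1, 0) : R^o * R^o) + (s, x)) - phi (s, x))) =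
    (fun h : R^o => h^-1 *: (phi (h *: (1 : R^o) + s, x) - phi (s, x))).
  apply/funext => h; congr (_ *: (phi _ - _)).
  by transitivity (h *: (1 : R^o) + s, h *: (0 : R^o) + x); rewrite // scaler0 add0r.
have [_ /(_ (s, x) (1, 0)) d] := sphi [::]; split.
  by move: d; rewrite /derivable/= e.
by rewrite /phit /derive/= e.
Qed.

Lemma phi_derive_x t x : is_derive (x : R^o) 1 (fun x : R^o => phi (t, x)) (phix (t, x)).
Proof.
have e : (fun h : R^o => h^-1 *: (phi (h *: ((0, 1) : R^o * R^o) + (t, x)) - phi (t, x))) =
    (fun h : R^o => h^-1 *: (phi (t, h *: (1 : R^o) + x) - phi (t, x))).
  apply/funext => h; congr (_ *: (phi _ - _)).
  by transitivity (h *: (0 : R^o) + t, h *: (1 : R^o) + x); rewrite // scaler0 add0r.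
have [_ /(_ (t, x) (0, 1)) d] := sphi [::]; split.
  by move: d; rewrite /derivable/= e.
by rewrite /phix /derive/= e.
Qed.

Definition pmodes k (t : R) : R[i] := modes (fun x => phi (t, x)) k.
Definition qmodes k (t : R) : R[i] := modes (fun x => phit (t, x)) k.

Lemma phi_cintble t : cintble (fun x => phi (t, x)).
Proof. apply: cintble_continuous; apply: continuous_slice; exact: phi_continuous. Qed.

Lemma phit_cintble t : cintble (fun x => phit (t, x)).
Proof. apply: cintble_continuous; apply: continuous_slice; exact: phit_continuous. Qed.

Lemma phix_cintble t : cintble (fun x => phix (t, x)).
Proof. apply: cintble_continuous; apply: continuous_slice; exact: phix_continuous. Qed.

Lemma ccont_modes (F : R^o * R^o -> R^o) k : continuous F ->
  ccont (fun t => modes (fun x => F (t, x)) k).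
Proof.
move=> cF; have [cc cs] := @cis_ccont R k.+1%:R.
have iF t : cintble (fun x => F (t, x)) by apply: cintble_continuous; exact: continuous_slice.
split.
- under eq_fun do rewrite modesRe//.
  move=> t; apply: cvgM; first exact: cvg_cst.
  exact: (continuous_param cF cc).
- under eq_fun do rewrite modesIm//.
  move=> t; apply: cvgN; apply: cvgM; first exact: cvg_cst.
  exact: (continuous_param cF cs).
Qed.

Lemma modes_rect_bound (F : R^o * R^o -> R^o) (p q : R) : continuous F ->
  exists2 C, 0 <= C & forall k t, p <= t <= q -> cnorm (modes (fun x => F (t, x)) k) <= C.
Proof.
move=> cF; have [M M0 hM] := rectangle_bounded p q cF.
have c0 := ltW (@cth_gt0 R).
exists (cth * (M * (2 * pi))) => [|k t tpq].
  by rewrite !mulr_ge0// ltW// ?pi_gt0.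
have iF : cintble (fun x => F (t, x)) by apply: cintble_continuous; exact: continuous_slice.
apply: le_trans (fourier_bound _ iF) _; rewrite ler_wpM2l//.
apply: (@le_trans _ _ (\int[leb R]_(x in circle R) M)).
  apply: le_Rintegral => //; [exact: integrable_norm iF|exact: cintble_cst|].
  by move=> x xc; exact: hM.
have e : fine (leb R (circle R)) = 2 * pi := congr1 fine leb_circle.
rewrite Rintegral_cst// ler_wpM2l//.
have := lexx (2 * pi : R); rewrite -{1}e; exact.
Qed.

(** The modes vanish at T and are recovered from those of the time derivative; such a backward
    primitive is what [duh_pairing] produces. *)
Lemma pmodesE k (s T : R) : s <= T -> (forall x, phi (T, x) = 0) ->
  pmodes k s = - cint (leb R) `[s, T] (qmodes k).
Proof.
move=> sT pT; have [cc cs] := @cis_ccont R k.+1%:R.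
have ip := phi_cintble; have iq := phit_cintble.
have c0 : cth != 0 :> R by rewrite lt0r_neq0// cth_gt0.
have [cq1 cq2] := ccont_modes k phit_continuous.
have dd (w : R -> R) : continuous w ->
    \int[leb R]_(t in `[s, T]) (\int[leb R]_(x in circle R) (phit (t, x) * w x)) =
    - \int[leb R]_(x in circle R) (phi (s, x) * w x).
  move=> cw; have dP (t : R^o) : is_derive t 1
      (fun s : R^o => \int[leb R]_(x in circle R) (phi (s, x) * w x) : R^o)
      (\int[leb R]_(x in circle R) (phit (t, x) * w x)).
    by apply: derive_param => //; [exact: phi_continuous|exact: phit_continuous|exact:
      phi_derive_t].
  rewrite (FTC_full sT (continuous_param phit_continuous cw) dP).
  have -> : \int[leb R]_(x in circle R) (phi (T, x) * w x) = 0.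
    rewrite (@eq_Rintegral _ _ _ (leb R) _ (cst 0)); last by move=> x _; rewrite pT mul0r.
    by rewrite Rintegral_cst// mul0r.
  by rewrite sub0r.
have int w : continuous w -> (leb R).-integrable `[s, T]
    (EFin \o (fun t => \int[leb R]_(x in circle R) (phit (t, x) * w x))).
  move=> cw; apply: continuous_compact_integrable; first exact: segment_compact.
  by apply: continuous_subspaceT; exact: (continuous_param phit_continuous cw).
apply: complex_ext.
- rewrite cReN -[cRe (cint _ _ _)]/(\int[leb R]_(t in `[s, T]) cRe (qmodes k t)).
  have qE t : cRe (qmodes k t) = cth * \int[leb R]_(x in circle R) (phit (t, x) * cos (k.+1%:R *
    x)).
    exact: modesRe.
  under eq_Rintegral do rewrite qE.
  rewrite /pmodes modesRe//.
  by rewrite RintegralZl ?dd ?mulrN ?opprK//; exact: int.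
- rewrite cImN -[cIm (cint _ _ _)]/(\int[leb R]_(t in `[s, T]) cIm (qmodes k t)).
  have qE t : cIm (qmodes k t) = - cth * \int[leb R]_(x in circle R) (phit (t, x) * sin (k.+1%:R
    * x)).
    by rewrite mulNr; exact: modesIm.
  under eq_Rintegral do rewrite qE.
  rewrite /pmodes modesIm//.
  by rewrite RintegralZl ?dd ?mulNr ?mulrN ?opprK//; exact: int.
Qed.

Lemma phix_modes k t : periodic (fun x : R => phi (t, x)) (2 * pi) ->
  modes (fun x => phix (t, x)) k = Complex 0 k.+1%:R * pmodes k t.
Proof.
move=> per; apply: (@modes_derive (fun x => phi (t, x))).
- by apply: continuous_slice; exact: phix_continuous.
- by move=> x; exact: phi_derive_x.
- by rewrite -(per 0) add0r.
Qed.

(** The strict inequality places a whole neighbourhood of t in the region where [phi] vanishes. *)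
Lemma phit_support (T t x : R) : (forall t x, T <= t -> phi (t, x) = 0) -> T < t -> phit (t, x) = 0.
Proof.
move=> pT Tt; have /@derive_val <- := phi_derive_t t x.
rewrite (@near_eq_derive _ _ _ _ (cst 0)) ?derive_cst//.
near=> s; apply: pT; apply: ltW; near: s; exact: lt_nbhsr.
Unshelve. all: by end_near.
Qed.

End TestFunctions.

(** * The weak equation for mild solutions *)

Section WeakEquation.
Context {R : realType}.

Lemma Rintegral_support (A B : set R) (F : R -> R) : measurable A -> measurable B ->
  B `<=` A -> (forall t, A t -> ~ B t -> F t = 0) ->
  \int[leb R]_(t in A) F t = \int[leb R]_(t in B) F t.
Proof.
move=> mA mB BA F0; rewrite /Rintegral [in LHS]integral_mkcond [in RHS]integral_mkcond.
congr fine; apply: eq_integral => t _; rewrite !patchE.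
case: (boolP (t \in B)) => [/set_mem Bt|/negP nB].
  by rewrite mem_set//; exact: BA.
case: ifPn => // /set_mem At; rewrite F0//.
by move=> Bt; apply: nB; exact: mem_set.
Qed.

Lemma sum_int_lt (D : set R) (F : nat -> R -> R[i]) (g : R -> \bar R) : measurable D ->
  (forall k, cmeas D (F k)) ->
  (forall t, D t -> (\sum_(k <oo) (cnorm (F k t))%:E <= g t)%E) ->
  (\int[leb R]_(t in D) g t < +oo)%E ->
  (\sum_(k <oo) \int[leb R]_(t in D) (cnorm (F k t))%:E < +oo)%E.
Proof.
move=> mD mF Fg; apply: le_lt_trans; rewrite -integral_nneseries//; last 2 first.
- by move=> k; apply/measurable_EFinP; exact: (cmeas_norm (mF k)).
- by move=> k t _; rewrite lee_fin cnorm_ge0.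
apply: ge0_le_integralW => // t _.
by apply: nneseries_ge0 => k *; rewrite lee_fin cnorm_ge0.
Qed.

Lemma cmeas_sub (D : set R) (F G : R -> R[i]) : cmeas D F -> cmeas D G ->
  cmeas D (fun t => F t - G t).
Proof. by move=> mF mG; apply: cmeasD => //; exact: cmeasN. Qed.

Lemma ccontJ (F : R -> R[i]) : ccont F -> ccont (fun t => conjc (F t)).
Proof.
move=> [c1 c2]; split.
  by rewrite (_ : (fun t => cRe (conjc (F t))) = fun t => cRe (F t))//; apply/funext => t;
    rewrite cReJ.
rewrite (_ : (fun t => cIm (conjc (F t))) = fun t => - cIm (F t)).
  by move=> t; apply: cvgN; exact: c2.
by apply/funext => t; rewrite cImJ.
Qed.

(** The mode equation tested against the backward primitive of q: [duh] is x plus the primitive of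
    its right-hand side, and exchanging the time integrals moves that primitive onto q. *)
Lemma duh_pairing (l : R) (x : R[i]) (M q : R -> R[i]) T : (forall T, tintegrable T M) ->
  0 <= T -> ccont q ->
  cint (leb R) `[0, T] (fun t => duh l x M t * q t) =
  x * cint (leb R) `[0, T] q +
  cint (leb R) `[0, T] (fun t => (M t - RC l * duh l x M t) * cint (leb R) `[t, T] q).
Proof.
move=> tM T0 cq; pose P t := M t - RC l * duh l x M t.
have ta T' : tintegrable T' (duh l x M) by apply: ccont_tintegrable; exact: duh_ccont.
have tP T' : tintegrable T' P.
  by apply: cintegrableB => //; [exact: tM|apply: cintegrableZ => //; exact: ta].
have tq T' : tintegrable T' q by exact: ccont_tintegrable.
have aP t : 0 <= t -> duh l x M t = x + tint t P.
  move=> t0; rewrite /P /tint cintB//; [|exact: tM|by apply: cintegrableZ => //; exact: ta].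
  rewrite cintZ//; last exact: ta.
  by rewrite addrA -[X in X - _](duh_eq l x tM t0) addrK.
have <- : cint (leb R) `[0, T] (fun s => cint (leb R) `[s, T] q * P s) =
    cint (leb R) `[0, T] (fun t => P t * cint (leb R) `[t, T] q).
  by apply: eq_cint => s _; rewrite mulrC.
rewrite -triangle_fubini//; [|exact: tq|exact: tP].
have iqP : tintegrable T (fun t => q t * tint t P).
  by apply: ccont_tintegrable; apply: ccontM => //; exact: tint_ccont.
rewrite -cintZ//; last exact: tq.
rewrite -cintD//; last by apply: cintegrableZ => //; exact: tq.
apply: eq_cint => t; rewrite /= in_itv/= => /andP[t0 _].
by rewrite aP// mulrDl [tint _ _ * _]mulrC.
Qed.

Variables (nu : R) (f0 : R -> R) (a : nat -> R -> R[i]).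
Hypotheses (nu_gt0 : 0 < nu) (hf0 : wiener 1 f0).
Hypotheses (hm : mild nu cth (modes f0) a) (hE : EN_le nu a 2^-1).
Let f t := synth (a^~ t).
Let c_gt0 := @cth_gt0 R.
Let c_lt := @cth_lt R.
Let W4 := w4_ge0 nu_gt0.
Let N k t := NN nu cth a a k t.

Lemma mild_mode_identity k T (q : R -> R[i]) : 0 <= T -> ccont q ->
  cint (leb R) `[0, T] (fun t => a k t * q t) =
  modes f0 k * cint (leb R) `[0, T] q +
  cint (leb R) `[0, T] (fun t => (N k t - RC (lam nu k) * a k t) * cint (leb R) `[t, T] q).
Proof.
move=> T0 cq; have [_ tN aE] := hm.
have := duh_pairing (lam nu k) (modes f0 k) (tN k) T0 cq.
by have <- : a k = duh (lam nu k) (modes f0 k) (NN nu cth a a k)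
  by apply/funext => t; rewrite aE.
Qed.

Lemma mild_mean0 t : 0 <= t -> mean0 (f t).
Proof.
move=> t0; have st := mild_summable nu_gt0 hE t0.
by split; [exact: synth_cintble|rewrite fourier_synth].
Qed.

Lemma mild_modes t : 0 <= t -> modes (f t) = a^~ t.
Proof. by move=> t0; apply: modes_synth; exact: (mild_summable nu_gt0 hE t0). Qed.

(** All three terms become sums over modes, by Parseval in space and Fubini between the sum and the
    time integral; [duh_pairing] then gives equality mode by mode. *)
Lemma mild_weak_equation : weak_equation nu f0 f.
Proof.
move=> phi [sphi per [T0 pT0]] g.
have [pf0 [if0 f00] sf0] := (@wienerP R 1 f0).1 hf0.
have sal : summable_seq (modes f0) by apply: wsum_summable sf0 => k; exact: wpow_ge1.
have mC := @measurable_circle R.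
pose T := Num.max T0 0; have T_ge0 : 0 <= T by rewrite le_max lexx orbT.
have pT t x : T <= t -> phi (t, x) = 0.
  by move=> Tt; apply: pT0; apply: le_trans Tt; rewrite le_max lexx.
set D := `[0, T]%classic : set R.
have mD : measurable D by exact: measurable_itv.
have DH : D `<=` half_line R.
  by move=> t; rewrite /D/= in_itv/= half_line_ge0 => /andP[].
have D0 t : D t -> 0 <= t by move=> /DH; rewrite half_line_ge0.
have outD t : half_line R t -> ~ D t -> T < t.
  by rewrite half_line_ge0 /D/= in_itv/= => t0 h; rewrite ltNge; apply/negP => tT; apply: h;
    rewrite t0.
pose P := pmodes phi; pose Q := qmodes phi.
have cP k : ccont (P k) by apply: ccont_modes; exact: phi_continuous.
have cQ k : ccont (Q k) by apply: ccont_modes; exact: phit_continuous.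
pose X k t := a k t * conjc (Q k t).
pose Y k t := (RC (lam nu k) * a k t - N k t) * conjc (P k t).
have [C1 C10 bQ] := modes_rect_bound 0 T (phit_continuous sphi).
have [C2 C20 bP] := modes_rect_bound 0 T (phi_continuous sphi).
have ma k : cmeas D (a k) by exact: (mild_cmeas k mD hm).
have maT k : cmeas setT (a k) by exact: (mild_cmeas k measurableT hm).
have mN k : cmeas D (N k).
  by apply: (@cmeasS _ _ _ _ setT) => //; apply: NN_cmeas.
have fin4 : (\int[leb R]_(t in D) wsum (w4 nu) (a^~ t) < +oo)%E.
  by apply: le_lt_trans (EN_le4 hE T_ge0) _; exact: ltry.
have finN : (\int[leb R]_(t in D) wsum w1 (N^~ t) < +oo)%E.
  by apply: (@NN_int_fin R nu cth nu_gt0 c_gt0 a 2^-1) => //; rewrite invr_ge0.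
have w40 k : 1 <= w4 nu k :> R.
  rewrite /w4 -[leLHS]mul1r ler_pM// ?ler1n//.
  by apply: le_trans (lam_ge nu_gt0 k); rewrite lerDl ltW.
have lamw4 k : lam nu k <= w4 nu k.
  by rewrite /w4 ler_peMl ?ler1n// (lam_ge0 nu_gt0).
have psi4 t : (0 <= wsum (w4 nu) (a^~ t))%E by exact: wsum_ge0.
have psiN t : (0 <= wsum w1 (N^~ t))%E by apply: wsum_ge0 => k; exact: w1_ge0.
have m4 : measurable_fun D (fun t => wsum (w4 nu) (a^~ t)) by exact: measurable_wsum.
have mN1 : measurable_fun D (fun t => wsum w1 (N^~ t)).
  by apply: measurable_wsum => // k; exact: w1_ge0.
(* X is the term with the time derivative, Y the right-hand side. The test modes are bounded on
   [[0, T]], so both are summable in mode and time by the dissipation and forcing bounds. *)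
have [sX iX eX] : [/\ summable_seq (fun k => cint (leb R) D (X k)),
    cintegrable (leb R) D (fun t => csum (X^~ t)) &
    csum (fun k => cint (leb R) D (X k)) = cint (leb R) D (fun t => csum (X^~ t))].
  apply: csum_cint => // [k|].
    by apply: cmeasM => //; apply: ccont_cmeas => //; apply: ccontJ.
  apply: (@sum_int_lt _ _ (fun t => C1%:E * wsum (w4 nu) (a^~ t))%E) => // [k|t Dt|].
  - by apply: cmeasM => //; apply: ccont_cmeas => //; apply: ccontJ.
  - rewrite -nneseriesZl//; last by move=> k _; rewrite lee_fin mulr_ge0 ?cnorm_ge0.
    apply: lee_nneseries => k *; rewrite -?EFinM lee_fin ?cnorm_ge0//.
    rewrite /X Normc.normcM cnormJ mulrC ler_pM ?cnorm_ge0//; first exact: bQ.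
    by rewrite ler_peMl ?cnorm_ge0.
  - by rewrite ge0_integralZl ?lee_fin// lte_mul_pinfty.
have [sY iY eY] : [/\ summable_seq (fun k => cint (leb R) D (Y k)),
    cintegrable (leb R) D (fun t => csum (Y^~ t)) &
    csum (fun k => cint (leb R) D (Y k)) = cint (leb R) D (fun t => csum (Y^~ t))].
  have mY k : cmeas D (Y k).
    apply: cmeasM; last by apply: ccont_cmeas => //; apply: ccontJ.
    by apply: cmeas_sub => //; apply: cmeasM => //; exact: cmeas_cst.
  apply: csum_cint => //.
  apply: (@sum_int_lt _ _ (fun t => C2%:E * (wsum (w4 nu) (a^~ t) + wsum w1 (N^~ t)))%E) => // [t
    Dt|].
  - rewrite /wsum -nneseriesD; last 2 first.
    + by move=> k _ _; rewrite lee_fin mulr_ge0 ?cnorm_ge0.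
    + by move=> k _ _; rewrite lee_fin mulr_ge0 ?cnorm_ge0 ?w1_ge0.
    rewrite -nneseriesZl//; last first.
      by move=> k _; rewrite -EFinD lee_fin addr_ge0// mulr_ge0 ?cnorm_ge0 ?w1_ge0 ?W4.
    apply: lee_nneseries => k *; rewrite -?EFinD -?EFinM lee_fin ?cnorm_ge0//.
    rewrite /Y Normc.normcM cnormJ mulrC ler_pM ?cnorm_ge0//; first exact: bP.
    apply: le_trans (cnormB _ _) _; rewrite Normc.normcM cnormR ger0_norm ?(lam_ge0 nu_gt0)//.
    rewrite lerD// ?ler_wpM2r ?cnorm_ge0//.
    by rewrite ler_peMl ?cnorm_ge0// /w1 ler1n.
  - rewrite ge0_integralZl ?lee_fin//; last 2 first.
    + exact: emeasurable_funD.
    + by move=> t _; exact: adde_ge0.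
    rewrite ge0_integralD// lte_mul_pinfty//.
    exact: lte_add_pinfty.
have -> : \int[leb R]_(t in half_line R) \int[leb R]_(x in circle R)
      (f t x * 'D_((1, 0) : R^o * R^o) phi (t, x)) =
    2 * cRe (csum (fun k => cint (leb R) D (X k))).
  rewrite (@Rintegral_support _ D)//; last 2 first.
  - exact: measurable_half_line.
  - move=> t Ht nD; rewrite (@eq_Rintegral _ _ _ (leb R) _ (cst 0)).
      by rewrite Rintegral_cst// mul0r.
    by move=> x _; rewrite -[X in _ * X]/(phit phi (t, x)) (phit_support sphi _ pT (outD _ Ht
      nD)) mulr0.
  rewrite eX -[cRe (cint _ _ _)]/(\int[leb R]_(t in D) cRe (csum (X^~ t))) -RintegralZl//; last
    by case: iX.
  apply: eq_Rintegral => t /set_mem Dt; have t0 := D0 _ Dt.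
  by apply: parseval; [exact: (mild_summable nu_gt0 hE t0)|exact: phit_cintble].
have -> : \int[leb R]_(x in circle R) (f0 x * phi (0, x)) =
    2 * cRe (csum (fun k => modes f0 k * conjc (P k 0))).
  rewrite -parseval//; last exact: phi_cintble.
  apply: ae_eq_Rintegral => //; have FF := ae_filter_ringOfSetsType (leb R).
  by apply: filterS (synth_modes if0 f00 sal) => x hx xc; rewrite hx.
have -> : \int[leb R]_(t in half_line R) \int[leb R]_(x in circle R)
      (g t x * phi (t, x) + hilbert_comm (f t) (g t) x * 'D_((0, 1) : R^o * R^o) phi (t, x)) =
    2 * cRe (csum (fun k => cint (leb R) D (Y k))).
  rewrite (@Rintegral_support _ D)//; last 2 first.
  - exact: measurable_half_line.
  - move=> t Ht nD; rewrite (@eq_Rintegral _ _ _ (leb R) _ (cst 0)).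
      by rewrite Rintegral_cst// mul0r.
    have Tt := outD _ Ht nD.
    move=> x _; rewrite pT ?(ltW Tt)// mulr0 add0r.
    have /@derive_val := phi_derive_x sphi t x; rewrite -[X in _ = X -> _]/('D_((0, 1) : R^o *
      R^o) phi (t, x)) => <-.
    rewrite (_ : (fun x0 : R^o => phi (t, x0)) = cst 0) ?derive_cst ?mulr0//.
    by apply/funext => y; rewrite pT// ltW.
  rewrite eY -[cRe (cint _ _ _)]/(\int[leb R]_(t in D) cRe (csum (Y^~ t))) -RintegralZl//; last
    by case: iY.
  (* The formula for a time slice holds where the dissipation is finite; the remaining times form a
     null set. *)
  apply: ae_eq_Rintegral => //; have FF := ae_filter_ringOfSetsType (leb R).
  apply: filterS (wsum_ae_fin W4 maT fin4) => t ht Dt; have t0 := D0 _ Dt.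
  have h4 := ht Dt.
  rewrite -[LHS]/(\int[leb R]_(x in circle R) (flux nu (f t) x * phi (t, x) +
    hilbert_comm (f t) (flux nu (f t)) x * phix phi (t, x))).
  rewrite (slice_pairing nu_gt0); last 5 first.
  - exact: mild_mean0.
  - by rewrite mild_modes.
  - exact: phi_cintble.
  - exact: phix_cintble.
  - by move=> k; apply: phix_modes.
  by rewrite mild_modes.
have sP0 : summable_seq (fun k => modes f0 k * conjc (P k 0)).
  apply: (@summable_le _ _ (modes f0) C2) => // k.
  by rewrite Normc.normcM cnormJ mulrC ler_wpM2r ?cnorm_ge0// bP// lexx.
rewrite -mulrDr -cReD -csumD//; congr (2 * cRe _); apply: eq_csum => k.
have PE t : D t -> P k t = - cint (leb R) `[t, T] (Q k).
  by rewrite /D/= in_itv/= => /andP[_ tT]; apply: pmodesE => // x; exact: pT.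
have JE t : D t -> cint (leb R) `[t, T] (fun s => conjc (Q k s)) = - conjc (P k t).
  move=> Dt; rewrite cintJ//; last first.
    split; apply: continuous_compact_integrable; try exact: segment_compact;
      by apply: continuous_subspaceT; case: (cQ k).
  by rewrite PE// rmorphN opprK.
rewrite /X (mild_mode_identity k T_ge0 (ccontJ (cQ k))).
have D0' : D 0 by rewrite /D/= in_itv/= lexx.
rewrite -/D JE// mulrN addrC addrA subrr add0r.
by apply: eq_cint => t Dt; rewrite JE// mulrN -mulNr opprB.
Qed.

End WeakEquation.

(** * Weak solutions are mild *)

Section DerivativeTools.
Context {R : realType}.

(** Serves at the end of the support of a bump, where the defining formula is available on one side
    only. *)
Lemma is_derive_quadratic (f : R -> R) (t K : R) : f t = 0 ->
  (forall h, `|h| <= 1 -> `|f (h + t)| <= K * h ^+ 2) ->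
  is_derive (t : R^o) 1 (f : R^o -> R^o) 0.
Proof.
move=> ft fK; have K0 : 0 <= K.
  by have := fK 1; rewrite normr1 expr1n mulr1 lexx => /(_ isT); exact: le_trans.
have lim : (fun h : R^o => h^-1 *: ((f (h *: (1 : R^o) + t) : R^o) - f t)) @ (0 : R^o)^' --> (0 :
  R^o).
  apply/cvgrPdist_le => e e0; near=> h.
  have h0 : h != 0 by near: h; exact: nbhs_dnbhs_neq.
  have hs : `|h| <= Num.min 1 (e / (K + 1)).
    near: h; apply: dnbhs0_le; rewrite lt_min ltr01/= divr_gt0//.
    by rewrite ltr_wpDl.
  move: hs; rewrite le_min => /andP[h1 he].
  rewrite sub0r normrN ft subr0 normrM /GRing.scale/= mulr1 normfV.
  apply: (@le_trans _ _ (`|h|^-1 * (K * h ^+ 2))).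
    by rewrite ler_wpM2l ?invr_ge0//; exact: fK.
  rewrite -[h ^+ 2]real_normK ?num_real// expr2 mulrCA mulKf ?normr_eq0//.
  apply: (@le_trans _ _ (K * (e / (K + 1)))); first by rewrite ler_wpM2l.
  by rewrite mulrCA ler_piMr ?(ltW e0)// ler_pdivrMr ?ltr_wpDl// mul1r lerDl.
split; first by apply/cvg_ex; exists 0; exact: lim.
by apply: cvg_lim; [exact: Rhausdorff|exact: lim].
Unshelve. all: by end_near.
Qed.

Lemma is_derive_line (f : R^o * R^o -> R^o) z v (df : R) :
  is_derive (0 : R^o) 1 (fun h : R^o => f (h *: v + z)) df -> is_derive z v f df.
Proof.
move=> [d1 d2]; split; first exact/derivable1P.
have e : (fun h : R^o => h^-1 *: ((f \o shift z) (h *: v) - f z)) =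
    (fun h : R^o => h^-1 *: (((fun h : R^o => f (h *: v + z)) \o shift 0) (h *: (1 : R^o)) -
      f ((0 : R^o) *: v + z))).
  by apply/funext => h; rewrite /= addr0 scale0r add0r [h *: (1 : R^o)]mulr1.
by rewrite -d2 /derive e.
Qed.

Lemma is_derive_affine (F : R -> R) (dF a t : R) :
  is_derive (t : R^o) 1 (F : R^o -> R^o) dF ->
  is_derive (0 : R^o) 1 (fun h : R^o => F (h * a + t) : R^o) (a * dF).
Proof.
move=> hF; have hF' : is_derive (0 * a + t : R^o) 1 (F : R^o -> R^o) dF by rewrite mul0r add0r.
have hg : is_derive (0 : R^o) 1 (fun h : R^o => h * a + t : R^o) a.
  by apply: is_derive_eq; rewrite /GRing.scale/= mulr0 add0r mulr1 addr0.
by rewrite mulrC; exact: (@is_derive1_comp R F (fun h => h * a + t) 0 dF a hF' hg).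
Qed.

Variables F G : nat -> R -> R.

(** [smooth] asks for all iterated directional derivatives. The span of products is closed under
    each of them once the two families are closed under differentiation, so an induction on the list
    of directions proves smoothness. *)
Inductive tensor_span : (R^o * R^o -> R^o) -> Prop :=
| TensorElem p q : tensor_span (fun z => F p z.1 * G q z.2)
| TensorD f g : tensor_span f -> tensor_span g -> tensor_span (fun z => f z + g z)
| TensorZ (c : R) f : tensor_span f -> tensor_span (fun z => c * f z).

Variables dF dG : nat -> R -> R.
Hypotheses (hF : forall p t, is_derive (t : R^o) 1 (F p : R^o -> R^o) (dF p t)).
Hypotheses (hG : forall q x, is_derive (x : R^o) 1 (G q : R^o -> R^o) (dG q x)).
Hypotheses (spanF : forall p q, tensor_span (fun z => dF p z.1 * G q z.2)).
Hypotheses (spanG : forall p q, tensor_span (fun z => F p z.1 * dG q z.2)).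

Lemma tensor_span_derive f : tensor_span f -> forall v,
  exists2 g, tensor_span g & forall z, is_derive z v f (g z).
Proof.
elim=> [p q|f1 f2 _ ih1 _ ih2|c f1 _ ih1] v.
- exists (fun z => v.1 * (dF p z.1 * G q z.2) + v.2 * (F p z.1 * dG q z.2)).
    by apply: TensorD; exact: TensorZ.
  move=> z; apply: is_derive_line.
  have d1 := is_derive_affine v.1 (hF p z.1).
  have d2 := is_derive_affine v.2 (hG q z.2).
  rewrite -[X in is_derive _ _ X _]/(fun h : R^o => F p (h * v.1 + z.1) * G q (h * v.2 + z.2) :
    R^o).
  by apply: is_derive_eq; rewrite /GRing.scale/= !mul0r !add0r; ring.
- have [g1 s1 h1] := ih1 v; have [g2 s2 h2] := ih2 v.
  exists (fun z => g1 z + g2 z); first exact: TensorD.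
  by move=> z; have := h1 z => ?; have := h2 z => ?; exact: is_deriveD.
- have [g1 s1 h1] := ih1 v; exists (fun z => c * g1 z); first exact: TensorZ.
  move=> z; have := h1 z => ?; exact: is_deriveZ.
Qed.

Lemma tensor_span_continuous f : tensor_span f -> continuous f.
Proof.
have cF p : continuous (F p).
  by move=> t; apply: differentiable_continuous; apply/derivable1_diffP; have /@ex_derive := hF p t.
have cG q : continuous (G q).
  by move=> t; apply: differentiable_continuous; apply/derivable1_diffP; have /@ex_derive := hG q t.
elim=> [p q|f1 f2 _ ih1 _ ih2|c f1 _ ih1] z.
- apply: cvgM.
    by apply: (@continuous_comp _ _ _ fst (F p)); [exact: cvg_fst|exact: cF].
  by apply: (@continuous_comp _ _ _ snd (G q)); [exact: cvg_snd|exact: cG].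
- by apply: cvgD; [exact: ih1|exact: ih2].
- by apply: cvgM; [exact: cvg_cst|exact: ih1].
Qed.

Lemma tensor_span_smooth f : tensor_span f -> smooth f.
Proof.
move=> sf vs; have sg : tensor_span (foldr (fun v (h : R^o * R^o -> R^o) => 'D_v h) f vs).
  elim: vs => [//|v vs ih] /=; have [g sg hg] := tensor_span_derive ih v.
  by rewrite (_ : 'D_v _ = g)//; apply/funext => z; have /@derive_val := hg z.
split; first exact: tensor_span_continuous.
by move=> z v; have [g _ hg] := tensor_span_derive sg v; have /@ex_derive := hg z.
Qed.

End DerivativeTools.

(** * Time cut-offs approximating the Duhamel kernel *)

Section Bump.
Context {R : realType}.
Variables (lm tau eps : R).
Hypothesis eps_gt0 : 0 < eps.

(* theta = bump 0 satisfies theta' - lm theta = - (1 + s) e^{-s} e^{lm t} with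
   s = eps / (tau - t), which tends to - e^{lm t}, the Duhamel kernel, on [0, tau[ as
   eps -> 0. The index p makes the family stable under differentiation. *)
Definition bump (p : nat) (t : R) : R :=
  if t < tau then (tau - t) * (tau - t)^-1 ^+ p * expR (- (eps * (tau - t)^-1)) * expR (lm * t)
  else 0.

Lemma power_exp_bound p (u : R) : 0 <= u ->
  u ^+ p.+1 * expR (- (eps * u)) <= (p.+1)`!%:R / eps ^+ p.+1.
Proof.
move=> u0; have eu : 0 <= eps * u by rewrite mulr_ge0// ltW.
have e0 : 0 < eps ^+ p.+1 by rewrite exprn_gt0.
have f0 : 0 < (p.+1)`!%:R :> R by rewrite ltr0n fact_gt0.
rewrite expRN ler_pdivlMr// mulrAC ler_pdivrMr ?expR_gt0//.
rewrite -exprMn [u * _]mulrC -ler_pdivrMl//.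
by apply: le_trans (expR_ge1Dxn p eu); rewrite [leLHS]mulrC lerDr.
Qed.

(** The exponential beats every negative power of [tau - t]; a quadratic zero at tau is enough to
    differentiate there with [is_derive_quadratic]. *)
Lemma bump_bound p t : t < tau ->
  `|bump p t| <= (p.+1)`!%:R / eps ^+ p.+1 * (tau - t) ^+ 2 * expR (lm * t).
Proof.
move=> tt; have s0 : 0 < tau - t by rewrite subr_gt0.
have w0 : 0 <= (tau - t)^-1 by rewrite invr_ge0 ltW.
rewrite /bump tt ger0_norm; last by rewrite !mulr_ge0 ?exprn_ge0 ?expR_ge0// ltW.
rewrite ler_wpM2r ?expR_ge0//.
have -> : (tau - t) * (tau - t)^-1 ^+ p * expR (- (eps * (tau - t)^-1)) =
    (tau - t)^-1 ^+ p.+1 * expR (- (eps * (tau - t)^-1)) * (tau - t) ^+ 2.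
  by rewrite exprS; field; rewrite gt_eqF.
by rewrite ler_wpM2r ?sqr_ge0//; exact: power_exp_bound.
Qed.

(** Up to the exponentials [bump p] is [(tau - t)^(1 - p)]. The three terms come from [e^{lm t}],
    from this power and from [e^{-eps / (tau - t)}], and each is again a multiple of a member of the
    family. *)
Definition dbump p t : R := lm * bump p t + (p%:R - 1) * bump p.+1 t + (- eps) * bump p.+2 t.

Lemma bump_derive p t : is_derive (t : R^o) 1 (bump p : R^o -> R^o) (dbump p t).
Proof.
have [tt|tt] := ltP t tau; last first.
  have b0 q : bump q t = 0 by rewrite /bump ltNge tt.
  rewrite /dbump !b0 !mulr0 !addr0.
  have [C CE] : exists C, C = (p.+1)`!%:R / eps ^+ p.+1 by eexists.
  have C0 : 0 <= C by rewrite CE divr_ge0// exprn_ge0// ltW.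
  apply: (@is_derive_quadratic _ _ _ (C * expR (`|lm| * (`|t| + 1)))) => // h h1.
  have [ht|ht] := ltP (h + t) tau; last first.
    rewrite /bump ltNge ht/= normr0; apply: mulr_ge0; last exact: sqr_ge0.
    by rewrite mulr_ge0// expR_ge0.
  apply: le_trans (bump_bound p ht) _; rewrite -CE mulrAC; apply: ler_pM.
  - by rewrite mulr_ge0// expR_ge0.
  - exact: sqr_ge0.
  - rewrite ler_wpM2l// ler_expR; apply: le_trans (ler_norm _) _; rewrite normrM ler_wpM2l//.
    by apply: le_trans (ler_normD _ _) _; rewrite addrC lerD2l.
  rewrite -[h ^+ 2]sqrrN; apply: lerXn2r; rewrite ?nnegrE.
  - by rewrite subr_ge0 ltW.
  - by move: ht tt; lra.
  - by move: tt; lra.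
have s0 : tau - t != 0 by rewrite gt_eqF// subr_gt0.
pose W s : R := (tau - s)^-1.
have d1 : is_derive (t : R^o) 1 (fun s : R^o => tau - s : R^o) (-1).
  by apply: is_derive_eq; ring.
have dW : is_derive (t : R^o) 1 (W : R^o -> R^o) (W t ^+ 2).
  have := @is_deriveV R (fun s => tau - s) t _ _ s0 d1.
  by rewrite /W -exprVn /GRing.scale/= mulrN mulr1 opprK => h; exact: h.
have dE1 : is_derive (t : R^o) 1 (fun s : R^o => expR (- (eps * W s)) : R^o)
    (expR (- (eps * W t)) * (- (eps * W t ^+ 2))).
  apply: (is_derive1_comp (f := expR) (g := fun s => - (eps * W s))).
have dE2 : is_derive (t : R^o) 1 (fun s : R^o => expR (lm * s) : R^o) (expR (lm * t) * lm).
  apply: (is_derive1_comp (f := expR) (g := fun s => lm * s)).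
  by apply: is_derive_eq; rewrite /GRing.scale/=; ring.
have M (g h : R -> R) (x y : R) : is_derive (t : R^o) 1 (g : R^o -> R^o) x ->
    is_derive (t : R^o) 1 (h : R^o -> R^o) y ->
    is_derive (t : R^o) 1 (fun s : R^o => g s * h s : R^o) (g t * y + h t * x).
  by move=> hg hh; exact: is_deriveM.
have dWp : is_derive (t : R^o) 1 (fun s : R^o => W s ^+ p : R^o) (p%:R * W t ^+ p.+1).
  elim: (p) => [|q ih].
    by rewrite mul0r; under eq_fun do rewrite expr0; exact: is_derive_cst.
  under eq_fun do rewrite exprS; apply: is_derive_eq (M _ _ _ _ dW ih) _.
  by rewrite -[in RHS]natr1 !exprS; ring.
pose H (s : R^o) : R^o := (tau - s) * W s ^+ p * expR (- (eps * W s)) * expR (lm * s).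
have dH : is_derive (t : R^o) 1 H (dbump p t).
  apply: is_derive_eq (M _ _ _ _ (M _ _ _ _ (M _ _ _ _ d1 dWp) dE1) dE2) _.
  rewrite /dbump /bump tt -/(W t).
  have -> : tau - t = (W t)^-1 by rewrite /W invrK.
  have W0 : W t != 0 by rewrite invr_neq0.
  move: (expR (- (eps * W t))) (expR (lm * t)) => e1 e2; move: (W t) W0 => w w0.
  by rewrite !exprS; move: (w ^+ p) => wp; field.
have eH : \near t, H t = bump p t.
  by near=> s; rewrite /bump ifT//; near: s; exact: lt_nbhsl.
exact: near_eq_is_derive eH dH.
Unshelve. all: by end_near.
Qed.

End Bump.

(** * Modes of an arbitrary solution *)

Section WeakSolutionModes.
Context {R : realType}.

Lemma wiener_norm_ge (u : R -> R) k : ((cnorm (modes u k))%:E <= wiener_norm 1 u)%E.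
Proof.
pose F (n : int) : \bar R := (((absz n)%:R `^ 1) * cnorm (fourier u n))%:E.
have F0 n : (0 <= F n)%E by rewrite lee_fin mulr_ge0 ?powR_ge0 ?cnorm_ge0.
have := @nneseries_le_esum R F (fun k : nat => k.+1%:Z) F0 (fun i j => ltac:(by move=> [])).
apply: le_trans; apply: (@le_trans _ _ (F k.+1%:Z)).
  by rewrite lee_fin powRr1// ler_peMl ?cnorm_ge0// ler1n.
apply: (@wsum_term R (fun k => (absz k.+1%:Z)%:R `^ 1) (modes u) k) => n.
exact: powR_ge0.
Qed.

Lemma cintble_sum (I : Type) (s : seq I) (v : I -> R -> R) : (forall i, cintble (v i)) ->
  cintble (fun x => \sum_(i <- s) v i x).
Proof.
move=> iv; elim: s => [|i s ih].
  by under eq_fun do rewrite big_nil; exact: cintble_cst.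
by under eq_fun do rewrite big_cons; exact: cintbleD.
Qed.

Lemma fourier_sum (I : Type) (s : seq I) (v : I -> R -> R) n : (forall i, cintble (v i)) ->
  fourier (fun x => \sum_(i <- s) v i x) n = \sum_(i <- s) fourier (v i) n.
Proof.
move=> iv; elim: s => [|i s ih].
  rewrite big_nil; under eq_fun do rewrite big_nil.
  have := fourierZ 0 n (cintble_cst (0 : R)).
  by under eq_fun do rewrite mul0r; rewrite -[RC 0]/(0 : R[i]) mul0r.
rewrite big_cons -ih -fourierD//; last exact: cintble_sum.
by congr (fourier _ n); apply/funext => x; rewrite big_cons.
Qed.

Lemma cmeas_sum {d} {T : measurableType d} (D : set T) (I : Type) (s : seq I)
    (F : I -> T -> R[i]) : (forall i, cmeas D (F i)) ->
  cmeas D (fun t => \sum_(i <- s) F i t).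
Proof.
move=> mF; elim: s => [|i s ih].
  by under eq_fun do rewrite big_nil; exact: cmeas_cst.
by under eq_fun do rewrite big_cons; exact: cmeasD.
Qed.

(** The A^1 norm bounds each mode, so a mode is the pointwise limit of the modes of the
    approximating simple functions. *)
Lemma wiener_measurable_modes (h : R -> R -> R) k : (forall t, 0 <= t -> wiener 1 (h t)) ->
  wiener_measurable 1 h -> cmeas (half_line R) (fun t => modes (h t) k).
Proof.
move=> wh [s [simp lim]].
have ih t : 0 <= t -> cintble (h t) by move=> /wh[].
have sE j : exists (n : nat) (E : 'I_n -> set R) (v : 'I_n -> R -> R),
    [/\ forall i, measurable (E i), forall t, cintble (s j t) &
    forall t, modes (s j t) k = \sum_(i < n) RC (\1_(E i) t) * modes (v i) k].
  have [n [E [v [mE wv sv]]]] := simp j; exists n, E, v.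
  have iv i t : cintble (fun x => \1_(E i) t * v i x) by apply: cintbleZ; case: (wv i).
  have e t : s j t = fun x => \sum_(i < n) \1_(E i) t * v i x by apply/funext => x; exact: sv.
  split=> // t; rewrite e; first exact: cintble_sum.
  rewrite /modes fourier_sum//; apply: eq_bigr => i _.
  by rewrite fourierZ//; case: (wv i).
have is' j t : cintble (s j t) by have [n [E [v []]]] := sE j.
have ms j : cmeas (half_line R) (fun t => modes (s j t) k).
  have [n [E [v [mE _ e]]]] := sE j; have -> : (fun t => modes (s j t) k) =
    fun t => \sum_(i < n) RC (\1_(E i) t) * modes (v i) k by apply/funext.
  apply: cmeas_sum => i.
  apply: cmeasM; last exact: cmeas_cst.
  by apply: cmeasR; exact: measurable_indic.
have cv t : half_line R t -> cnorm (modes (h t) k - modes (s j t) k) @[j --> \oo] --> 0.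
  rewrite half_line_ge0 => t0; have := lim _ t0 => L.
  move: L => /fine_cvgP[ffin fl]; apply: (@squeeze_cvgr _ _ _ _ (cst 0)
    (fun j => fine (wiener_norm 1 (fun x => h t x - s j t x)))) => //; last exact: cvg_cst.
  near=> j; rewrite cnorm_ge0/= -lee_fin fineK; last by near: j.
  have := wiener_norm_ge (fun x => h t x - s j t x) k.
  by rewrite {1}/modes fourierB//; exact: ih.
split.
- apply: (measurable_fun_cvg (fun j => (ms j).1)) => t Ht.
  apply/cvgrPdist_le => e e0; have /cvgrPdist_le/(_ _ e0) := cv t Ht.
  apply: filterS => j; rewrite sub0r normrN ger0_norm ?cnorm_ge0// => hj.
  by apply: le_trans hj; rewrite -cReN -cReD; exact: Re_le_cnorm.
- apply: (measurable_fun_cvg (fun j => (ms j).2)) => t Ht.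
  apply/cvgrPdist_le => e e0; have /cvgrPdist_le/(_ _ e0) := cv t Ht.
  apply: filterS => j; rewrite sub0r normrN ger0_norm ?cnorm_ge0// => hj.
  by apply: le_trans hj; rewrite -cImN -cImD; exact: Im_le_cnorm.
Unshelve. all: by end_near.
Qed.

Lemma constant_sign_integral (E : set R) (f : R -> R) (s : bool) : measurable E ->
  (leb R).-integrable E (EFin \o f) -> (forall t, E t -> (0 <= f t) = s) ->
  (\int[leb R]_(t in E) (`|f t|)%:E = `|\int[leb R]_(t in E) f t|%:E)%E.
Proof.
move=> mE iF sg; have ia : (leb R).-integrable E (EFin \o (fun t => `|f t|)).
  exact: (integrable_norm iF).
rewrite -[LHS]fineK; last exact: integrable_fin_num.
congr (_%:E); rewrite -[LHS]/(\int[leb R]_(t in E) `|f t|).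
case: s sg => sg.
  rewrite (@eq_Rintegral _ _ _ (leb R) _ f); last by move=> t /set_mem Et; rewrite ger0_norm// sg.
  by rewrite ger0_norm//; apply: Rintegral_ge0 => t Et; rewrite sg.
have fneg t : E t -> f t <= 0 by move=> Et; rewrite leNgt; apply/negP => /ltW; rewrite sg.
rewrite (@eq_Rintegral _ _ _ (leb R) _ (fun t => - 1 * f t)); last first.
  by move=> t /set_mem Et; rewrite ler0_norm ?fneg// mulN1r.
rewrite RintegralZl// mulN1r ler0_norm// -oppr_ge0 -mulN1r -RintegralZl//.
by apply: Rintegral_ge0 => t Et; rewrite mulN1r oppr_ge0 fneg.
Qed.

(* Where the signs of Re F and Im F are constant there is no cancellation, so that the
   variation of a vector measure bounds the integral of the norms of its density. *)
Lemma quadrant_integral (E : set R) (F : R -> R[i]) (s : bool * bool) : measurable E ->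
  cintegrable (leb R) E F -> (forall t, E t -> (0 <= cRe (F t)) = s.1 /\ (0 <= cIm (F t)) = s.2) ->
  (\int[leb R]_(t in E) (cnorm (F t))%:E <= (2 * cnorm (cint (leb R) E F))%:E)%E.
Proof.
move=> mE [i1 i2] sg.
apply: (@le_trans _ _ (\int[leb R]_(t in E) ((`|cRe (F t)|)%:E + (`|cIm (F t)|)%:E))%E).
  by apply: ge0_le_integralW => t _; rewrite -?EFinD lee_fin ?cnorm_ge0 ?cnorm_le.
have mi (f : R -> R) : (leb R).-integrable E (fun t => (f t)%:E) ->
    measurable_fun E (fun t => (`|f t|)%:E).
  move=> /integrableP[mf _]; apply/measurable_EFinP; apply: measurableT_comp => //.
  exact/measurable_EFinP.
rewrite ge0_integralD//; [|exact: mi|exact: mi].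
rewrite (@constant_sign_integral _ _ s.1)//; last by move=> t /sg[].
rewrite (@constant_sign_integral _ _ s.2)//; last by move=> t /sg[].
rewrite -EFinD lee_fin mulr_natl mulr2n; apply: lerD.
  exact: (Re_le_cnorm (cint (leb R) E F)).
exact: (Im_le_cnorm (cint (leb R) E F)).
Qed.

End WeakSolutionModes.

(** * Variation of the vector measure on sign cells *)

Section VectorMeasureCells.
Context {R : realType}.
Variables (B : nat -> R -> R[i]) (m : set R -> R -> R) (T : R).
Hypotheses (mB : forall n, cmeas setT (B n)) (iB : forall n, tintegrable T (B n))
  (vm : wiener_vmeasure 4%:R m)
  (mE : forall E, measurable E -> E `<=` `[0, T]%classic ->
    forall n, modes (m E) n = cint (leb R) E (B n)).
Variable (N : nat).

Let signs (t : R) : {ffun 'I_N -> bool * bool} :=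
  [ffun i : 'I_N => (0 <= cRe (B i t), 0 <= cIm (B i t))].
Let J := {ffun 'I_N -> bool * bool}.

(** One cell for each pattern of signs of the first N modes: a finite measurable partition of
    [[0, T]], as the bound on the variation requires. *)
Definition sign_cell (j : 'I_#|J|) : set R :=
  `[0, T]%classic `&` [set t | signs t = enum_val j].

Let measurable_sign (b : bool) (f : R -> R) : measurable_fun setT f ->
  measurable [set t | (0 <= f t) = b].
Proof.
move=> mf; have mle : measurable_fun setT (fun t => 0 <= f t).
  exact: measurable_fun_ler (measurable_cst _) mf.
have := mle measurableT [set b] I; rewrite setTI.
by congr (measurable _); apply/seteqP; split.
Qed.

Lemma measurable_sign_cell j : measurable (sign_cell j).
Proof.
apply: measurableI; first exact: measurable_itv.
have -> : [set t | signs t = enum_val j] = \bigcap_(i in [set: 'I_N])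
    ([set t | (0 <= cRe (B i t)) = ((enum_val j : J) i).1] `&`
     [set t | (0 <= cIm (B i t)) = ((enum_val j : J) i).2]).
  apply/seteqP; split=> t /=.
    by move=> e i _; rewrite /= -e ffunE.
  move=> h; apply/ffunP => i; rewrite ffunE; have [/= -> ->] := h i I.
  by case: (_ i).
apply: fin_bigcap_measurable => // i _.
by apply: measurableI; apply: measurable_sign; case: (mB i).
Qed.

Lemma trivIset_sign_cell : trivIset setT sign_cell.
Proof.
by move=> i j _ _ [t [[_ /= e] [_ /= e']]]; apply: enum_val_inj; rewrite -e -e'.
Qed.


(** The factor 2 lost in [quadrant_integral] is exactly the factor 2 between the Wiener norm and the
    sum over positive modes. The bound C does not depend on N, so it controls the full series. *)
Lemma sign_cell_integral C : (forall (n : nat) (F : 'I_n -> set R),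
        (forall i, measurable (F i)) -> (forall i, F i `<=` half_line R) ->
        trivIset setT F -> (\sum_(i < n) wiener_norm 4%:R (m (F i)) <= C%:E)%E) ->
  (\sum_(0 <= i < N) (wpow 4 i)%:E * \int[leb R]_(t in `[0%R, T]) (cnorm (B i t))%:E <= C%:E)%E.
Proof.
move=> hC; rewrite big_mkord; apply: le_trans (hC _ sign_cell _ _ _); last first.
- exact: trivIset_sign_cell.
- by move=> j t [/=]; rewrite half_line_ge0 in_itv/= => /andP[].
- exact: measurable_sign_cell.
have cover : \big[setU/set0]_(j <- index_enum 'I_#|J|) sign_cell j = `[0, T]%classic.
  rewrite -bigcup_seq; apply/seteqP; split=> [t [j _ []]//|t tT].
  by exists (enum_rank (signs t)) => /=; rewrite ?mem_index_enum// /sign_cell/= enum_rankK.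
have split_cells (i : 'I_N) : (\int[leb R]_(t in `[0%R, T]) (cnorm (B i t))%:E =
    \sum_(j < #|J|) \int[leb R]_(t in sign_cell j) (cnorm (B i t))%:E)%E.
  rewrite -cover ge0_integral_bigsetU//.
  - exact: measurable_sign_cell.
  - exact: index_enum_uniq.
  - exact: sub_trivIset trivIset_sign_cell.
  - apply/measurable_EFinP; apply: measurable_funS (cmeas_norm (mB i)) => //.
  - by move=> t _; rewrite lee_fin cnorm_ge0.
under eq_bigr => i _.
  rewrite split_cells ge0_sume_distrr; last by move=> j _; apply: integral_ge0 => t _; rewrite
    lee_fin cnorm_ge0.
  over.
rewrite exchange_big/=; apply: lee_sum => j _.
have sT : sign_cell j `<=` `[0, T]%classic by move=> t [].
have mS := measurable_sign_cell j.
have [wF _ _] := vm; have /wienerP[_ [cm m0] _] : wiener 4%:R (m (sign_cell j)).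
  by apply: wF => // t /sT; rewrite half_line_ge0/= in_itv/= => /andP[].
rewrite wiener_normE//.
apply: (@le_trans _ _ (\sum_(0 <= i < N) 2%:E * (wpow 4 i * cnorm (modes (m (sign_cell j))
  i))%:E)%E).
  rewrite big_mkord; apply: lee_sum => i _.
  rewrite mE// (_ : (2%:E * _ = (wpow 4 i)%:E * (2 * cnorm (cint (leb R) (sign_cell j) (B
    i)))%:E)%E); last first.
    by rewrite -!EFinM; congr (_%:E); ring.
  apply: lee_wpmul2l; first by rewrite lee_fin wpow_ge0.
  apply: (@quadrant_integral _ _ _ ((enum_val j : J) i)) => //.
    by apply: (@cintegrableS _ _ R (leb R) _ `[0, T]%classic) => //; exact: iB.
  by move=> t [_ /= <-]; rewrite ffunE.
rewrite -ge0_sume_distrr; last by move=> i _; rewrite lee_fin mulr_ge0 ?wpow_ge0 ?cnorm_ge0.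
apply: lee_wpmul2l; first by rewrite lee_fin.
by apply: nneseries_lim_ge => i *; rewrite lee_fin mulr_ge0 ?wpow_ge0 ?cnorm_ge0.
Qed.

End VectorMeasureCells.

(** * A bounded measurable representative of the modes *)

Section WeakSolutionRepresentative.
Context {R : realType}.
Variables (nu : R) (h : R -> R -> R).
Hypotheses (nu_gt0 : 0 < nu) (hL : Linfty_wiener 1 h) (hV : in_wiener_vmeasure 4 h).

Lemma w4_le_wpow k : w4 nu k <= (1 + nu) * wpow 4 k.
Proof.
rewrite /w4 /lam /wpow; set x : R := k.+1%:R; have x1 : 1 <= x by rewrite ler1n.
have -> : (1 + nu) * x ^+ 4 = x * (nu * x ^+ 3 + x ^+ 3) by ring.
apply: ler_wpM2l; first by rewrite (le_trans ler01).
by rewrite lerD2l exprS ler_peMr ?(le_trans ler01)// exprn_ege1.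
Qed.

(** B consists of the modes where their A^1 size is at most M, and is 0 elsewhere, in particular for
    [t < 0]: it is measurable and bounded at every time, and among nonnegative times it differs from
    the modes on a null set only. The dissipation bound is the variation bound of the vector measure
    times [1 + nu], by [w4_le_wpow]. *)
Lemma weak_solution_representative : exists (B : nat -> R -> R[i]) (M C : R),
  [/\ 0 <= M /\ 0 <= C, forall n, cmeas setT (B n),
    forall t, (wsum w1 (B^~ t) <= M%:E)%E,
    {ae leb R, forall t, 0 <= t -> forall n, B n t = modes (h t) n} &
    forall T, (\int[leb R]_(t in `[0%R, T]) wsum (w4 nu) (B^~ t) <= C%:E)%E].
Proof.
have [wh mh [M0 hM0]] := hL; have [m [vm mE]] := hV.
have mm k : cmeas (half_line R) (fun t => modes (h t) k) by exact: wiener_measurable_modes.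
pose M := Num.max M0 0; have M_ge0 : 0 <= M by rewrite le_max lexx orbT.
have mH : measurable (half_line R) by exact: measurable_half_line.
pose G := half_line R `&` [set t | (wsum w1 (modes (h t)) <= M%:E)%E].
have mG : measurable G.
  by apply: emeasurable_fun_infty_c => //; apply: measurable_wsum.
pose B n t : R[i] := if t \in G then modes (h t) n else 0.
have mB n : cmeas setT (B n).
  have [m1 m2] := cmeasS mH (@subIsetl _ _ _) (mm n) : cmeas G _.
  have [r1 r2] := (measurable_restrictT (fun t => cRe (modes (h t) n)) mG,
    measurable_restrictT (fun t => cIm (modes (h t) n)) mG).
  split; [have := r1.1 m1|have := r2.1 m2]; congr (measurable_fun _ _);
    by apply/funext => t; rewrite /patch /B; case: ifP.
have bB t : (wsum w1 (B^~ t) <= M%:E)%E.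
  case: (boolP (t \in G)) => tG.
    have -> : B^~ t = modes (h t) by apply/funext => n; rewrite /B tG.
    by have [_] := set_mem tG.
  rewrite (_ : wsum _ _ = 0%E) ?lee_fin//; apply: eseries0 => n _ _.
  by rewrite /B (negbTE tG) cnorm0 mulr0.
have BE : {ae leb R, forall t, 0 <= t -> forall n, B n t = modes (h t) n}.
  have FF := ae_filter_ringOfSetsType (leb R).
  apply: filterS hM0 => t ht t0 n; rewrite /B ifT//; apply/mem_set; split => //=.
    by rewrite half_line_ge0.
  have /(@wienerP _ 1)[_ [iht ht0] _] := wh _ t0.
  have := ht t0; rewrite (@wiener_normE _ 1)// => le2.
  apply: (@le_trans _ _ (2%:E * wsum w1 (modes (h t)))%E).
    by apply: lee_pemull; rewrite ?wsum_ge0 ?lee_fin ?ler1n// => k; exact: w1_ge0.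
  by apply: le_trans le2 _; rewrite lee_fin le_max lexx.
have [wm _ [C hC]] := vm.
have C_ge0 : 0 <= C.
  by have := hC 0%N (fun=> set0); rewrite big_ord0 lee_fin; apply => -[].
exists B, M, ((1 + nu) * C); split => //; first by split=> //; rewrite mulr_ge0// addr_ge0// ltW.
move=> T; case: (leP 0 T) => T0; last first.
  by rewrite set_itv_ge ?integral_set0 ?lee_fin ?mulr_ge0 ?addr_ge0 ?(ltW nu_gt0)// bnd_simp -ltNge.
have iB n : tintegrable T (B n).
  apply: (cintegrable_le (f := cst M)) => //; first by apply: cmeasS (mB n).
    by apply: continuous_compact_integrable; [exact:
      segment_compact|exact/continuous_subspaceT/cst_continuous].
  move=> t _; rewrite -lee_fin; apply: le_trans (bB t).
  apply: le_trans (wsum_term (B^~ t) n (@w1_ge0 R)).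
  by rewrite lee_fin ler_peMl ?cnorm_ge0 ?ler1n.
have BmE E : measurable E -> E `<=` `[0, T]%classic ->
    forall n, modes (m E) n = cint (leb R) E (B n).
  move=> ? ET n; rewrite /modes (mE T)// /cintegral.
  have FF := ae_filter_ringOfSetsType (leb R).
  congr Complex; apply: ae_eq_Rintegral => //; apply: filterS BE => t bt /ET;
    by rewrite /= in_itv/= => /andP[t0 _]; rewrite bt.
rewrite integral_wsum//; [|by move=> n; exact: w4_ge0|by move=> n; apply: cmeasS (mB n)].
apply: nneseries_le_bound => [n|N].
  by rewrite mule_ge0 ?lee_fin ?w4_ge0//; apply: integral_ge0 => t _; rewrite lee_fin cnorm_ge0.
apply: (@le_trans _ _ ((1 + nu)%:E *
    \sum_(0 <= i < N) (wpow 4 i)%:E * \int[leb R]_(t in `[0%R, T]) (cnorm (B i t))%:E)%E).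
  rewrite ge0_sume_distrr; last first.
    move=> i _; rewrite mule_ge0 ?lee_fin ?wpow_ge0//.
    by apply: integral_ge0 => t _; rewrite lee_fin cnorm_ge0.
  apply: lee_sum => i _; rewrite muleA; apply: lee_wpmul2r.
    by apply: integral_ge0 => t _; rewrite lee_fin cnorm_ge0.
  by rewrite -EFinM lee_fin w4_le_wpow.
rewrite EFinM; apply: lee_wpmul2l; first by rewrite lee_fin addr_ge0// ltW.
exact: (sign_cell_integral mB iB vm BmE N hC).
Qed.

End WeakSolutionRepresentative.

(** * Vanishing primitives and dominated convergence *)

Section WeakDuhamel.
Context {R : realType}.

(** Lebesgue differentiation on each [[0, n]], where the extension of f by zero is integrable on the
    line. *)
Lemma primitive_zero_ae (f : R -> R) :
  (forall T, (leb R).-integrable `[0, T] (EFin \o f)) ->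
  (forall T, 0 <= T -> \int[leb R]_(t in `[0, T]) f t = 0) ->
  {ae leb R, forall t, 0 <= t -> f t = 0}.
Proof.
move=> fi f0; have FF := ae_filter_ringOfSetsType (leb R).
suff h n : {ae leb R, forall t, 0 < t < n%:R -> f t = 0}.
  have nz : {ae leb R, forall y : R, y <> 0}.
    exists [set (0 : R)]; split; [exact: measurable_set1|exact: lebesgue_measure_set1|].
    by move=> y /=; apply: contra_notP.
  apply: filterS2 nz (ae_foralln h) => t t0 ht; rewrite le_eqVlt => /predU1P[/esym//|t_gt0].
  by apply: (ht (Num.truncn t).+1); rewrite t_gt0 truncnS_gt.
pose D := `[0, n%:R]%classic : set R; have mD : measurable D by exact: measurable_itv.
pose g := f \_ D.
have gi E : measurable E -> (leb R).-integrable E (EFin \o g).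
  move=> mE; apply: (@integrableS _ _ R (leb R) setT) => //.
  by rewrite /g -restrict_EFin; apply: (iffLR (@integrable_mkcond _ _ R (leb R) _ _ mD)); exact: fi.
have := @FTC1 R g (BLeft 0) (fun y => gi _ (measurable_itv _)) (integrable_locally mD (fi n%:R)).
apply: filterS => t /= ht /andP[t0 tn].
have [|_] := ht; first by rewrite lte_fin.
rewrite /g patchE mem_set; last by rewrite /D/= in_itv/= !ltW.
move=> <-; rewrite derive1E (@near_eq_derive _ _ _ _ (cst 0)) ?derive_cst//.
near=> y; rewrite -[RHS](f0 y); last by apply: ltW; near: y; exact: lt_nbhsr.
apply: eq_Rintegral => s; rewrite inE/= in_itv/= => /andP[s0 sy].
rewrite patchE mem_set// /D/= in_itv/= s0 (le_trans sy)// ltW//.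
by near: y; exact: lt_nbhsl.
Unshelve. all: by end_near.
Qed.

Lemma cprimitive_zero_ae (F : R -> R[i]) : (forall T, tintegrable T F) ->
  (forall T, 0 <= T -> tint T F = 0) -> {ae leb R, forall t, 0 <= t -> F t = 0}.
Proof.
move=> iF F0; have FF := ae_filter_ringOfSetsType (leb R).
have h1 := @primitive_zero_ae (fun t => cRe (F t)) (fun T => (iF T).1) (fun T T0 => congr1 (fun z
  : R[i] => cRe z) (F0 T T0)).
have h2 := @primitive_zero_ae (fun t => cIm (F t)) (fun T => (iF T).2) (fun T T0 => congr1 (fun z
  : R[i] => cIm z) (F0 T T0)).
by apply: filterS2 h1 h2 => t e1 e2 t0; apply: complex_ext; rewrite ?e1 ?e2.
Qed.

Lemma cint_dominated (D : set R) (F : nat -> R -> R[i]) (G : R -> R[i]) (g : R -> R) :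
  measurable D -> (forall j, cmeas D (F j)) -> (leb R).-integrable D (EFin \o g) ->
  (forall j t, D t -> cnorm (F j t) <= g t) ->
  (forall t, D t -> cnorm (F j t - G t) @[j --> \oo] --> 0) ->
  (forall j, cint (leb R) D (F j) = 0) -> cint (leb R) D G = 0.
Proof.
move=> mD mF ig Fg lim F0.
have key (p : R[i] -> R) : (forall z w, p (z - w) = p z - p w) ->
    (forall z, `|p z| <= cnorm z) -> (forall j, measurable_fun D (fun t => p (F j t))) ->
    (forall j, (\int[leb R]_(t in D) (p (F j t))%:E = 0)%E) -> \int[leb R]_(t in D) p (G t) = 0.
  move=> pB pn mp p0.
  have h : (\int[leb R]_(t in D) (p (F j t))%:E)%E @[j --> \oo] -->
      (\int[leb R]_(t in D) (p (G t))%:E)%E.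
    apply: (@dominated_cvg _ _ _ (leb R) D mD _ _ (EFin \o g)) => //.
    - by move=> j; apply/measurable_EFinP; exact: mp.
    - move=> t Dt; apply: cvg_EFin; first exact: nearW.
      apply/cvgrPdist_le => e e0; have /cvgrPdist_le/(_ _ e0) := lim _ Dt.
      apply: filterS => j; rewrite sub0r normrN ger0_norm ?cnorm_ge0//.
      by apply: le_trans; rewrite distrC -pB.
    - by move=> j t Dt; rewrite lee_fin; apply: le_trans (pn _) (Fg _ _ Dt).
  have {}h : (\int[leb R]_(t in D) (p (G t))%:E = 0)%E.
    rewrite -(cvg_lim (@ereal_hausdorff R) h).
    by apply: (cvg_lim (@ereal_hausdorff R)); apply: cvg_near_cst; apply: nearW => j; exact: p0.
  by rewrite /Rintegral h.
have iF j : cintegrable (leb R) D (F j) by exact: (@cintegrable_le _ _ R (leb R) D (F j) g mD (mF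
  j) ig (Fg j)).
apply: complex_ext; rewrite /=.
  apply: (key (fun z => cRe z)) => [z w|z|j|j]; first by rewrite cReD cReN.
  - exact: Re_le_cnorm.
  - by case: (mF j).
  - rewrite -[LHS]fineK; first by rewrite (congr1 (fun z : R[i] => cRe z) (F0 j) : fine _ = _).
    by apply: integrable_fin_num => //; case: (iF j).
apply: (key (fun z => cIm z)) => [z w|z|j|j]; first by rewrite cImD cImN.
- exact: Im_le_cnorm.
- by case: (mF j).
- rewrite -[LHS]fineK; first by rewrite (congr1 (fun z : R[i] => cIm z) (F0 j) : fine _ = _).
  by apply: integrable_fin_num => //; case: (iF j).
Qed.

End WeakDuhamel.

(** * Duhamel's formula for an arbitrary solution *)

Section WeakSolutionDuhamel.
Context {R : realType}.

(** The index q counts the space derivatives of [2 c Re (v e^{i (n + 1) x})], whose only nonzero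
    positive mode can be v at index n; with it the family meets the closure hypotheses for
    [tensor_span]. *)
Definition mode_test (v : R[i]) n (q : nat) (x : R) : R :=
  2 * cth * cRe (v * Complex 0 n.+1%:R ^+ q * cis (n.+1%:R * x)).

Lemma mode_test_derive v n q x :
  is_derive (x : R^o) 1 (mode_test v n q : R^o -> R^o) (mode_test v n q.+1 x).
Proof.
rewrite /mode_test; set N : R := n.+1%:R.
have -> : v * Complex 0 N ^+ q.+1 = v * Complex 0 N ^+ q * Complex 0 N by rewrite exprSr mulrA.
move: (v * _) => w.
have dc : is_derive (x : R^o) 1 (fun y : R^o => N * y : R^o) N.
  by apply: is_derive_eq; rewrite /GRing.scale/=; ring.
have d1 : is_derive (x : R^o) 1 (fun y : R^o => cos (N * y) : R^o) (- sin (N * x) * N).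
  exact: (is_derive1_comp (f := cos) (g := fun y => N * y)).
have d2 : is_derive (x : R^o) 1 (fun y : R^o => sin (N * y) : R^o) (cos (N * x) * N).
  exact: (is_derive1_comp (f := sin) (g := fun y => N * y)).
have -> : (fun y => 2 * cth * cRe (w * cis (N * y))) =
    (fun y => 2 * cth * (cRe w * cos (N * y) - cIm w * sin (N * y))).
  by apply/funext => y; rewrite cReM.
apply: is_derive_eq; rewrite /GRing.scale/= !cReM !cImM/=; ring.
Qed.

Lemma mode_test_synth v n : mode_test v n 0 = synth (fun k => if k == n then v else 0).
Proof.
apply/funext => x; rewrite /mode_test /synth expr0 mulr1; congr (_ * cRe _).
rewrite -[LHS](csum_delta n); apply: eq_csum => k.
by case: eqVneq => [->|_]; rewrite ?mul0r.
Qed.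

Lemma summable_delta n (v : R[i]) : summable_seq (fun k => if k == n then v else 0).
Proof.
have := summable_finite (fun k => if k == n then v else 0) n.+1.
by congr summable_seq; apply/funext => k; case: eqVneq => [->|_]; rewrite ?ltnSn ?if_same.
Qed.

Lemma bump0 (lm tau eps : R) p t : tau <= t -> bump lm tau eps p t = 0.
Proof. by move=> tt; rewrite /bump ltNge tt. Qed.

Lemma dbump0 (lm tau eps : R) p t : tau <= t -> dbump lm tau eps p t = 0.
Proof. by move=> tt; rewrite /dbump !bump0// !mulr0 !addr0. Qed.


Lemma bump_continuous (lm tau eps : R) p : 0 < eps -> continuous (bump lm tau eps p).
Proof.
move=> e0 t; apply: differentiable_continuous; apply/derivable1_diffP.
by have /@ex_derive := bump_derive lm tau e0 p t.
Qed.

Lemma dbump_continuous (lm tau eps : R) p : 0 < eps -> continuous (dbump lm tau eps p).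
Proof.
move=> e0 t; apply: cvgD; [apply: cvgD|]; apply: cvgM;
  by [exact: cvg_cst|exact: bump_continuous].
Qed.

Lemma tintegrableM_ccont T (q F : R -> R[i]) : ccont q -> tintegrable T F ->
  tintegrable T (fun t => q t * F t).
Proof.
move=> cq iF; have [T0|T0] := leP 0 T; last first.
  rewrite /tintegrable set_itv_ge ?bnd_simp -?ltNge//.
  by split; exact: integrable_set0.
have /cintegrableP[//|m1 _] := iF.
pose g t := `|cRe (q t)| + `|cIm (q t)|.
have cg : continuous g.
  by move=> t; apply: cvgD; apply: cvg_norm; [exact: cq.1|exact: cq.2].
have [c _ gc] := EVT_max T0 (continuous_subspaceT cg).
apply: (@cintegrable_le _ _ R (leb R) _ _ (fun t => g c * cnorm (F t))) => //.
- apply: cmeasM => //; exact: ccont_cmeas.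
- apply: integrableRZ => //; exact: (@cintegrable_norm _ _ R (leb R)).
- move=> t tT; rewrite Normc.normcM ler_wpM2r ?cnorm_ge0//.
  by apply: le_trans (cnorm_le _) _; exact: gc.
Qed.

Lemma cRe_mulCA_RC (x : R) (y z : R[i]) : cRe (y * (RC x * z)) = x * cRe (y * z).
Proof. by rewrite -cReMR mulrCA. Qed.

Variables (nu : R) (f0 : R -> R) (h : R -> R -> R) (B : nat -> R -> R[i]) (M C : R).
Hypotheses (nu_gt0 : 0 < nu) (hf0 : wiener 1 f0) (wh : forall t, 0 <= t -> wiener 1 (h t))
  (eqh : weak_equation nu f0 h) (M_ge0 : 0 <= M) (C_ge0 : 0 <= C)
  (mB : forall n, cmeas setT (B n)) (bB : forall t, (wsum w1 (B^~ t) <= M%:E)%E)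
  (BE : {ae leb R, forall t, 0 <= t -> forall n, B n t = modes (h t) n})
  (iB4 : forall T, (\int[leb R]_(t in `[0%R, T]) wsum (w4 nu) (B^~ t) <= C%:E)%E).
Let N n t := NN nu cth B B n t.

Lemma representative_bound n t : cnorm (B n t) <= M.
Proof.
rewrite -lee_fin; apply: le_trans (bB t).
apply: le_trans (wsum_term (B^~ t) n (@w1_ge0 R)).
by rewrite lee_fin ler_peMl ?cnorm_ge0 ?ler1n.
Qed.

Lemma representative_tintegrable n T : tintegrable T (B n).
Proof.
apply: (@cintegrable_le _ _ R (leb R) _ _ (cst M)) => //.
- exact: (cmeasS _ _ (mB n)).
- by apply: continuous_compact_integrable; [exact:
  segment_compact|exact/continuous_subspaceT/cst_continuous].
- by move=> t _; exact: representative_bound.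
Qed.

Lemma forcing_int T : (\int[leb R]_(s in `[0%R, T]) wsum w1 (N^~ s) <= (2 * cth * (C * M))%:E)%E.
Proof. by apply: NN_int => //; exact: cth_gt0. Qed.

Lemma forcing_cmeas n : cmeas setT (N n).
Proof. exact: NN_cmeas. Qed.

Lemma forcing_tintegrable n T : tintegrable T (N n).
Proof.
apply: (@tintegrable_wsum R w1 N T) => //; last exact: le_lt_trans (forcing_int T) (ltry _).
- by move=> k; rewrite ler1n.
- exact: forcing_cmeas.
Qed.

(** A bump in time multiplied by a pure mode in space is an admissible test function, and Parseval
    reduces each spatial integral to twice the real part of [conj v] times the mode n. *)
Lemma weak_mode_test (v : R[i]) n tau eps : 0 < eps -> 0 <= tau ->
  let th := bump (lam nu n) tau eps 0 in let dth := dbump (lam nu n) tau eps 0 in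
  let D := `[0, tau]%classic in
  cRe (conjc v * cint (leb R) D (fun t => RC (dth t) * B n t)) +
    cRe (conjc v * (RC (th 0) * modes f0 n)) =
  cRe (conjc v * cint (leb R) D (fun t => RC (th t) * (RC (lam nu n) * B n t - N n t))).
Proof.
move=> eps0 tau0 th dth D.
pose phi (z : R^o * R^o) : R^o := th z.1 * mode_test v n 0 z.2.
have hF p t : is_derive (t : R^o) 1 (bump (lam nu n) tau eps p : R^o -> R^o)
  (dbump (lam nu n) tau eps p t) by exact: bump_derive.
have hG := mode_test_derive v n.
have sphi : smooth phi.
  apply: (@tensor_span_smooth R (bump (lam nu n) tau eps) (mode_test v n) _ _ hF hG) => [p q|p q|].
  - have -> : (fun z : R^o * R^o => dbump (lam nu n) tau eps p z.1 * mode_test v n q z.2) =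
      (fun z => (lam nu n * (bump (lam nu n) tau eps p z.1 * mode_test v n q z.2) +
        (p%:R - 1) * (bump (lam nu n) tau eps p.+1 z.1 * mode_test v n q z.2)) +
        (- eps) * (bump (lam nu n) tau eps p.+2 z.1 * mode_test v n q z.2)).
      by apply/funext => z; rewrite /dbump; ring.
    by do !apply: TensorD; apply: TensorZ; exact: TensorElem.
  - exact: (TensorElem _ _ p q.+1).
  - exact: (TensorElem _ _ 0 0).
pose z0 k : R[i] := if k == n then v else 0.
have sz0 : summable_seq z0 by exact: summable_delta.
have G0 : mode_test v n 0 = synth z0 by exact: mode_test_synth.
have per t : periodic (fun x : R => phi (t, x)) (2 * pi).
  by move=> x; rewrite /phi/= G0 synth_periodic.
have tphi : spacetime_test phi.
  by split=> //; exists tau => t x tt; rewrite /phi/= /th bump0// mul0r.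
have iG : cintble (mode_test v n 0) by rewrite G0; exact: synth_cintble.
have phitE t x : phit phi (t, x) = dth t * mode_test v n 0 x.
  have /@derive_val <- := phi_derive_t sphi t x.
  have d : is_derive (t : R^o) 1 (fun s : R^o => th s * mode_test v n 0 x : R^o) (dth t *
    mode_test v n 0 x).
    have d1 : is_derive (t : R^o) 1 (th : R^o -> R^o) (dth t) := hF 0 t.
    by apply: is_derive_eq; rewrite /GRing.scale/=; ring.
  by have /@derive_val := d.
have phixE t x : phix phi (t, x) = th t * mode_test v n 1 x.
  have /@derive_val <- := phi_derive_x sphi t x.
  have d : is_derive (x : R^o) 1 (fun y : R^o => th t * mode_test v n 0 y : R^o) (th t *
    mode_test v n 1 x).
    by have d1 := hG 0 x; apply: is_derive_eq; rewrite /GRing.scale/=; ring.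
  by have /@derive_val := d.
have pmE t k : modes (fun x => phi (t, x)) k = RC (th t) * z0 k.
  rewrite -[in RHS](modes_synth sz0) -G0.
  exact: (fourierZ (th t) k.+1%:Z iG).
have pairE u : cintble u ->
    \int[leb R]_(x in circle R) (u x * mode_test v n 0 x) = 2 * cRe (conjc v * modes u n).
  move=> iu; rewrite G0; under eq_Rintegral do rewrite mulrC.
  rewrite parseval//; congr (2 * _).
  have -> : (fun k => z0 k * conjc (modes u k)) = fun k => if k == n then v * conjc (modes u n)
    else 0.
    by apply/funext => k; rewrite /z0; case: eqVneq => [->|_]; rewrite ?mul0r.
  by rewrite csum_delta; move: (modes u n) => m; rewrite !cReM !cReJ !cImJ; ring.
have FF := ae_filter_ringOfSetsType (leb R); have mC := @measurable_circle R.
have mD : measurable D by exact: measurable_itv.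
have DH : D `<=` half_line R.
  by move=> t; rewrite /D/= in_itv/= half_line_ge0 => /andP[].
have D0 t : D t -> 0 <= t by move=> /DH; rewrite half_line_ge0.
have outD t : half_line R t -> ~ D t -> tau <= t.
  rewrite half_line_ge0 /D/= in_itv/= => t0 nD.
  by rewrite leNgt; apply/negP => tT; apply: nD; rewrite t0 ltW.
have ih t : 0 <= t -> mean0 (h t) by move=> /wh/(@wienerP _ 1)[].
have [_ [if0 _] _] := (@wienerP R 1 f0).1 hf0.
have pull (F : R -> R[i]) : cintegrable (leb R) D F ->
    2 * cRe (conjc v * cint (leb R) D F) = \int[leb R]_(t in D) (2 * cRe (conjc v * F t)).
  move=> iF; have [i1 _] : cintegrable (leb R) D (fun t => conjc v * F t) by exact: cintegrableZ.
  rewrite -cintZ// -[cRe (cint _ _ _)]/(\int[leb R]_(t in D) cRe (conjc v * F t)).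
  by rewrite -RintegralZl.
have := eqh tphi; cbv zeta.
have -> : \int[leb R]_(t in half_line R) \int[leb R]_(x in circle R)
      (h t x * 'D_((1, 0) : R^o * R^o) phi (t, x)) =
    2 * cRe (conjc v * cint (leb R) D (fun t => RC (dth t) * B n t)).
  rewrite (@Rintegral_support _ _ D)//; last 2 first.
  - exact: measurable_half_line.
  - move=> t Ht nD; rewrite (@eq_Rintegral _ _ _ (leb R) _ (cst 0)).
      by rewrite Rintegral_cst// mul0r.
    move=> x _; rewrite -[X in _ * X]/(phit phi (t, x)) phitE /dth dbump0 ?mul0r ?mulr0//.
    exact: outD.
  rewrite pull; last first.
    by apply: tintegrableM_ccont; [apply: ccontR; exact: dbump_continuous|exact:
      representative_tintegrable].
  apply: ae_eq_Rintegral => //; apply: filterS BE => t bt Dt.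
  have t0 := D0 _ Dt; have [iht _] := ih _ t0.
  rewrite (@eq_Rintegral _ _ _ (leb R) _ (fun x => dth t * (h t x * mode_test v n 0 x))); last
    first.
    by move=> x _; rewrite -[X in _ * X = _]/(phit phi (t, x)) phitE mulrCA.
  rewrite RintegralZl//; last first.
    by rewrite G0; exact: (synthM_cintble sz0 iht).
  rewrite pairE// bt// mulrCA; congr (2 * _).
  by rewrite cRe_mulCA_RC.
have -> : \int[leb R]_(x in circle R) (f0 x * phi (0, x)) =
    2 * cRe (conjc v * (RC (th 0) * modes f0 n)).
  rewrite (@eq_Rintegral _ _ _ (leb R) _ (fun x => th 0 * (f0 x * mode_test v n 0 x))); last first.
    by move=> x _; rewrite mulrCA.
  rewrite RintegralZl//; last first.
    by rewrite G0; exact: (synthM_cintble sz0 if0).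
  rewrite pairE// mulrCA; congr (2 * _).
  by rewrite cRe_mulCA_RC.
have -> : \int[leb R]_(t in half_line R) \int[leb R]_(x in circle R)
      ((nu * Lambda 3 (h t) x + Lambda 1 (h t) x) * phi (t, x) +
        hilbert_comm (h t) (fun x => nu * Lambda 3 (h t) x + Lambda 1 (h t) x) x *
        'D_((0, 1) : R^o * R^o) phi (t, x)) =
    2 * cRe (conjc v * cint (leb R) D (fun t => RC (th t) * (RC (lam nu n) * B n t - N n t))).
  rewrite (@Rintegral_support _ _ D)//; last 2 first.
  - exact: measurable_half_line.
  - move=> t Ht nD; rewrite (@eq_Rintegral _ _ _ (leb R) _ (cst 0)).
      by rewrite Rintegral_cst// mul0r.
    move=> x _; rewrite -[X in _ + _ * X]/(phix phi (t, x)) phixE /phi/= /th.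
    by rewrite bump0 ?mul0r ?mulr0 ?addr0//; exact: outD.
  rewrite pull; last first.
    apply: tintegrableM_ccont; first by apply: ccontR; exact: bump_continuous.
    apply: cintegrableB => //; last exact: forcing_tintegrable.
    by apply: cintegrableZ => //; exact: representative_tintegrable.
  have w4fin : (\int[leb R]_(t in D) wsum (w4 nu) (B^~ t) < +oo)%E by apply: le_lt_trans (iB4
    tau) (ltry _).
  apply: ae_eq_Rintegral => //.
  apply: filterS2 BE (wsum_ae_fin (@w4_ge0 R nu nu_gt0) mB w4fin) => t bt ft Dt.
  have t0 := D0 _ Dt; have hB : modes (h t) = B^~ t by apply/funext => k; rewrite bt.
  rewrite -[LHS]/(\int[leb R]_(x in circle R) (flux nu (h t) x * phi (t, x) +
    hilbert_comm (h t) (flux nu (h t)) x * phix phi (t, x))).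
  rewrite (slice_pairing nu_gt0); last 5 first.
  - exact: ih.
  - by rewrite hB; exact: ft.
  - by apply: cintble_continuous; apply: continuous_slice; exact: phi_continuous.
  - exact: phix_cintble.
  - by move=> k; exact: (phix_modes sphi).
  congr (2 * _); rewrite hB.
  have -> : (fun k => (RC (lam nu k) * B k t - Nl nu cth (B^~ t) (B^~ t) k) *
      conjc (modes (fun x => phi (t, x)) k)) =
      fun k => if k == n then (RC (lam nu n) * B n t - N n t) * conjc (RC (th t) * v) else 0.
    apply/funext => k; rewrite pmE /z0; case: eqVneq => [->//|_].
    by rewrite mulr0 conjc0 mulr0.
  rewrite csum_delta; move: (RC (lam nu n) * B n t - N n t) => y.
  by case: y v {sphi z0 sz0 G0 per tphi iG phitE phixE pmE pairE pull phi hG} => a b [c d] /=; ring.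
by rewrite -mulrDr => /mulfI; apply; rewrite pnatr_eq0.
Qed.

(** A complex number is determined by the real parts obtained with [v = 1] and [v = i]. *)
Lemma weak_mode_identity n tau eps : 0 < eps -> 0 <= tau ->
  let th := bump (lam nu n) tau eps 0 in let dth := dbump (lam nu n) tau eps 0 in
  let D := `[0, tau]%classic in
  cint (leb R) D (fun t => RC (dth t) * B n t) + RC (th 0) * modes f0 n =
  cint (leb R) D (fun t => RC (th t) * (RC (lam nu n) * B n t - N n t)).
Proof.
move=> e0 tau0 th dth D.
have h1 := weak_mode_test 1 n e0 tau0; have h2 := weak_mode_test (Complex 0 1) n e0 tau0.
move: h1 h2; cbv zeta; rewrite -/th -/dth -/D.
move: (cint _ _ _) (RC (th 0) * _) (cint _ _ _) => [a b] [c d] [e f].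
rewrite !cReM/= !(oppr0, mul0r, mul1r, subr0, opprK, sub0r, mulN1r) => h1 h2.
by apply: complex_ext; rewrite /= ?h1 ?h2.
Qed.

(** The forcing is computed from B and not from the function being defined; that this makes no
    difference is shown once the two agree almost everywhere. *)
Definition weak_mild n (t : R) : R[i] := Sm nu (modes f0) N n t.

(** B and [weak_mild] satisfy the same tested identity with the same datum and forcing. In the
    difference these cancel, and the cut-off only enters through [dbump 0 - lam bump 0 = - (bump 1 +
    eps bump 2)]. *)
Lemma weak_mild_identity n tau eps : 0 < eps -> 0 <= tau ->
  cint (leb R) `[0, tau]
    (fun t => RC (bump (lam nu n) tau eps 1 t + eps * bump (lam nu n) tau eps 2 t) *
      (B n t - weak_mild n t)) = 0.
Proof.
move=> e0 tau0; set D := `[0, tau]%classic.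
have mD : measurable D by exact: measurable_itv.
have h1 := weak_mode_identity n e0 tau0; move: h1; cbv zeta.
rewrite -/D; set th := bump _ _ _ 0; set dth := dbump _ _ _ 0 => h1.
have cd : ccont (fun t => RC (dth t)) by apply: ccontR; exact: dbump_continuous.
have ct : ccont (fun t => RC (th t)) by apply: ccontR; exact: bump_continuous.
have h2 := duh_pairing (lam nu n) (modes f0 n) (forcing_tintegrable n) tau0 cd.
have ftc t : 0 <= t -> t <= tau -> cint (leb R) `[t, tau] (fun s => RC (dth s)) = - RC (th t).
  move=> t0 tt; transitivity (RC (th tau - th t)); last by rewrite /th bump0// sub0r rmorphN.
  rewrite cintR; congr (RC _); apply: FTC_full => //; first exact: dbump_continuous.
  by move=> x; exact: bump_derive.
pose A t := weak_mild n t.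
have cA : ccont A by apply: duh_ccont; exact: forcing_tintegrable.
have iA : tintegrable tau A by exact: ccont_tintegrable.
have iB := representative_tintegrable n tau; have iN := forcing_tintegrable n tau.
have {}h2 : cint (leb R) D (fun t => RC (dth t) * A t) =
    - (RC (th 0) * modes f0 n) + cint (leb R) D (fun t => RC (th t) * (RC (lam nu n) * A t - N n
      t)).
  rewrite -[LHS](@eq_cint _ _ _ (leb R) _ (fun t => A t * RC (dth t))); last by move=> t _;
    rewrite mulrC.
  rewrite [LHS]h2 ftc// mulrN [RC _ * _]mulrC; congr (_ + _).
  apply: eq_cint => t; rewrite /= in_itv/= => /andP[t0 tt].
  by rewrite ftc// mulrN -mulNr opprB mulrC.
have iX (F : R -> R[i]) : tintegrable tau F -> tintegrable tau (fun t => RC (lam nu n) * F t - N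
  n t).
  by move=> iF; apply: cintegrableB => //; exact: cintegrableZ.
have e1 : cint (leb R) D (fun t => RC (dth t) * B n t - RC (th t) * (RC (lam nu n) * B n t - N n
  t)) =
    - (RC (th 0) * modes f0 n).
  rewrite cintB//; [|exact: tintegrableM_ccont|by apply: tintegrableM_ccont => //; exact: iX].
  by rewrite -h1 opprD addNKr.
have e2 : cint (leb R) D (fun t => RC (dth t) * A t - RC (th t) * (RC (lam nu n) * A t - N n t)) =
    - (RC (th 0) * modes f0 n).
  rewrite cintB//; [|exact: tintegrableM_ccont|by apply: tintegrableM_ccont => //; exact: iX].
  by rewrite h2 addrK.
have iY (F : R -> R[i]) : tintegrable tau F ->
    tintegrable tau (fun t => RC (dth t) * F t - RC (th t) * (RC (lam nu n) * F t - N n t)).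
  move=> iF; apply: cintegrableB => //; apply: tintegrableM_ccont => //; exact: iX.
have e3 : cint (leb R) D (fun t =>
   (RC (dth t) * A t - RC (th t) * (RC (lam nu n) * A t - N n t)) -
   (RC (dth t) * B n t - RC (th t) * (RC (lam nu n) * B n t - N n t))) = 0.
  rewrite cintB//; [|exact: iY|exact: iY].
  by rewrite e1 e2 subrr.
rewrite -[RHS]e3; apply: eq_cint => t _; rewrite /dth /dbump -/th -/(A t).
rewrite sub0r mulN1r !mulNr [RC (_ + _)]rmorphD [RC (_ - _ - _)]rmorphB rmorphB !rmorphM.
move: (A t) (B n t) (N n t) => x y z; ring.
Qed.

Lemma bump_sum (lm tau eps t : R) : t < tau -> let s := eps * (tau - t)^-1 in
  bump lm tau eps 1 t + eps * bump lm tau eps 2 t = (1 + s) * expR (- s) * expR (lm * t).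
Proof.
move=> tt s; have t0 : tau - t != 0 by rewrite gt_eqF// subr_gt0.
rewrite /bump tt /s; move: (expR (- (eps * (tau - t)^-1))) (expR (lm * t)) => x y.
by field.
Qed.

(** The weight [(1 + s) e^{-s}] tends to 1 quadratically: the lower bound is [e^{-s} >= 1 - s], the
    upper one [e^s >= 1 + s]. *)
Lemma weight_itv (s : R) : 0 <= s -> 1 - s ^+ 2 <= (1 + s) * expR (- s) <= 1.
Proof.
move=> s0; apply/andP; split.
  have := expR_ge1Dx (- s) => /(ler_wpM2l (addr_ge0 ler01 s0)).
  by apply: le_trans; rewrite le_eqVlt; apply/orP; left; apply/eqP; ring.
by rewrite expRN ler_pdivrMr ?expR_gt0// mul1r expR_ge1Dx.
Qed.

Lemma weak_mild_ccont n : ccont (weak_mild n).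
Proof. by apply: duh_ccont; exact: forcing_tintegrable. Qed.

(** Letting eps = 1 / (j + 1) tend to 0 shows that [e^{lam t} (B - weak_mild)] has zero integral
    over every [[0, T]], hence vanishes almost everywhere. *)
Lemma weak_mild_ae n : {ae leb R, forall t, 0 <= t -> B n t = weak_mild n t}.
Proof.
have FF := ae_filter_ringOfSetsType (leb R).
pose l := lam nu n; have l0 : 0 <= l by exact: lam_ge0.
pose W t := B n t - weak_mild n t.
have cE : ccont (fun t => RC (expR (l * t))) by exact: ccont_expR.
have iW T : tintegrable T W.
  apply: cintegrableB => //; first exact: representative_tintegrable.
  by apply: ccont_tintegrable; exact: weak_mild_ccont.
have iF T : tintegrable T (fun t => RC (expR (l * t)) * W t) by exact: tintegrableM_ccont.
suff F0 T : 0 <= T -> tint T (fun t => RC (expR (l * t)) * W t) = 0.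
  apply: filterS (cprimitive_zero_ae iF F0) => t ht t0.
  have /eqP := ht t0; rewrite mulf_eq0 => /orP[/eqP/(congr1 (fun z : R[i] => cRe z))/=/eqP|].
    by rewrite gt_eqF// expR_gt0.
  by rewrite subr_eq0 => /eqP.
move=> T0; pose D := `[0, T]%classic : set R; have mD : measurable D by exact: measurable_itv.
(* The bumps vanish at [t = T], so the pointwise limit is cut off there; a single point does not
   change the integral. *)
pose G t : R[i] := if t < T then RC (expR (l * t)) * W t else 0.
have <- : cint (leb R) D G = tint T (fun t => RC (expR (l * t)) * W t).
  have nT : {ae leb R, forall y : R, y <> T}.
    exists [set T]; split; [exact: measurable_set1|exact: lebesgue_measure_set1|].
    by move=> y /=; apply: contra_notP.
  apply: complex_ext; apply: ae_eq_Rintegral => //; apply: filterS nT => t tT;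
    by rewrite /D/= in_itv/= => /andP[_]; rewrite le_eqVlt => /predU1P[//|tt]; rewrite /G tt.
pose e j : R := j.+1%:R^-1; have e0 j : 0 < e j by rewrite invr_gt0.
pose F j t := RC (bump l T (e j) 1 t + e j * bump l T (e j) 2 t) * W t.
have [m1 m2] : cmeas D W by have /cintegrableP[] := iW T.
apply: (@cint_dominated R D F G (fun t => expR (l * T) * cnorm (W t)) mD).
- move=> j; apply: cmeasM => //; apply: ccont_cmeas => //; apply: ccontR => t.
  by apply: cvgD; [|apply: cvgM; [exact: cvg_cst|]]; exact: bump_continuous.
- by apply: integrableRZ => //; apply: (@cintegrable_norm _ _ R (leb R)) => //; exact: iW.
- move=> j t; rewrite /D/= in_itv/= => /andP[t0 tT].
  rewrite Normc.normcM ler_wpM2r ?cnorm_ge0// cnormR.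
  move: tT; rewrite le_eqVlt => /predU1P[->|tt].
    by rewrite !bump0// mulr0 addr0 normr0 expR_ge0.
  rewrite bump_sum//; set s := e j * _.
  have s0 : 0 <= s by rewrite mulr_ge0 ?invr_ge0 ?subr_ge0 ?ltW.
  have /andP[_ h1] := weight_itv s0.
  rewrite ger0_norm ?mulr_ge0 ?addr_ge0 ?expR_ge0//.
  rewrite -[leRHS]mul1r ler_pM ?mulr_ge0 ?addr_ge0 ?expR_ge0// ler_expR.
  by rewrite ler_wpM2l// ltW.
- move=> t; rewrite /D/= in_itv/= => /andP[t0 tT].
  have [tt|tt] := ltP t T; last first.
    rewrite /G ltNge tt /=; apply: cvg_near_cst; apply: nearW => j.
    by rewrite /F !bump0// mulr0 addr0 [RC 0]/(0 : R[i]) mul0r subr0 cnorm0.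
  pose u := (T - t)^-1; have u0 : 0 <= u by rewrite invr_ge0 subr_ge0 ltW.
  (* With [s = e j * u] the error [s^2] is at most [u^2 * e j], because [e j <= 1]. *)
  pose K := u ^+ 2 * expR (l * t) * cnorm (W t).
  have K0 : 0 <= K by rewrite !mulr_ge0 ?expR_ge0 ?sqr_ge0 ?cnorm_ge0.
  apply: (@squeeze_cvgr _ _ _ _ (cst 0) (fun j => K * harmonic j)); last 2 first.
  + exact: cvg_cst.
  + by rewrite -[X in _ --> X](mulr0 K); apply: cvgM; [exact: cvg_cst|exact: cvg_harmonic].
  apply: nearW => j; rewrite cnorm_ge0/= /G tt /F bump_sum// -/u; set s := e j * u.
  have s0 : 0 <= s by rewrite mulr_ge0// invr_ge0.
  rewrite -mulrBl -rmorphB Normc.normcM cnormR.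
  have -> : K * harmonic j = u ^+ 2 * expR (l * t) * j.+1%:R^-1 * cnorm (W t).
    by rewrite /K/=; ring.
  rewrite ler_wpM2r ?cnorm_ge0//.
  have -> : (1 + s) * expR (- s) * expR (l * t) - expR (l * t) =
    ((1 + s) * expR (- s) - 1) * expR (l * t) by ring.
  have /andP[h1 h2] := weight_itv s0.
  rewrite normrM (ger0_norm (expR_ge0 _)) [leRHS]mulrAC ler_wpM2r ?expR_ge0//.
  rewrite ler0_norm ?subr_le0// opprB; apply: (@le_trans _ _ (s ^+ 2)).
    by rewrite lerBlDl -lerBlDr.
  rewrite /s exprMn mulrC ler_wpM2l ?sqr_ge0// expr2 ler_piMl ?(ltW (e0 j))//.
  by rewrite /e invf_le1 ?ler1n ?ltr0n.
- by move=> j; exact: weak_mild_identity.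
Qed.

Lemma weak_mild_ae_all : {ae leb R, forall t, 0 <= t -> B^~ t = weak_mild^~ t}.
Proof.
have FF := ae_filter_ringOfSetsType (leb R).
by apply: filterS (ae_foralln weak_mild_ae) => t ht t0; apply/funext => n; exact: ht.
Qed.

Lemma weak_mild_EN : EN_le nu weak_mild (fine (wsum w1 (modes f0)) + 2 * cth * (C * M)).
Proof.
move=> t t0; apply: le_trans (Sm_EN nu_gt0 (modes f0) forcing_tintegrable t0) _.
have [_ _ sf0] := (@wienerP R 1 f0).1 hf0.
rewrite EFinD fineK; first by rewrite leeD2l// forcing_int.
by rewrite ge0_fin_numE ?wsum_ge0// => k; exact: w1_ge0.
Qed.

(** At almost every time [weak_mild] equals B in all modes at once, so the two forcings have the
    same integrals and the equation closes on [weak_mild] itself. *)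
Lemma weak_mildP : mild nu cth (modes f0) weak_mild.
Proof.
have c_gt0 := @cth_gt0 R.
have mA n : cmeas setT (weak_mild n) by apply: ccont_cmeas => //; exact: weak_mild_ccont.
split; first exact: weak_mild_ccont.
  apply: (NN_tint nu_gt0 c_gt0 mA weak_mild_EN).
  rewrite addr_ge0 ?fine_ge0 ?wsum_ge0// ?mulr_ge0 ?(ltW c_gt0)// => k; exact: w1_ge0.
move=> n t; pose l := lam nu n.
have e : tint t (fun s => RC (expR (l * s)) * N n s) =
    tint t (fun s => RC (expR (l * s)) * NN nu cth weak_mild weak_mild n s).
  have FF := ae_filter_ringOfSetsType (leb R).
  by apply: complex_ext; apply: ae_eq_Rintegral => //; apply: filterS weak_mild_ae_all => s hs;
    rewrite /= in_itv/= => /andP[/hs e _]; rewrite /N /NN e.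
exact: (congr1 (fun z => RC (expR (- (l * t))) * (modes f0 n + z)) e).
Qed.

Lemma weak_solution_modes (a : nat -> R -> R[i]) : mild nu cth (modes f0) a -> EN_le nu a 2^-1 ->
  {ae leb R, forall t, 0 <= t -> modes (h t) = a^~ t}.
Proof.
move=> ma aE; have FF := ae_filter_ringOfSetsType (leb R).
apply: filterS2 BE weak_mild_ae_all => t e1 e2 t0.
have -> : modes (h t) = B^~ t by apply/funext => n; rewrite e1.
rewrite e2//; apply/funext => n.
exact: (mild_unique nu_gt0 (@cth_gt0 R) (@cth_lt R) ma weak_mildP aE weak_mild_EN n t0).
Qed.

End WeakSolutionDuhamel.

(** * From modes back to functions on the circle *)

Section Conclusion.
Context {R : realType}.
Variables (nu : R) (f0 : R -> R) (a : nat -> R -> R[i]).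
Hypotheses (nu_gt0 : 0 < nu) (hf0 : wiener 1 f0).
Hypotheses (hm : mild nu cth (modes f0) a) (hE : EN_le nu a 2^-1).
Let f t := synth (a^~ t).

Lemma mild_initial : {ae leb R, forall x, f 0 x = f0 x}.
Proof.
have [pf0 [if0 f00] sf0] := (@wienerP R 1 f0).1 hf0.
have sal : summable_seq (modes f0) by apply: wsum_summable sf0 => k; exact: wpow_ge1.
have a0 : a^~ 0 = modes f0.
  apply/funext => n; have [_ _ ->] := hm; rewrite /Sm /duh mulr0 oppr0 expR0 mul1r.
  by rewrite /tint set_itv1 /cint !Rintegral_set1 addr0.
rewrite /f a0; apply: periodic_ae => //; first exact: synth_periodic.
have FF := ae_filter_ringOfSetsType (leb R).
by apply: filterS (synth_modes if0 f00 sal) => x hx /hx.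
Qed.

Lemma mild_weak_unique (h : R -> R -> R) : global_solution nu f0 h ->
  {ae leb R, forall t, 0 <= t -> {ae leb R, forall x, h t x = f t x}}.
Proof.
move=> [hL hV he]; have FF := ae_filter_ringOfSetsType (leb R).
have [B [M [C [[M0 C0] mB bB BE iB4]]]] := weak_solution_representative nu_gt0 hL hV.
have [wh _ _] := hL.
apply: filterS (weak_solution_modes nu_gt0 hf0 wh he M0 C0 mB bB BE iB4 hm hE) => t ht t0.
have [pht [iht ht0] fht] := (@wienerP R 1 (h t)).1 (wh _ t0).
have sht : summable_seq (modes (h t)) by apply: wsum_summable fht => k; exact: wpow_ge1.
apply: periodic_ae => //; first exact: synth_periodic.
by rewrite /f -ht//; exact: synth_modes.
Qed.

Lemma mild_wiener_norm0_decay t : (wiener_norm 1 f0 <= (2^-1)%:E)%E -> 0 <= t ->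
  (wiener_norm 0 (f t) <= wiener_norm 0 f0 *
    (expR (- (1 - 2 * fine (wiener_norm 1 f0)) * (1 + nu) * t))%:E)%E.
Proof.
move=> small t0.
have [pf0 [if0 f00] sf0] := (@wienerP R 1 f0).1 hf0.
have nE : wiener_norm 1 f0 = (2%:E * wsum w1 (modes f0))%E := @wiener_normE R 1 f0 if0 f00.
have [A AE] : exists A, wsum w1 (modes f0) = A%:E.
  exists (fine (wsum w1 (modes f0))); rewrite fineK// ge0_fin_numE//.
  by apply: wsum_ge0 => k; exact: w1_ge0.
have A4 : A <= 4^-1 by move: small; rewrite nE AE -EFinM lee_fin; lra.
have st := mild_summable nu_gt0 hE t0.
have e0 z : wsum (wpow 0) z = wsum w0 z by [].
rewrite (@wiener_normE R 0 _ (synth_cintble st)) ?fourier_synth// modes_synth//.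
rewrite (@wiener_normE R 0 _ if0 f00) -muleA lee_wpmul2l// !e0 nE AE.
apply: le_trans (mild_A0_decay nu_gt0 (@cth_gt0 R) (@cth_lt R) hm hE t0 AE A4) _.
apply: lee_wpmul2l; first by apply: wsum_ge0 => k; exact: w0_ge0.
(* The A^1 norm of the datum is 2 A, so [1 - 4 A] is the stated rate. *)
rewrite lee_fin ler_expR le_eqVlt; apply/orP; left; apply/eqP.
by rewrite -EFinM/=; ring.
Qed.

End Conclusion.

Theorem theorem2p5 (R : realType) (nu : R) (hnu : 0 < nu) (f0 : R -> R)
    (hf0 : wiener 1 f0) (hsmall : (wiener_norm 1 f0 < (1 / 2)%:E)%E) :
  exists f : R -> R -> R,
    [/\ global_solution nu f0 f,
        weakly_continuous f /\ {ae leb R, forall x, f 0 x = f0 x},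
        forall h : R -> R -> R, global_solution nu f0 h ->
          {ae leb R, forall t, 0 <= t -> {ae leb R, forall x, h t x = f t x}}
      & forall t : R, 0 <= t ->
          (wiener_norm 1 (f t) <= wiener_norm 1 f0)%E /\
          (wiener_norm 0 (f t) <= wiener_norm 0 f0 *
             (expR (- (1 - 2 * fine (wiener_norm 1 f0)) * (1 + nu) * t))%:E)%E].
Proof.
have [_ [if0 f00] sf0] := (@wienerP R 1 f0).1 hf0.
have nE : wiener_norm 1 f0 = (2%:E * wsum w1 (modes f0))%E := @wiener_normE R 1 f0 if0 f00.
have small : (wsum w1 (modes f0) <= (4^-1)%:E)%E.
  move: hsmall; rewrite nE; case: (wsum _ _) => [A| |].
  - by rewrite -EFinM lte_fin lee_fin; lra.
  - by rewrite gt0_muley ?lte_fin.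
  - by rewrite leNye.
have [a [ca ta ea hE]] := mild_existence hnu (@cth_gt0 R) (@cth_lt R) small.
have hm : mild nu cth (modes f0) a by split.
exists (fun t => synth (a^~ t)); split.
- split; [exact: mild_Linfty hnu hm hE|exact: mild_vmeasure hnu hm hE|].
  exact: mild_weak_equation hnu hf0 hm hE.
- by split; [exact: mild_weakly_continuous hnu hm hE|exact: (mild_initial hf0 hm)].
- by move=> h; exact: (mild_weak_unique hnu hf0 hm hE).
- move=> t t0; split.
    by rewrite nE; exact: mild_wiener_norm1 hnu hm hE _ t0.
  apply: (mild_wiener_norm0_decay hnu hf0 hm hE) => //; apply: le_trans (ltW hsmall) _; rewrite
    lee_fin; lra.
Qed.
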